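(* Let $\underline s=(s_1,\dots,s_r)\in\mathbb R^r$ with all $s_k>0$. If there is a positive measure $\mathcal R^*_{\underline s}$ on $V$ with Laplace transform $\theta\mapsto\Delta_{-\underline s}(\theta)$ on $\Omega$, then for $m\in\Omega=\Omega^*$ $$\mathbb V_{F(\mathcal R^*_{\underline s})}(m)=\frac1{s_1}\mathbb P(m)+\sum_{i=2}^r\left(\frac1{s_i}-\frac1{s_{i-1}}\right)\mathbb P\left(m-[P_{i-1}m^{-1}]^{-1}_0\right).$$ If there is a positive measure $\mathcal R_{\underline s}$ on $V$ with Laplace transform $\theta\mapsto\Delta_{\underline s}(\theta^{-1})$ on $\Omega$, then for $m\in\Omega$ $$\mathbb V_{F(\mathcal R_{\underline s})}(m)=\frac1{s_r}\mathbb P(m)+\sum_{k=1}^{r-1}\left(\frac1{s_k}-\frac1{s_{k+1}}\right)\mathbb P\left(m-[P^*_{r-k}m^{-1}]^{-1}_0\right).$$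
   Context: $V$ is a simple Euclidean Jordan algebra of rank $r$ with inner product $\langle x,y\rangle=\mathrm{tr}(xy)$ (Jordan trace), $\Omega$ its associated irreducible symmetric cone, and $\mathbb P$ the quadratic representation, $\mathbb P(x)=2\mathbb L(x)^2-\mathbb L(x^2)$ with $\mathbb L(x)y=xy$. For an idempotent $c$, $V(c,1)$ is the eigenspace of $\mathbb L(c)$ for the eigenvalue $1$ (a subalgebra with unit $c$). Fix a Jordan frame $(c_1,\dots,c_r)$ and put $V^{(k)}=V(c_1+\dots+c_k,1)$, $W^{(k)}=V(c_{r-k+1}+\dots+c_r,1)$. $P_k$ and $P_k^*$ are the orthogonal projections of $V$ onto $V^{(k)}$ and $W^{(k)}$, respectively. $[\cdot]_0$ denotes the inclusion of the subalgebras $V^{(k)}$, $W^{(k)}$ into $V$; in $[P_{i-1}m^{-1}]_0^{-1}$ and $[P^*_{r-k}m^{-1}]_0^{-1}$ the outer inverse is taken in the subalgebra $V^{(i-1)}$, respectively $W^{(r-k)}$, before inclusion. The generalized power function with respect to the frame is $\Delta_{\underline s}(x)=\Delta_1(x)^{s_1-s_2}\cdots\Delta_{r-1}(x)^{s_{r-1}-s_r}\Delta_r(x)^{s_r}$ on $\Omega$, where $\Delta_k(x)$ is the determinant of $P_kx$ in the Jordan algebra $V^{(k)}$. The Laplace transform of a positive measure $\mu$ on $V$ is $L_\mu(\theta)=\int e^{-\langle\theta,x\rangle}\mu(dx)$. For $\mu$ not concentrated on an affine hyperplane and with $\Theta(\mu)=\mathrm{int}\{L_\mu<\infty\}\neq\emptyset$,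 let $k_\mu=\log L_\mu$ and $F(\mu)=\{e^{-\langle\theta,x\rangle-k_\mu(\theta)}\mu(dx):\theta\in\Theta(\mu)\}$ (natural exponential family). The mean map $m_\mu=-k_\mu'$ is a diffeomorphism of $\Theta(\mu)$ onto the domain of means, with inverse $\psi_\mu$; the variance function is $\mathbb V_{F(\mu)}(m)=k_\mu''(\psi_\mu(m))=-[\psi_\mu'(m)]^{-1}$, a symmetric linear operator on $V$. For the measures in the claim $\Theta(\mu)=\Omega$ and the domain of means is $\Omega$. *)

(* Defs.v *)
From mathcomp Require Import all_boot all_order all_algebra.
From mathcomp Require Import all_classical all_reals all_analysis.

Set Implicit Arguments.
Unset Strict Implicit.
Unset Printing Implicit Defensive.

Import Order.TTheory GRing.Theory Num.Theory.
Import numFieldNormedType.Exports.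

Local Open Scope classical_set_scope.
Local Open Scope ring_scope.

(** The Jordan algebra is a finite-dimensional real vector space [V] with a
    product [mul] and a unit [e].  The norm of [V] only provides the topology:
    all norms on a finite-dimensional space are equivalent, and it plays no
    other role. *)

Section JordanAlgebra.
Context {R : realType} {V : normedModType R} (mul : V -> V -> V).

Local Notation "x ** y" := (mul x y) (at level 40, left associativity).

Record jordan_algebra (e : V) : Prop := JordanAlgebra {
  jordan_mulC : commutative mul ;
  jordan_mul_linear : forall x, linear (mul x) ;
  jordan_mul1 : left_id e mul ;
  jordan_identity : forall x y, x ** ((x ** x) ** y) = (x ** x) ** (x ** y)
}.

Definition finite_dimensional : Prop :=
  exists n (f : {linear 'rV[R]_n -> V}), bijective f.

Definition associative_inner_product (B : V -> V -> R) : Prop :=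
  [/\ forall x y, B x y = B y x,
      forall x, scalar (B x),
      forall x, x != 0 -> 0 < B x x &
      forall x y z, B (x ** y) z = B y (x ** z)].

Record euclidean_jordan_algebra (e : V) : Prop := EuclideanJordanAlgebra {
  euclidean_jordan : jordan_algebra e ;
  euclidean_finite_dimensional : finite_dimensional ;
  euclidean_form : exists B, associative_inner_product B
}.

Definition jordan_ideal (I : set V) : Prop :=
  [/\ I 0,
      forall (a : R) x y, I x -> I y -> I (a *: x + y) &
      forall x y, I y -> I (x ** y)].

Definition simple_euclidean_jordan_algebra (e : V) : Prop :=
  [/\ euclidean_jordan_algebra e,
      e != 0 &
      forall I, jordan_ideal I -> I = [set 0] \/ I = [set: V]].

(** The quadratic representation $2 L(x)^2 - L(x^2)$. *)
Definition qrep (x y : V) : V := 2 *: (x ** (x ** y)) - (x ** x) ** y.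

(** For an idempotent [u], [peirce1 u] is the subalgebra $V(u,1)$, with unit
    [u].  The notions below are relative to such a subalgebra and are indexed
    by [u]; [u = e] gives the whole algebra, as $V(e,1) = V$. *)
Definition peirce1 (u : V) : set V := [set x | u ** x = x].

Definition idempotent_elt (c : V) : Prop := c ** c = c.

Definition primitive_idempotent (u c : V) : Prop :=
  [/\ peirce1 u c, idempotent_elt c, c != 0 &
      forall a b, peirce1 u a -> peirce1 u b ->
        idempotent_elt a -> idempotent_elt b -> c = a + b -> a = 0 \/ b = 0].

Definition jordan_frame (u : V) (c : seq V) : Prop :=
  [/\ forall i, (i < size c)%N -> primitive_idempotent u c`_i,
      forall i j, (i < size c)%N -> (j < size c)%N -> i != j ->
        c`_i ** c`_j = 0 &
      \sum_(x <- c) x = u].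

(** [x] is $\sum_i l_i c_i$ in $V(u,1)$; the entries of [l] are the
    eigenvalues of [x], which are unique up to order. *)
Definition spectral_decomposition (u x : V) (c : seq V) (l : seq R) : Prop :=
  [/\ jordan_frame u c, size l = size c &
      x = \sum_(0 <= i < size c) l`_i *: c`_i].

Definition jdet (u x : V) : R :=
  get [set d : R | exists c l,
    spectral_decomposition u x c l /\ d = \prod_(a <- l) a].

Definition jtr (u x : V) : R :=
  get [set t : R | exists c l,
    spectral_decomposition u x c l /\ t = \sum_(a <- l) a].

Fixpoint jpow (u x : V) (n : nat) : V :=
  if n is n'.+1 then x ** jpow u x n' else u.

(** [jhorner u p x] is $p(x)$, evaluated in the algebra with unit [u]. *)
Definition jhorner (u : V) (p : {poly R}) (x : V) : V :=
  \sum_(i < size p) p`_i *: jpow u x i.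

(** The inverse of [x] in $V(u,1)$ is the [y] in $\mathbb{R}[x]$ such that
    $xy = u$; requiring [y] to be a polynomial in [x] makes it unique. *)
Definition jinv (u x : V) : V :=
  get [set y : V | x ** y = u /\ exists p, y = jhorner u p x].

Variable e : V.

Definition ip (x y : V) : R := jtr e (x ** y).

(** The orthogonal projection of $V$ onto $V(u,1)$. *)
Definition orth_proj (u x : V) : V :=
  get [set y : V | peirce1 u y /\ forall z, peirce1 u z -> ip (x - y) z = 0].

Definition symmetric_cone : set V := [set x : V | exists y, x = y ** y]°.

(** $c_1 + \dots + c_k$ and $c_{r-k+1} + \dots + c_r$: the units of $V^{(k)}$
    and $W^{(k)}$. Sequences are indexed from [0], so that $c_i$ is
    [c`_i.-1]. *)
Definition frame_first (c : seq V) (k : nat) : V := \sum_(0 <= i < k) c`_i.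

Definition frame_last (c : seq V) (k : nat) : V :=
  \sum_(size c - k <= i < size c) c`_i.

(** $\Delta_k(x)$, the determinant of $P_k x$ in $V^{(k)}$. *)
Definition principal_minor (c : seq V) (k : nat) (x : V) : R :=
  jdet (frame_first c k) (orth_proj (frame_first c k) x).

(** $\Delta_{\underline s}(x)$; $s_k$ is [s`_k.-1]. *)
Definition gpower (r : nat) (c : r.-tuple V) (s : r.-tuple R) (x : V) : R :=
  (\prod_(1 <= k < r) principal_minor c k x `^ (s`_k.-1 - s`_k))
  * principal_minor c r x `^ s`_r.-1.

End JordanAlgebra.

Definition borelType (T : ptopologicalType) := g_sigma_algebraType (@open T).

Section NaturalExponentialFamily.
Context {R : realType} {V : normedModType R} (B : V -> V -> R).

(** [B] is the inner product that identifies [V] with its dual. *)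
Definition gradient (f : V -> R) (x : V) : V :=
  get [set g : V | forall h, 'd f x h = B g h].

Variable mu : {measure set (borelType V) -> \bar R}.

Definition laplace_transform (theta : V) : \bar R :=
  (\int[mu]_x (expR (- B theta x))%:E)%E.

Definition canonical_domain : set V :=
  [set theta | (laplace_transform theta < +oo)%E]°.

Definition cumulant (theta : V) : R := ln (fine (laplace_transform theta)).

Definition mean_map (theta : V) : V := - gradient cumulant theta.

(** $\psi_\mu$: the inverse of the mean map, from the domain of means
    [mean_map @` canonical_domain] onto [canonical_domain]. *)
Definition inverse_mean_map : V -> V :=
  'pinv_(fun=> 0) canonical_domain mean_map.

(** $k_\mu''(\psi_\mu(m))$ as an operator on [V]: the derivative of the
    gradient of the cumulant function. *)
Definition variance_function (m : V) : V -> V :=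
  'd (gradient cumulant) (inverse_mean_map m).

End NaturalExponentialFamily.

(* Main.v *)
(** Put $W_k = [(P_k\theta)^{-1}]_0$.  On $\Omega$ the cumulant function is
    $-\sum_k s_k(\ln\Delta_k - \ln\Delta_{k-1})$, the gradient of
    $\ln\Delta_k$ is $W_k$, and the derivative of $W_k$ is $-\mathbb{P}(W_k)$;
    hence the mean is $m = \sum_k s_k q_k$ with $q_k = W_k - W_{k-1}$, and the
    variance is $\sum_k s_k(\mathbb{P}(W_k) - \mathbb{P}(W_{k-1}))$.  By Schur
    complements, $q_k$ is a positive multiple of $c_k + z + (z^2)_0$ with
    $z \in V_{1/2}(c_k)$, and conversely, rescaling such increments by
    positive factors $t_k$ turns the family $W_k$ into the family
    $[(P_k y^{-1})^{-1}]_0$ of another element $y$ of the cone.  Therefore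
    $[P_k m^{-1}]_0^{-1} = \sum_{j \le k} s_j q_j$, the mean map is a bijection
    of $\Omega$, and the formula for the variance is an identity between
    quadratic expressions in the $q_k$.  The canonical domain is $\Omega$
    because the Laplace transform is bounded on the segments where it is
    finite, while the power function blows up at the boundary of $\Omega$.

    The second formula is the first one for the reversed frame, by
    $\Delta_k(\theta^{-1})\det\theta = \Delta^*_{r-k}(\theta)$.

    The derivative of $\ln\det$ comes from
    $\ln\det y - \ln\det x \le \langle x^{-1}, y - x\rangle$, which is Jensen's
    inequality for the doubly stochastic matrix of the products of two Jordan
    frames.  Linearity of the trace uses simplicity: two primitive idempotents
    that are not orthogonal have the same norm for any associative inner
    product, so that all of them do, and the trace form is proportional to the
    given inner product. *)
Require Import Defs.
From HB Require Import structures.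
From mathcomp Require Import all_boot all_order all_algebra.
From mathcomp Require Import all_classical all_reals all_analysis.
From mathcomp Require Import measurable_realfun complex ring lra zify.

Set Implicit Arguments.
Unset Strict Implicit.
Unset Printing Implicit Defensive.

Import Order.TTheory GRing.Theory Num.Theory.
Import numFieldNormedType.Exports.

Local Open Scope classical_set_scope.
Local Open Scope ring_scope.

(** Determinant, trace and inverse are picked from existential descriptions, so nothing about them
    is polynomial or smooth by construction. The Jensen bound for $\ln\det$ makes up for this,
    because it can be used in both directions: between two decompositions of one element it shows
    that the determinant is well defined; between $x$ and $x+h$ it leaves a remainder of order
    $|h|^2$, once the inverse is known to be Lipschitz; along a curve of rank-one lifts it shows
    that the determinant does not move. Positivity is positive definiteness of $L(x)$ on $V(u,1)$:
    it passes to compressions by self-adjointness and gives the coercive estimates for the inverse.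

    The factors $t_k$ can be changed independently of each other because, for $m$ positive in
    $V(u,1)$, compressing the inverse of $m$ plus a positive multiple of a rank-one lift returns the
    inverse of $m$, whatever the multiple and the lift. The mean uses $t=s$, and its preimage
    $t=1/s$. *)

Section EuclideanJordan.
Context {R : realType} {V : normedModType R} (mul : V -> V -> V) (e : V) (B : V -> V -> R).
Hypothesis HJ : euclidean_jordan_algebra mul e.
Hypothesis HB : associative_inner_product mul B.

Local Notation "x ** y" := (mul x y) (at level 40, left associativity).

(** * Bilinear calculus and the linearized Jordan identity *)

Lemma jmulC x y : x ** y = y ** x.
Proof. by have [[]] := HJ. Qed.

Lemma jmulP a x y z : x ** (a *: y + z) = a *: (x ** y) + x ** z.
Proof. by have [[_ H _ _] _ _] := HJ; exact: H. Qed.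

Lemma jmulDr x y z : x ** (y + z) = x ** y + x ** z.
Proof. by rewrite -[y in LHS]scale1r jmulP scale1r. Qed.

Lemma jmul0r x : x ** 0 = 0.
Proof. by apply: (addrI (x ** 0)); rewrite -jmulDr !addr0. Qed.

Lemma jmulZr a x y : x ** (a *: y) = a *: (x ** y).
Proof. by rewrite -[a *: y]addr0 jmulP jmul0r addr0. Qed.

Lemma jmulNr x y : x ** - y = - (x ** y).
Proof. by rewrite -scaleN1r jmulZr scaleN1r. Qed.

Lemma jmulDl x y z : (x + y) ** z = x ** z + y ** z.
Proof. by rewrite !(jmulC _ z) jmulDr. Qed.

Lemma jmul0l x : 0 ** x = 0.
Proof. by rewrite jmulC jmul0r. Qed.

Lemma jmulZl a x y : (a *: x) ** y = a *: (x ** y).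
Proof. by rewrite jmulC jmulZr jmulC. Qed.

Lemma jmulNl x y : (- x) ** y = - (x ** y).
Proof. by rewrite jmulC jmulNr jmulC. Qed.

Lemma jmul1l x : e ** x = x.
Proof. by have [[_ _ H _] _ _] := HJ; exact: H. Qed.

Lemma jmul1r x : x ** e = x.
Proof. by rewrite jmulC jmul1l. Qed.

Lemma jordanI x y : x ** ((x ** x) ** y) = (x ** x) ** (x ** y).
Proof. by have [[_ _ _ H] _ _] := HJ; exact: H. Qed.

Lemma jmul_suml (I : Type) (r : seq I) (P : pred I) (F : I -> V) y :
  (\sum_(i <- r | P i) F i) ** y = \sum_(i <- r | P i) F i ** y.
Proof.
by apply: (big_morph (fun x => x ** y)); [move=> a b; exact: jmulDl | exact: jmul0l].
Qed.

Lemma jmul_sumr (I : Type) (r : seq I) (P : pred I) (F : I -> V) y :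
  y ** (\sum_(i <- r | P i) F i) = \sum_(i <- r | P i) y ** F i.
Proof. by rewrite jmulC jmul_suml; apply: eq_bigr => i _; rewrite jmulC. Qed.

Lemma BC x y : B x y = B y x.
Proof. by have [] := HB. Qed.

Lemma BP a x y z : B x (a *: y + z) = a * B x y + B x z.
Proof. by have [_ H _ _] := HB; have := H x a y z; apply. Qed.

Lemma BDr x y z : B x (y + z) = B x y + B x z.
Proof. by rewrite -[y in LHS]scale1r BP mul1r. Qed.

Lemma B0r x : B x 0 = 0.
Proof. by apply: (addrI (B x 0)); rewrite -BDr !addr0. Qed.

Lemma BZr a x y : B x (a *: y) = a * B x y.
Proof. by rewrite -[a *: y]addr0 BP B0r addr0. Qed.

Lemma BNr x y : B x (- y) = - B x y.
Proof. by rewrite -scaleN1r BZr mulN1r. Qed.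

Lemma BDl x y z : B (x + y) z = B x z + B y z.
Proof. by rewrite !(BC _ z) BDr. Qed.

Lemma B0l x : B 0 x = 0.
Proof. by rewrite BC B0r. Qed.

Lemma BZl a x y : B (a *: x) y = a * B x y.
Proof. by rewrite BC BZr BC. Qed.

Lemma BNl x y : B (- x) y = - B x y.
Proof. by rewrite BC BNr BC. Qed.

Lemma B_gt0 x : x != 0 -> 0 < B x x.
Proof. by have [_ _ H _] := HB; exact: H. Qed.

Lemma B_ge0 x : 0 <= B x x.
Proof. by have [->|/B_gt0/ltW//] := eqVneq x 0; rewrite B0r. Qed.

Lemma B_eq0 x : B x x = 0 -> x = 0.
Proof. by move=> H; apply/eqP; apply: contraT => /B_gt0; rewrite H ltxx. Qed.

Lemma Bassoc x y z : B (x ** y) z = B y (x ** z).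
Proof. by have [_ _ _ H] := HB; exact: H. Qed.

Lemma B_suml (I : Type) (r : seq I) (P : pred I) (F : I -> V) y :
  B (\sum_(i <- r | P i) F i) y = \sum_(i <- r | P i) B (F i) y.
Proof.
by apply: (big_morph (fun x => B x y)); [move=> a b; exact: BDl | exact: B0l].
Qed.

Lemma B_sumr (I : Type) (r : seq I) (P : pred I) (F : I -> V) y :
  B y (\sum_(i <- r | P i) F i) = \sum_(i <- r | P i) B y (F i).
Proof. by rewrite BC B_suml; apply: eq_bigr => i _; rewrite BC. Qed.

Lemma B_ext x y : (forall w, B x w = B y w) -> x = y.
Proof.
move=> H; apply/eqP; rewrite -subr_eq0; apply/eqP/B_eq0.
by rewrite BDl BNl H subrr.
Qed.

Definition jmulE := (jmulDl, jmulDr, jmulNl, jmulNr, jmulZl, jmulZr, jmul0l, jmul0r).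
Definition BlE := (BDl, BNl, BZl, B0l).
Definition BrE := (BDr, BNr, BZr, B0r).

(* Vector identities are checked after pairing with an arbitrary vector, which
   turns them into identities of real numbers. *)
Ltac pair_with w := apply: B_ext => w; rewrite ?(BDl, BNl, BZl, B0l, mulr1n, mulr0n).
Ltac pair_eq H w := move/(congr1 (fun v => B v w)): H; rewrite ?(BDl, BNl, BZl, B0l, mulr1n, mulr0n) => H.

(** Polarization: inclusion-exclusion over the partial sums of [a], [b], [d] isolates the part of
    the Jordan identity that is linear in each of them. The Peirce rules below are substitutions
    into this identity or into [jordan_op]. *)
Lemma jordan4 a b d y :
  (a ** b) ** (d ** y) + (b ** d) ** (a ** y) + (d ** a) ** (b ** y) =
  d ** ((a ** b) ** y) + a ** ((b ** d) ** y) + b ** ((d ** a) ** y).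
Proof.
have H1 := jordanI (a + b + d) y; have H2 := jordanI (a + b) y.
have H3 := jordanI (b + d) y; have H4 := jordanI (a + d) y.
have H5 := jordanI a y; have H6 := jordanI b y; have H7 := jordanI d y.
rewrite !jmulE in H1 H2 H3 H4 H5 H6 H7.
rewrite !(jmulC b a) !(jmulC d a) !(jmulC d b) in H1 H2 H3 H4 *.
pair_with w.
pair_eq H1 w; pair_eq H2 w; pair_eq H3 w; pair_eq H4 w.
pair_eq H5 w; pair_eq H6 w; pair_eq H7 w.
lra.
Qed.

(* The left-hand side of [jordan4] is symmetric in all four variables. *)
Lemma jordan4_swap a b d y :
  d ** ((a ** b) ** y) + a ** ((b ** d) ** y) + b ** ((d ** a) ** y) =
  d ** ((a ** y) ** b) + a ** ((y ** d) ** b) + y ** ((d ** a) ** b).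
Proof.
have H := jordan4 a y d b; rewrite -jordan4.
rewrite !(jmulC y d) !(jmulC y b) (jmulC (a ** y) (d ** b)) (jmulC d b) in H *.
rewrite (jmulC (d ** y) (a ** b)) in H.
by pair_with w; pair_eq H w; lra.
Qed.

(** Operator form: $L((ad)b)$ is expressed through products of multiplications by shorter words.
    This is the recursion behind [generated_comm]. *)
Lemma jordan_op a b d y :
  a ** (b ** (d ** y)) + d ** (b ** (a ** y)) + ((a ** d) ** b) ** y =
  (a ** b) ** (d ** y) + (b ** d) ** (a ** y) + (a ** d) ** (b ** y).
Proof.
have H1 := jordan4 a b d y; have H2 := jordan4_swap a b d y.
rewrite -{}H1 in H2; rewrite (jmulC d a) in H2; rewrite H2.
rewrite (jmulC (a ** y) b) (jmulC (y ** d) b) (jmulC y d) (jmulC y (a ** d ** b)).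
by pair_with w; lra.
Qed.

Definition idem (c : V) := c ** c = c.

(** * Peirce eigenspaces of one idempotent *)

Section Peirce.
Variable c : V.
Hypothesis cc : idem c.

(** As an operator identity, $L(c)(L(c)-1)(2L(c)-1)=0$: the possible eigenvalues of $L(c)$ are 0,
    1/2 and 1. *)
Lemma peirce_cubic v : 2 *: (c ** (c ** (c ** v))) = 3 *: (c ** (c ** v)) - c ** v.
Proof.
have := jordan_op c c c v; rewrite !cc => H.
by pair_with w; pair_eq H w; lra.
Qed.

(** Substituting $c,c,x$ in [jordan4] leaves $(2l-1)[L(c),L(x)]=0$. *)
Lemma peirce_comm_op l x v : c ** x = l *: x -> l != 2^-1 ->
  c ** (x ** v) = x ** (c ** v).
Proof.
move=> cx lh; have := jordan4 c c x v; rewrite cc (jmulC x c) cx !jmulE => H.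
have : (2 * l - 1) *: (c ** (x ** v) - x ** (c ** v)) = 0.
  by pair_with w; pair_eq H w; lra.
move/eqP; rewrite scaler_eq0 subr_eq0 (can2_eq (mulKf _) (mulVKf _)) ?pnatr_eq0//.
by rewrite mulr1 (negbTE lh) /= subr_eq0 => /eqP.
Qed.

(** $L(c)^2=L(c)$ on the product excludes the eigenvalue 1/2, that is, $V_{1/2}V_{1/2}\subset
    V_0+V_1$. *)
Lemma peirce_half_mul x y : c ** x = 2^-1 *: x -> c ** y = 2^-1 *: y ->
  c ** (c ** (x ** y)) = c ** (x ** y).
Proof.
move=> cx cy; have := jordan4 x y c c; rewrite cc (jmulC y c) (jmulC x c) cx cy.
rewrite !jmulE !(jmulC _ c) cx cy !jmulE !(jmulC y x) => H.
by pair_with w; pair_eq H w; lra.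
Qed.

End Peirce.

(** * Systems of orthogonal idempotents *)

Definition orth_system n (d : 'I_n -> V) :=
  (forall i, idem (d i)) /\ (forall i j, i != j -> d i ** d j = 0).

Section OrthSystem.
Variables (n : nat) (d : 'I_n -> V).
Hypothesis d_orth : orth_system d.

Lemma osys_mul i j : d i ** d j = (i == j)%:R *: d i.
Proof.
have [d1 d0] := d_orth; have [<-|/d0 ->] := eqVneq i j; last by rewrite scale0r.
by rewrite scale1r d1.
Qed.

Lemma osys_mul_sum (l m : 'I_n -> R) :
  (\sum_i l i *: d i) ** (\sum_i m i *: d i) = \sum_i (l i * m i) *: d i.
Proof.
rewrite jmul_suml; apply: eq_bigr => i _; rewrite jmul_sumr (bigD1 i)//=.
rewrite big1 ?addr0 => [|j ji]; first by rewrite !jmulE osys_mul eqxx scale1r scalerA.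
by rewrite !jmulE osys_mul eq_sym (negbTE ji) !(scale0r, scaler0).
Qed.

Lemma osys_comm i j v : d i ** (d j ** v) = d j ** (d i ** v).
Proof.
have [->//|ij] := eqVneq i j; have [d1 d0] := d_orth.
apply: (@peirce_comm_op (d i) (d1 i) 0); rewrite ?d0 ?scale0r//.
by rewrite eq_sym invr_eq0 pnatr_eq0.
Qed.

Lemma osys_pair i j v : i != j -> d i ** (d i ** (d j ** v)) = 2^-1 *: (d i ** (d j ** v)).
Proof.
move=> ij; have [d1 d0] := d_orth; have := jordan_op (d i) (d j) (d i) v.
rewrite (jmulC (d j) (d i)) (d1 i) (d0 _ _ ij) !jmulE.
rewrite !(osys_comm j i) => H; by pair_with w; pair_eq H w; lra.
Qed.

Lemma osys_triple i j k v : i != j -> j != k -> i != k ->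
  d i ** (d j ** (d k ** v)) = 0.
Proof.
move=> ij jk ik; have [d1 d0] := d_orth; have := jordan_op (d i) (d j) (d k) v.
rewrite !d0// !jmulE !addr0 (osys_comm k j) (osys_comm k i) (osys_comm j i).
rewrite (osys_comm j k) => H; by pair_with w; pair_eq H w; lra.
Qed.

(* For [i != j], [peirce_comp i j + peirce_comp j i] is the projection onto
   $V_{ij}$; [peirce_comp i i] is the projection onto $V_{ii}$. *)
Definition peirce_comp (i j : 'I_n) (v : V) : V :=
  2 *: (d i ** (d j ** v)) - (i == j)%:R *: (d i ** v).

Local Notation F := peirce_comp.

Lemma peirce_comp_eigen k i j v :
  d k ** F i j v = (((k == i)%:R + (k == j)%:R) / 2) *: F i j v.
Proof.
have [d1 d0] := d_orth; rewrite /F; have [<-|ij] := eqVneq i j.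
  have [->|ki] := eqVneq k i.
    have := peirce_cubic (d1 i) v => H; rewrite !jmulE.
    by pair_with w; pair_eq H w; lra.
  rewrite !jmulE !(osys_comm k i) osys_pair 1?eq_sym//.
  by pair_with w; lra.
rewrite scale0r subr0 !jmulE.
have [->|ki] := eqVneq k i.
  by rewrite osys_pair// (negbTE ij); pair_with w; lra.
have [->|kj] := eqVneq k j.
  by rewrite (osys_comm i j) osys_pair 1?eq_sym//; pair_with w; lra.
by rewrite osys_triple//; pair_with w; lra.
Qed.

Lemma peirce_comp_mul (l : 'I_n -> R) i j v :
  (\sum_k l k *: d k) ** F i j v = ((l i + l j) / 2) *: F i j v.
Proof.
have sum_delta p : \sum_k l k * (k == p)%:R = l p.
  rewrite (bigD1 p)//= eqxx mulr1 big1 ?addr0// => k /negbTE ->.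
  by rewrite mulr0.
rewrite jmul_suml; under eq_bigr do rewrite jmulZl peirce_comp_eigen scalerA.
rewrite -scaler_suml; congr (_ *: _).
under eq_bigr do rewrite mulrA mulrDr.
by rewrite -mulr_suml big_split /= !sum_delta.
Qed.

Lemma peirce_comp_sym i j v w : B (F i j v) w = B v (F i j w).
Proof.
by rewrite /F !BlE !BrE !Bassoc osys_comm.
Qed.


(** For $i\ne j$ the projection onto $V_{ij}$ is shared equally by [peirce_comp i j] and
    [peirce_comp j i], hence the factor 1/2. *)
Lemma peirce_comp_idem i j v :
  F i j (F i j v) = (if i == j then 1 else 2^-1) *: F i j v.
Proof.
rewrite {1}/F !peirce_comp_eigen jmulZr peirce_comp_eigen !scalerA -scalerBl.
congr (_ *: _); rewrite !eqxx (eq_sym j).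
by case: (i == j); rewrite /= ?mulr1n ?mulr0n; lra.
Qed.

Lemma peirce_comp_ge0 i j v : 0 <= B (F i j v) v.
Proof.
have := peirce_comp_idem i j v.
case: (i == j) => H; have := B_ge0 (F i j v);
  rewrite -peirce_comp_sym H BZl; lra.
Qed.

Lemma sum_peirce_comp_weight (a : 'I_n -> 'I_n -> R) v :
  \sum_i \sum_j a i j *: F i j v =
  2 *: (\sum_i \sum_j a i j *: (d i ** (d j ** v))) - \sum_i a i i *: (d i ** v).
Proof.
rewrite scaler_sumr -sumrB; apply: eq_bigr => i _.
rewrite scaler_sumr -[X in _ - X](_ : \sum_j a i j *: ((i == j)%:R *: (d i ** v)) = _).
  rewrite -sumrB; apply: eq_bigr => j _.
  by rewrite /F scalerBr !scalerA (mulrC 2).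
rewrite (bigD1 i)//= eqxx scale1r big1 ?addr0// => j ji.
by rewrite eq_sym (negbTE ji) scale0r scaler0.
Qed.

Lemma osys_mul_mul (l m : 'I_n -> R) v :
  (\sum_i l i *: d i) ** ((\sum_i m i *: d i) ** v) =
  \sum_i \sum_j (l i * m j) *: (d i ** (d j ** v)).
Proof.
rewrite !jmul_suml; apply: eq_bigr => i _; rewrite jmul_sumr; apply: eq_bigr => j _.
by rewrite !jmulE scalerA.
Qed.

Lemma qrep_osys (l : 'I_n -> R) v :
  qrep mul (\sum_i l i *: d i) v = \sum_i \sum_j (l i * l j) *: F i j v.
Proof.
rewrite sum_peirce_comp_weight /qrep osys_mul_sum osys_mul_mul; congr (_ - _).
by rewrite jmul_suml; apply: eq_bigr => i _; rewrite jmulZl.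
Qed.

Hypothesis d_sum : \sum_i d i = e.

(** The case of all $l_i=1$ in [qrep_osys], since $P(e)$ is the identity. *)
Lemma sum_peirce_comp v : \sum_i \sum_j F i j v = v.
Proof.
have sum1 : \sum_i 1 *: d i = e by under eq_bigr do rewrite scale1r.
have := qrep_osys (fun=> 1) v.
under [RHS]eq_bigr do under eq_bigr do rewrite mul1r scale1r.
move=> <-; rewrite /qrep !sum1 !jmul1l.
by pair_with w; lra.
Qed.

Lemma mul_osys (l : 'I_n -> R) v :
  (\sum_k l k *: d k) ** v = \sum_i \sum_j ((l i + l j) / 2) *: F i j v.
Proof.
rewrite -{1}(sum_peirce_comp v) jmul_sumr; apply: eq_bigr => i _.
by rewrite jmul_sumr; apply: eq_bigr => j _; rewrite peirce_comp_mul.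
Qed.

Lemma B_mul_osys (l : 'I_n -> R) v :
  B ((\sum_k l k *: d k) ** v) v = \sum_i \sum_j ((l i + l j) / 2) * B (F i j v) v.
Proof.
rewrite mul_osys B_suml; apply: eq_bigr => i _; rewrite B_suml.
by apply: eq_bigr => j _; rewrite BZl.
Qed.

(** $L(\sum_k l_kd_k)$ acts on $V_{ij}$ as the mean $(l_i+l_j)/2$, and every Peirce component of $v$
    pairs nonnegatively with $v$. *)
Lemma mul_osys_ge (l : 'I_n -> R) a v : (forall i, a <= l i) ->
  a * B v v <= B ((\sum_k l k *: d k) ** v) v.
Proof.
move=> al; rewrite B_mul_osys -{1}(sum_peirce_comp v) B_suml mulr_sumr.
apply: ler_sum => i _; rewrite B_suml mulr_sumr; apply: ler_sum => j _.
apply: ler_wpM2r; first exact: peirce_comp_ge0.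
by have := al i; have := al j; lra.
Qed.

End OrthSystem.

(** * Peirce rules and powers *)

Section PeirceOne.
Variable u : V.
Hypothesis uu : idem u.

Lemma peirce_comm1 x v : u ** x = x -> u ** (x ** v) = x ** (u ** v).
Proof.
move=> ux; apply: (@peirce_comm_op _ uu 1); first by rewrite scale1r.
by rewrite eq_sym invr_eq1 -[1]/(1%:R) eqr_nat.
Qed.

Lemma peirce_comm0 x v : u ** x = 0 -> u ** (x ** v) = x ** (u ** v).
Proof.
move=> ux; apply: (@peirce_comm_op _ uu 0); first by rewrite scale0r.
by rewrite eq_sym invr_eq0 pnatr_eq0.
Qed.

Lemma peirce1_mul x y : u ** x = x -> u ** y = y -> u ** (x ** y) = x ** y.
Proof. by move=> ux uy; rewrite peirce_comm1// uy. Qed.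

Lemma peirce0_mul x y : u ** x = 0 -> u ** y = 0 -> u ** (x ** y) = 0.
Proof. by move=> ux uy; rewrite peirce_comm0// uy jmul0r. Qed.

Lemma peirce10_mul x y : u ** x = x -> u ** y = 0 -> x ** y = 0.
Proof.
move=> ux uy; have H := peirce_comm1 y ux.
by rewrite uy jmul0r (jmulC x) peirce_comm0// ux in H; rewrite jmulC.
Qed.

End PeirceOne.

Lemma idem_sub u c : idem u -> idem c -> u ** c = c -> idem (u - c).
Proof.
move=> uu cc uc; rewrite /idem !jmulE uu cc (jmulC c) uc.
by pair_with w; lra.
Qed.

Lemma idem_subM u c : idem c -> u ** c = c -> c ** (u - c) = 0.
Proof. by move=> cc uc; rewrite !jmulE cc jmulC uc subrr. Qed.

Lemma idem_split c a b : idem c -> idem a -> idem b -> c = a + b -> a ** b = 0.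
Proof.
move=> + aa bb cE; rewrite cE /idem !jmulE aa bb (jmulC b) => H.
by pair_with w; pair_eq H w; lra.
Qed.

Lemma peirce1_sub c d x : idem c -> idem d -> c ** d = d -> d ** x = x -> c ** x = x.
Proof.
move=> cc dd cd dx; have : (c - d) ** x = 0.
  by rewrite jmulC; apply: (peirce10_mul dd); rewrite ?idem_subM.
by rewrite !jmulE dx => /eqP; rewrite subr_eq0 => /eqP.
Qed.

Lemma peirce1_orth c d x y : idem c -> idem d -> c ** d = 0 ->
  c ** x = x -> d ** y = y -> x ** y = 0.
Proof.
move=> cc dd cd cx dy; apply: (peirce10_mul cc cx); rewrite jmulC.
by apply: (peirce10_mul dd dy); rewrite jmulC.
Qed.

Section Generated.
Variables (u x : V).
Hypotheses (uu : idem u) (ux : u ** x = x).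

(* The subalgebra $\mathbb{R}[x]$, stated as its induction principle. *)
Definition generated (v : V) := forall S : V -> Prop,
  S u -> (forall a y z, S y -> S z -> S (a *: y + z)) ->
  (forall y, S y -> S (x ** y)) -> S v.

Lemma generated_unit : generated u.
Proof. by move=> S Su. Qed.

Lemma generatedP a y z : generated y -> generated z -> generated (a *: y + z).
Proof. by move=> Hy Hz S S1 S2 S3; apply: (S2); [apply: Hy|apply: Hz]. Qed.

Lemma generatedM y : generated y -> generated (x ** y).
Proof. by move=> Hy S S1 S2 S3; apply: (S3); apply: Hy. Qed.

Lemma generated0 : generated 0.
Proof.
rewrite -(addNr u) -scaleN1r; apply: generatedP; exact: generated_unit.
Qed.

Lemma generated_peirce1 v : generated v -> u ** v = v.
Proof.
move=> Hv; apply: (Hv (fun v => u ** v = v)) => // [a y z uy uz|y uy]; first by rewrite !jmulE uy uz.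
exact: peirce1_mul.
Qed.

(** Power associativity in operator form. The induction must also carry commutation with $L(x^2)$,
    and the same statements for $xv$: [jordan_op] writes $L(x(xy))$ through $L(xy)$, $L(y)$, $L(x)$
    and $L(x^2)$, a two-step recursion. *)
Lemma generated_comm v : generated v -> forall w, x ** (v ** w) = v ** (x ** w).
Proof.
pose x2 := x ** x.
pose S v := [/\ forall w, x ** (v ** w) = v ** (x ** w),
  forall w, x2 ** (v ** w) = v ** (x2 ** w),
  forall w, x ** ((x ** v) ** w) = (x ** v) ** (x ** w),
  forall w, x2 ** ((x ** v) ** w) = (x ** v) ** (x2 ** w) & x2 ** v = x ** (x ** v)].
move=> Hv; suff: S v by case.
have ux2 : u ** x2 = x2 by exact: peirce1_mul.
have comm12 w : x2 ** (x ** w) = x ** (x2 ** w) by rewrite -jordanI.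
apply: (Hv S) => [|a y z [y1 y2 y3 y4 y5] [z1 z2 z3 z4 z5]|y [y1 y2 y3 y4 y5]].
- split=> [w|w|w|w|].
  + by rewrite -(peirce_comm1 uu).
  + by rewrite -(peirce_comm1 uu).
  + by rewrite (jmulC x u) ux.
  + by rewrite (jmulC x u) ux comm12.
  + by rewrite (jmulC x u) ux jmulC.
- split=> [w|w|w|w|]; rewrite !jmulE.
  + by rewrite y1 z1.
  + by rewrite y2 z2.
  + by rewrite y3 z3.
  + by rewrite y4 z4.
  + by rewrite y5 z5.
have xxy w : (x ** (x ** y)) ** w =
    2 *: ((x ** y) ** (x ** w)) + x2 ** (y ** w) - 2 *: (x ** (y ** (x ** w))).
  have := jordan_op x y x w; rewrite -y5 -/x2 (jmulC y x) => H.
  by pair_with t; pair_eq H t; lra.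
split=> // [w|w|]; last by rewrite comm12 y5.
- rewrite !xxy !jmulE.
  by rewrite -!comm12 y3 !y1.
- by rewrite !xxy !jmulE !(y4, comm12, y2).
Qed.

Lemma generated_mul a b : generated a -> generated b -> generated (a ** b).
Proof.
move=> Ha Hb; apply: (Ha (fun a => generated (a ** b))).
- by rewrite generated_peirce1.
- by move=> k y z Hy Hz; rewrite jmulDl jmulZl; exact: generatedP.
- move=> y Hy; rewrite jmulC -(generated_comm Hb) jmulC [b ** y]jmulC jmulC.
  exact: generatedM.
Qed.

Lemma generated_lin a y z b : generated y -> generated z -> generated (a *: y + b *: z).
Proof.
move=> Hy Hz; apply: generatedP => //; rewrite -[b *: z]addr0.
by apply: generatedP => //; exact: generated0.
Qed.

End Generated.

(** * The spectral theorem *)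

Section Eigenvector.
Variables (u x : V).
Hypothesis u0 : u != 0.

(** One factor $L(x)-(s+it)$ of the complexified operator, applied to $y_1+iy_2$ and written as a
    pair of real vectors. *)
Let step (s t : R) (y : V * V) : V * V :=
  (x ** y.1 - s *: y.1 + t *: y.2, x ** y.2 - s *: y.2 - t *: y.1).

Let steps (rs : seq (complex R)) (y : V * V) :=
  foldl (fun y z => step (complex.Re z) (complex.Im z) y) y rs.

Let gen2 (y : V * V) := generated u x y.1 /\ generated u x y.2.

Let gen2_step s t y : gen2 y -> gen2 (step s t y).
Proof.
move=> [g1 g2]; split; rewrite /step /=.
  rewrite -[x ** _]scale1r -[- (s *: _)]scaleNr addrC.
  by apply: generatedP => //; apply: generated_lin => //; exact: generatedM.
rewrite -[x ** _]scale1r -[- (s *: _)]scaleNr -[- (t *: _)]scaleNr addrC.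
by apply: generatedP => //; apply: generated_lin => //; exact: generatedM.
Qed.

Let steps_eigen rs y : gen2 y -> y != 0 -> steps rs y = 0 ->
  exists s t z, [/\ gen2 z, z != 0 & step s t z = 0].
Proof.
elim: rs y => [|z rs IH] y gy y0 /=; first by move/eqP; rewrite (negbTE y0).
have [st0 _|st0] := eqVneq (step (complex.Re z) (complex.Im z) y) 0.
  by exists (complex.Re z), (complex.Im z), y.
by apply: IH => //; exact: gen2_step.
Qed.

Let annihilating_steps : exists rs, steps rs (u, 0) = 0.
Proof.
have [_ [n [f [g fg gf]]] _] := HJ.
case: n f g fg gf => [|n] f g fg gf.
  by exfalso; move/eqP: u0; apply; rewrite -(gf u) (thinmx0 (g u)) linear0.
have glin : linear g.
  by move=> a y z; apply: (can_inj fg); rewrite gf linearP !gf.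
have g0 : g 0 = 0 by rewrite -(linear0 f) fg.
have gD a b : g (a + b) = g a + g b by have := glin 1 a b; rewrite !scale1r.
have gZ k a : g (k *: a) = k *: g a by have := glin k a 0; rewrite g0 !addr0.
pose X : 'M[R]_n.+1 := \matrix_(i < n.+1) g (x ** f (delta_mx 0 i)).
have gX y : g (x ** y) = g y *m X.
  rewrite mulmx_sum_row -{1}(gf y) {1}(row_sum_delta (g y)).
  rewrite linear_sum jmul_sumr (big_morph g gD g0); apply: eq_bigr => i _.
  by rewrite linearZ jmulZr gZ rowK.
pose C := complex R; pose toC := real_complex R.
pose XC : 'M[C]_n.+1 := map_mx toC X.
pose cpx (y : V * V) : 'rV[C]_n.+1 :=
  map_mx toC (g y.1) + ('i)%C *: map_mx toC (g y.2).
have cpxE y j : cpx y 0 j = (g y.1 0 j +i* g y.2 0 j)%C.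
  by rewrite !mxE; apply/eqP; rewrite eq_complex /=; apply/andP; split; apply/eqP; ring.
have cpx_step z y : cpx y *m (XC - z%:M) =
    cpx (step (complex.Re z) (complex.Im z) y).
  have XC1 : cpx y *m XC = cpx (x ** y.1, x ** y.2).
    by rewrite /cpx /= mulmxDl -scalemxAl -!map_mxM !gX.
  apply/rowP => j; rewrite mulmxBr mul_mx_scalar XC1.
  transitivity (cpx (x ** y.1, x ** y.2) 0 j - z * cpx y 0 j); first by rewrite !mxE.
  rewrite !cpxE /step /= -!scaleNr !gD !gZ !mxE; case: z => s t.
  by apply/eqP; rewrite eq_complex /=; apply/andP; split; apply/eqP; ring.
have cpx_steps rs y : cpx (steps rs y) = cpx y *m \prod_(z <- rs) (XC - z%:M).
  elim: rs y => [|z rs IH] y /=; first by rewrite big_nil mulmx1.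
  by rewrite big_cons IH -cpx_step -mulmxA.
(* Over the complex numbers the characteristic polynomial splits, and by Cayley-Hamilton the product
   of its linear factors kills every vector, in particular [u]. *)
have [rs rsP] := closed_field_poly_normal (char_poly XC).
exists rs.
have : cpx (steps rs (u, 0)) = 0.
  rewrite cpx_steps; have := Cayley_Hamilton XC.
  rewrite rsP (monicP (char_poly_monic XC)) scale1r rmorph_prod.
  under eq_bigr do rewrite rmorphB /= horner_mx_X horner_mx_C.
  by move=> ->; rewrite mulmx0.
case: (steps _ _) => y1 y2 /rowP y0.
have gy : g y1 = 0 /\ g y2 = 0.
  by split; apply/rowP => j; have := y0 j; rewrite cpxE !mxE => -[].
by rewrite -(gf y1) -(gf y2) gy.1 gy.2 linear0.
Qed.

(** The last nonzero vector before the product of linear factors reaches 0 is a complex eigenvector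
    inside the complexification of $\mathbb{R}[x]$. Self-adjointness of $L(x)$ makes its eigenvalue
    real, so whichever of its real and imaginary parts is nonzero is an eigenvector. *)
Lemma generated_eigenvector : exists l y, [/\ generated u x y, y != 0 & x ** y = l *: y].
Proof.
have [rs rs0] := annihilating_steps.
have [||s [t [[y1 y2] [[g1 g2] y0]]]] := steps_eigen _ _ rs0.
- by split; [exact: generated_unit | exact: generated0].
- by apply: contra u0 => /eqP[->].
rewrite /step /= => -[E1 E2].
have t0 : t * (B y1 y1 + B y2 y2) = 0.
  have : B (x ** y1) y2 = B y1 (x ** y2) by rewrite Bassoc.
  pair_eq E1 y2; move/(congr1 (B y1)): E2; rewrite !BrE (BC y1 y2) => E2 E3.
  by rewrite (BC y1 y2) in E1; lra.
have {}t0 : t = 0.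
  move/eqP: t0; rewrite mulf_eq0 => /orP[/eqP//|]; rewrite paddr_eq0 ?B_ge0//.
  by move=> /andP[/eqP/B_eq0 y10 /eqP/B_eq0 y20]; rewrite y10 y20 eqxx in y0.
rewrite t0 !scale0r addr0 subr0 in E1 E2.
have [y10|y10] := eqVneq y1 0; last by exists s, y1; split=> //; apply/eqP; rewrite -subr_eq0 E1.
exists s, y2; split=> //; last by apply/eqP; rewrite -subr_eq0 E2.
by apply: contra y0 => /eqP ->; rewrite y10.
Qed.

End Eigenvector.

(** An element of $\mathbb{R}[x]$ that is an eigenvector for $l$ and orthogonal to $u$ is orthogonal
    to all of $\mathbb{R}[x]$, itself included, hence 0. This applies to $y^2-ky$, where $k$ makes
    it orthogonal to $u$; so $y/k$ is idempotent. *)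
Lemma idem_eigen u x : idem u -> u != 0 -> u ** x = x ->
  exists l c, [/\ idem c, c != 0, u ** c = c & x ** c = l *: c].
Proof.
move=> uu u0 ux; have [l [y [gy y0 xy]]] := generated_eigenvector x u0.
have orth_u a : x ** a = l *: a -> B a u = 0 -> forall v, generated u x v -> B a v = 0.
  move=> xa au v gv; apply: (gv (fun v => B a v = 0)) => // [k p q p0 q0|p p0].
    by rewrite BDr BZr p0 q0 mulr0 addr0.
  by rewrite -Bassoc xa BZl p0 mulr0.
have uy := generated_peirce1 uu ux gy.
have yu0 : B y u != 0.
  by apply: contra y0 => /eqP yu; apply/eqP/B_eq0; apply: orth_u.
pose k := B y y / B y u.
have gyy : generated u x (y ** y) by exact: generated_mul.
have yy : y ** y = k *: y.
  have g : generated u x (- k *: y + y ** y) by exact: generatedP.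
  have : - k *: y + y ** y = 0.
    apply: B_eq0; apply: orth_u => //.
      rewrite !jmulE (generated_comm uu ux gy) xy !jmulE.
      by rewrite !scalerDr !scalerA (mulrC l).
    by rewrite BDl BZl Bassoc (jmulC y) uy /k mulNr divfK// addNr.
  by rewrite addrC scaleNr => /eqP; rewrite subr_eq0 => /eqP.
have k0 : k != 0.
  by rewrite mulf_neq0 ?invr_eq0//; apply: contra y0 => /eqP/B_eq0 ->.
exists l, (k^-1 *: y); split.
- by rewrite /idem !jmulE yy !scalerA -mulrA mulVf// mulr1.
- by rewrite scaler_eq0 invr_eq0 negb_or k0.
- by rewrite !jmulE uy.
- by rewrite !jmulE xy !scalerA mulrC.
Qed.

Definition orth_seq (c : seq V) :=
  (forall i, (i < size c)%N -> idem c`_i /\ c`_i != 0) /\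
  (forall i j, (i < size c)%N -> (j < size c)%N -> i != j -> c`_i ** c`_j = 0).

(** Nonzero orthogonal idempotents are linearly independent, so the dimension bounds their number;
    this makes the splitting in the spectral theorem terminate. *)
Lemma orth_seq_bounded : exists n, forall c, orth_seq c -> (size c <= n)%N.
Proof.
have [_ [n [f [g fg gf]]] _] := HJ; exists n => c [c1 c0].
pose M : 'M[R]_(size c, n) := \matrix_(i < size c) g c`_i.
suff : row_free M by move=> /eqP <-; exact: rank_leq_col.
rewrite -kermx_eq0; apply/rowV0P => v /sub_kermxP vM.
have : \sum_(i < size c) v 0 i *: c`_i = 0.
  transitivity (f (v *m M)); last by rewrite vM linear0.
  rewrite mulmx_sum_row linear_sum.
  by apply: eq_bigr => i _; rewrite linearZ rowK gf.
move=> vc; apply/rowP => k; rewrite mxE.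
have := congr1 (fun x => c`_k ** x) vc.
rewrite jmul0r jmul_sumr (bigD1 k)//= big1 ?addr0 => [|i ik]; last first.
  by rewrite jmulZr c0 ?scaler0// eq_sym.
have [ck ck0] := c1 k (ltn_ord k).
by rewrite jmulZr ck => /eqP; rewrite scaler_eq0 (negbTE ck0) orbF => /eqP.
Qed.

Lemma primitive_idem u p : primitive_idempotent mul u p -> idem p.
Proof. by case. Qed.

(** A decomposition of $p$ into idempotents takes place inside $V(p,1)$, so primitivity does not
    depend on the ambient unit. *)
Lemma primitive_lift u w p : idem u -> w ** p = p ->
  primitive_idempotent mul u p -> primitive_idempotent mul w p.
Proof.
move=> uu wp [up pp p0 H]; split=> // a b wa wb aa bb pab.
have ab := idem_split pp aa bb pab.
have pa : p ** a = a by rewrite pab jmulDl aa (jmulC b) ab addr0.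
have pb : p ** b = b by rewrite pab jmulDl ab bb add0r.
by apply: H => //; rewrite /peirce1/=; apply: (@peirce1_sub _ p).
Qed.

Lemma frame_idem u c : jordan_frame mul u c -> forall i, (i < size c)%N -> idem c`_i.
Proof. by move=> [H _ _] i /H[]. Qed.

Lemma frame_in u c : jordan_frame mul u c -> forall i, (i < size c)%N -> u ** c`_i = c`_i.
Proof. by move=> [H _ _] i /H[]. Qed.

Lemma frame_cat a b c d : idem a -> idem b -> a ** b = 0 ->
  jordan_frame mul a c -> jordan_frame mul b d -> jordan_frame mul (a + b) (c ++ d).
Proof.
move=> aa bb ab Fc Fd; have [c1 c0 cs] := Fc; have [d1 d0 ds] := Fd.
have cd i j : (i < size c)%N -> (j < size d)%N -> c`_i ** d`_j = 0.
  by move=> ic jd; apply: (@peirce1_orth a b); rewrite // ?(frame_in Fc)// (frame_in Fd).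
have abP p : a ** p = p -> (a + b) ** p = p.
  by move=> ap; rewrite jmulDl ap (jmulC b) (peirce10_mul aa ap ab) addr0.
have baP p : b ** p = p -> (a + b) ** p = p.
  move=> bp; rewrite jmulDl bp (jmulC a) (peirce10_mul bb bp) ?add0r//.
  by rewrite jmulC.
split; last by rewrite big_cat /= cs ds.
- move=> i; rewrite size_cat nth_cat; case: (ltnP i (size c)) => ic id.
    by apply: (@primitive_lift a) => //; [exact: abP (frame_in Fc ic) | exact: c1].
  have id' : (i - size c < size d)%N by rewrite ltn_subLR.
  by apply: (@primitive_lift b) => //; [exact: baP (frame_in Fd id') | exact: d1].
- move=> i j; rewrite size_cat !nth_cat; case: (ltnP i (size c)) => ic id; case: (ltnP j (size c)) => jc jd ij.
  + exact: c0.
  + by apply: cd => //; rewrite ltn_subLR.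
  + by rewrite jmulC; apply: cd => //; rewrite ltn_subLR.
  + apply: d0; rewrite ?ltn_subLR//.
    by apply: contra ij => /eqP E; rewrite -(subnK ic) E subnK.
Qed.

Lemma spectral_cat a b x y c d l m : idem a -> idem b -> a ** b = 0 ->
  spectral_decomposition mul a x c l -> spectral_decomposition mul b y d m ->
  spectral_decomposition mul (a + b) (x + y) (c ++ d) (l ++ m).
Proof.
move=> aa bb ab [Fc lc ->] [Fd md ->]; split; first exact: frame_cat.
  by rewrite !size_cat lc md.
rewrite size_cat (big_cat_nat (leq0n _) (leq_addr _ _)) /=; congr (_ + _).
  by rewrite !big_mkord; apply: eq_bigr => i _; rewrite !nth_cat lc ltn_ord.
rewrite -[X in _ = \sum_(X <= _ < _) _](add0n (size c)) big_addn addKn !big_mkord; apply: eq_bigr => i _.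
by rewrite !nth_cat lc ltnNge leq_addl /= addnK.
Qed.

Lemma orth_seq_cons a b c : idem a -> idem b -> b != 0 -> a ** b = 0 -> orth_seq c ->
  (forall i, (i < size c)%N -> a ** c`_i = c`_i) -> orth_seq (b :: c).
Proof.
move=> aa bb b0 ab [c1 c0] ac; split=> [[|i]//= /c1//|].
have bc i : (i < size c)%N -> b ** c`_i = 0.
  by move=> ic; rewrite jmulC (peirce10_mul aa)// ac.
move=> [|i] [|j]//= ic jc ij; [exact: bc | by rewrite jmulC bc | exact: c0].
Qed.

(** The idempotent [c] of [idem_eigen] splits off unless it equals [u]. In that case [x] is a
    multiple of [u], and any decomposition of [u] also splits [x]. *)
Lemma scalar_or_split u x : idem u -> u != 0 -> u ** x = x ->
  (exists2 l, x = l *: u & primitive_idempotent mul u u) \/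
  exists a b y z, [/\ [/\ idem a, idem b, a != 0 & b != 0], a ** b = 0,
    u = a + b, x = y + z & a ** y = y /\ b ** z = z].
Proof.
move=> uu u0 ux; have [l [c [cc c0 uc xc]]] := idem_eigen uu u0 ux.
have [ucE|uc'] := eqVneq (u - c) 0.
  have cE : c = u by apply/eqP; rewrite eq_sym -subr_eq0 ucE.
  rewrite {c cc c0 uc ucE}cE jmulC ux in xc.
  have [[a [b [aa bb a0 b0 uab]]]|H] := pselect (exists a b,
      [/\ idem a, idem b, a != 0, b != 0 & u = a + b]).
    right; exists a, b, (l *: a), (l *: b); split=> //.
    - exact: idem_split uu aa bb uab.
    - by rewrite xc uab scalerDr.
    - by rewrite !jmulZr aa bb.
  left; exists l => //; split=> // a b _ _ aa bb uab.
  have [->|a0] := eqVneq a 0; first by left.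
  have [->|b0] := eqVneq b 0; first by right.
  by case: H; exists a, b.
right; exists c, (u - c), (l *: c), (x - l *: c); split=> //.
- by split=> //; exact: idem_sub.
- exact: idem_subM.
- by rewrite addrC subrK.
- by rewrite addrC subrK.
- by rewrite !jmulE cc ux uc (jmulC c x) xc; split=> //; pair_with w; lra.
Qed.

(** Induction on a bound for the orthogonal systems in $V(u,1)$. After splitting $u=a+b$ the bound
    drops on both sides, because a system in $V(a,1)$ can be enlarged by $b$ and one in $V(b,1)$ by
    $a$. *)
Lemma spectral_theorem u x : idem u -> u ** x = x ->
  exists c l, spectral_decomposition mul u x c l.
Proof.
have [n nP] := orth_seq_bounded; move=> uu ux.
have {nP} : forall c, orth_seq c -> (forall i, (i < size c)%N -> u ** c`_i = c`_i) ->
  (size c <= n)%N by move=> c /nP.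
elim: n u x uu ux => [|n IH] u x uu ux bound; have [u0|u0] := eqVneq u 0.
- exists [::], [::]; split=> //; last by rewrite big_nil -ux u0 jmul0l.
  by split=> //; rewrite big_nil.
- have ou : orth_seq [:: u] by split=> [[|]//|[|i] [|j]].
  suff: (size [:: u] <= 0)%N by [].
  by apply: (bound _ ou) => -[|].
- exists [::], [::]; split=> //; last by rewrite big_nil -ux u0 jmul0l.
  by split=> //; rewrite big_nil.
have [[l xl pu]|[a [b [y [z [[aa bb a0 b0] ab uE xE [ay bz]]]]]]] :=
  scalar_or_split uu u0 ux.
  exists [:: u], [:: l]; split=> //; last by rewrite big_nat1.
  by split=> [[|]//|[|i] [|j]//|]; rewrite big_seq1.
have half p q w : idem p -> idem q -> q != 0 -> p ** q = 0 -> u = p + q -> p ** w = w ->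
    exists c l, spectral_decomposition mul p w c l.
  move=> pp qq q0 pq upq pw; apply: IH => // c oc pc.
  rewrite -ltnS; apply: (bound (q :: c)).
    exact: (@orth_seq_cons p).
  have uP r : p ** r = r -> u ** r = r.
    by move=> pr; rewrite upq jmulDl pr (jmulC q) (peirce10_mul pp) ?addr0.
  move=> [_|i /pc /uP//] /=; rewrite upq jmulDl qq (jmulC p) .
  by rewrite jmulC pq add0r.
have [c [l sc]] := half a b y aa bb b0 ab uE ay.
have ba : b ** a = 0 by rewrite jmulC.
have [d [m sd]] := half b a z bb aa a0 ba (etrans uE (addrC a b)) bz.
by exists (c ++ d), (l ++ m); rewrite uE xE; exact: spectral_cat.
Qed.

(** * Primitive idempotents *)

Local Notation P := (qrep mul).

Lemma primitive_line u p x : idem u -> primitive_idempotent mul u p -> p ** x = x ->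
  exists l, x = l *: p.
Proof.
move=> uu pu px; have pp := primitive_idem pu.
have [_ _ p0 H] : primitive_idempotent mul p p by exact: (primitive_lift uu).
have [[l -> _]|[a [b [y [z [[aa bb a0 b0] ab pE _ _]]]]]] := scalar_or_split pp p0 px.
  by exists l.
have pa : peirce1 mul p a by rewrite /peirce1/= pE jmulDl aa (jmulC b) ab addr0.
have pb : peirce1 mul p b by rewrite /peirce1/= pE jmulDl bb ab add0r.
by case: (H _ _ pa pb aa bb pE) => E; rewrite E eqxx in a0 b0.
Qed.

Lemma qrep_sym x v w : B (P x v) w = B v (P x w).
Proof. by rewrite /qrep !BlE !BrE !Bassoc. Qed.

Lemma qrepD x v w : P x (v + w) = P x v + P x w.
Proof. by rewrite /qrep !jmulE; pair_with t; lra. Qed.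

Lemma qrepZ x a v : P x (a *: v) = a *: P x v.
Proof. by rewrite /qrep !jmulE; pair_with t; lra. Qed.

Lemma qrep_idem p v : idem p -> p ** P p v = P p v.
Proof.
by move=> pp; have H := peirce_cubic pp v; rewrite /qrep !jmulE pp;
   pair_with t; pair_eq H t; lra.
Qed.

Lemma qrep_idem1 p x : idem p -> p ** x = x -> P p x = x.
Proof. by move=> pp px; rewrite /qrep pp !px; pair_with t; lra. Qed.

Lemma qrep_idem0 p x : idem p -> p ** x = 0 -> P p x = 0.
Proof. by move=> pp px; rewrite /qrep pp !px jmul0r; pair_with t; lra. Qed.

Lemma qrep_idem_half p x : idem p -> p ** x = 2^-1 *: x -> P p x = 0.
Proof. by move=> pp px; rewrite /qrep pp !px jmulZr px; pair_with t; lra. Qed.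

(** The polynomial $4t(1-t)$ is 1 at 1/2 and 0 at 0 and 1, so for an idempotent [p] this is the
    projection onto $V_{1/2}(p)$. *)
Definition half_part (p x : V) := 4 *: (p ** x - p ** (p ** x)).

Lemma half_partP p x : idem p -> p ** half_part p x = 2^-1 *: half_part p x.
Proof.
move=> pp; have H := peirce_cubic pp x; rewrite /half_part !jmulE.
by pair_with t; pair_eq H t; lra.
Qed.

Definition zero_part (p x : V) := x - P p x - half_part p x.

Lemma zero_partP p x : idem p -> p ** zero_part p x = 0.
Proof.
move=> pp; rewrite /zero_part jmulDr jmulNr half_partP// jmulDr jmulNr qrep_idem//.
by rewrite /half_part /qrep pp; pair_with t; lra.
Qed.

Lemma peirce_decomp p x : x = P p x + half_part p x + zero_part p x.
Proof. by rewrite /zero_part; pair_with t; lra. Qed.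

Lemma half_partD p x y : half_part p (x + y) = half_part p x + half_part p y.
Proof. by rewrite /half_part !jmulE; pair_with t; lra. Qed.

Lemma half_partZ p a x : half_part p (a *: x) = a *: half_part p x.
Proof. by rewrite /half_part !jmulE; pair_with t; lra. Qed.

Lemma half_part_half p x : p ** x = 2^-1 *: x -> half_part p x = x.
Proof. by move=> px; rewrite /half_part !px jmulZr px; pair_with t; lra. Qed.

Lemma half_part_eq0 p x : p ** (p ** x) = p ** x -> half_part p x = 0.
Proof. by move=> px; rewrite /half_part px subrr scaler0. Qed.

Lemma peirce_half_zero p x y : idem p -> p ** x = 2^-1 *: x -> p ** y = 0 ->
  p ** (x ** y) = 2^-1 *: (x ** y).
Proof. by move=> pp px py; rewrite (jmulC x) (peirce_comm0 pp)// px jmulZr. Qed.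

(** Adjoining $e-u$ completes the system to a decomposition of $e$, where the Peirce expansions are
    available. The new element may be 0, which [orth_system] allows. *)
Lemma ext_orth_system u (c : seq V) : idem u ->
  (forall i, (i < size c)%N -> idem c`_i) ->
  (forall i j, (i < size c)%N -> (j < size c)%N -> i != j -> c`_i ** c`_j = 0) ->
  \sum_(x <- c) x = u ->
  orth_system (fun i : 'I_(size c).+1 => (e - u :: c)`_i).
Proof.
move=> uu c1 c0 cu.
have uc i : (i < size c)%N -> u ** c`_i = c`_i.
  move=> ic; rewrite -cu (big_nth 0) big_mkord jmul_suml (bigD1 (Ordinal ic))//=.
  by rewrite c1// big1 ?addr0// => j ji; rewrite c0.
have euc i : (i < size c)%N -> (e - u) ** c`_i = 0.
  by move=> ic; rewrite !jmulE jmul1l uc// subrr.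
split=> [[[|i] /= ic]|[[|i] /= ic] [[|j] /= jc]] //=.
- by apply: idem_sub; rewrite /idem ?jmul1l.
- exact: c1.
- by move=> _; exact: euc.
- by move=> _; rewrite jmulC euc.
- by move=> ij; apply: c0.
Qed.

Lemma ext_orth_system_sum1 u (c : seq V) : \sum_(x <- c) x = u ->
  \sum_(i < (size c).+1) (e - u :: c)`_i = e.
Proof.
move=> cu; rewrite big_ord_recl /= -{2}[e](subrK u); congr (_ + _).
by rewrite -cu (big_nth 0) big_mkord.
Qed.

Lemma idem_mul_ge0 p v : idem p -> 0 <= B (p ** v) v.
Proof.
move=> pp.
have od := @ext_orth_system p [:: p] pp.
have {}od : orth_system (fun i : 'I_2 => [:: e - p; p]`_i).
  by apply: od => [[|]//|[|] [|]//|]; exact: big_seq1.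
have := @mul_osys_ge _ _ od (@ext_orth_system_sum1 p [:: p] (big_seq1 _ _ _))
  (fun i => [:: 0; 1]`_i) 0 v.
rewrite mul0r !big_ord_recl big_ord0 /= scale0r add0r scale1r addr0; apply.
by case=> [[|[|]]] //=; rewrite ler01.
Qed.

(** * Relative position of two idempotents *)

Section IdempotentPair.
Variables (p q a b : V) (lam : R).
Hypotheses (pp : idem p) (qq : idem q) (qE : q = lam *: p + a + b).
Hypotheses (pa : p ** a = 2^-1 *: a) (pb : p ** b = 0).

Let sqE : lam ^+ 2 *: p + lam *: a + a ** a + 2 *: (a ** b) + b ** b = q.
Proof.
rewrite -[RHS]qq qE !jmulE (jmulC a p) (jmulC b p) pa pb pp (jmulC b a).
by pair_with t; lra.
Qed.

Let ab : p ** (a ** b) = 2^-1 *: (a ** b). Proof. exact: peirce_half_zero. Qed.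
Let bb : p ** (b ** b) = 0. Proof. exact: peirce0_mul. Qed.

(** The $V_1(p)$ component of $q^2=q$: only $p^2$ and $a^2$ contribute to that of $q^2$. *)
Lemma idem_pair_sq1 : P p (a ** a) = (lam - lam ^+ 2) *: p.
Proof.
have := congr1 (P p) sqE; rewrite qE !qrepD !qrepZ !(qrep_idem1 pp pp).
rewrite !(qrep_idem_half pp pa, qrep_idem_half pp ab, qrep_idem0 pp bb, qrep_idem0 pp pb).
by move=> H; pair_with t; pair_eq H t; lra.
Qed.

Lemma idem_pair_half : 2 *: (a ** b) = (1 - lam) *: a.
Proof.
have := congr1 (half_part p) sqE; rewrite qE !half_partD !half_partZ.
rewrite !(half_part_half pa, half_part_half ab).
rewrite (@half_part_eq0 p p) ?pp// (@half_part_eq0 p b) ?pb ?jmul0r//.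
rewrite (@half_part_eq0 p (b ** b)) ?bb ?jmul0r//.
rewrite (@half_part_eq0 p (a ** a)); last exact: peirce_half_mul.
by move=> H; pair_with t; pair_eq H t; lra.
Qed.

(** For $\lambda=0$ the component of $a^2$ along $p$ vanishes, while pairing $a^2$ with $p$ gives
    $|a|^2/2$. *)
Lemma idem_pair_orth : lam = 0 -> q = b.
Proof.
move=> l0; suff a0 : a = 0 by rewrite qE a0 l0 scale0r !add0r.
apply: B_eq0; have := congr1 (B p) idem_pair_sq1.
rewrite -qrep_sym (qrep_idem1 pp pp) l0 expr0n subrr BrE mul0r BC Bassoc (jmulC a) pa BrE.
by lra.
Qed.

(** The fundamental formula $P(p)P(q)P(p)=P(P(p)q)$ evaluated at $p$, obtained from the components
    of $q^2=q$. *)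
Lemma idem_pair_qrep : P p (P q p) = lam ^+ 2 *: p.
Proof.
have qp : q ** p = lam *: p + 2^-1 *: a.
  by rewrite qE !jmulE pp (jmulC a) (jmulC b) pa pb addr0.
have qa : q ** a = 2^-1 *: a + a ** a.
  rewrite qE !jmulE pa (jmulC b); have := idem_pair_half => H; pair_with t.
  by pair_eq H t; lra.
have -> : P q p = (2 * lam ^+ 2 - lam) *: p + lam *: a + a ** a.
  by rewrite /qrep qq qp jmulDr !jmulZr qp qa; pair_with t; lra.
rewrite !qrepD !qrepZ (qrep_idem1 pp pp) (qrep_idem_half pp pa) idem_pair_sq1.
by pair_with t; lra.
Qed.

End IdempotentPair.

Section PrimitivePair.
Variables p q : V.
Hypotheses (pP : primitive_idempotent mul e p) (qP : primitive_idempotent mul e q).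

Let ee : idem e. Proof. exact: jmul1l. Qed.
Let pp : idem p := primitive_idem pP.
Let qq : idem q := primitive_idem qP.

Lemma primitive_B_gt0 : 0 < B p p.
Proof. by have [_ _ /B_gt0] := pP. Qed.

Lemma primitive_B_ge0 : 0 <= B p q.
Proof. by have := idem_mul_ge0 q pp; rewrite (jmulC p) Bassoc qq. Qed.

Lemma qrep_primitive v : P p v = (B p v / B p p) *: p.
Proof.
have [l E] := primitive_line ee pP (qrep_idem v pp).
rewrite E; congr (_ *: _); have := congr1 (B p) E.
rewrite -qrep_sym qrep_idem1// BrE => ->; rewrite mulfK//.
by rewrite gt_eqF// primitive_B_gt0.
Qed.

Let qE : q = (B p q / B p p) *: p + half_part p q + zero_part p q.
Proof. by rewrite {1}(peirce_decomp p q) qrep_primitive. Qed.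

Lemma primitive_orth : B p q = 0 -> p ** q = 0.
Proof.
move=> pq; have -> : q = zero_part p q.
  apply: (idem_pair_orth pp qq qE (half_partP q pp) (zero_partP q pp)).
  by rewrite pq mul0r.
exact: zero_partP.
Qed.

End PrimitivePair.

(* [P q p = mu *: q] and [P p q = lam *: p] with [P p (P q p) = lam ^+ 2 *: p]
   give [mu = lam]. *)
Lemma primitive_norm p q : primitive_idempotent mul e p -> primitive_idempotent mul e q ->
  B p q != 0 -> B p p = B q q.
Proof.
move=> pP qP pq0; have Bp := primitive_B_gt0 pP; have Bq := primitive_B_gt0 qP.
have pp := primitive_idem pP.
have qE := peirce_decomp p q; rewrite (qrep_primitive pP) in qE.
have := idem_pair_qrep pp (primitive_idem qP) qE (half_partP q pp) (zero_partP q pp).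
rewrite (qrep_primitive qP) qrepZ (qrep_primitive pP) scalerA.
move=> /(congr1 (B p)); rewrite !BrE (BC q p) => /(mulIf (lt0r_neq0 Bp)).
set x := B p q in pq0 *; set y := B p p in Bp *; set z := B q q in Bq *.
rewrite expr2 => H; have {}H : x / z = x / y.
  by apply: mulIf H; rewrite mulf_neq0// invr_eq0 lt0r_neq0.
by move/(mulfI pq0)/invr_inj: H.
Qed.

Lemma e_idem : idem e.
Proof. exact: jmul1l. Qed.

(* The elements orthogonal to all primitive idempotents of another norm than
   that of [p] form an ideal. *)
Lemma simple_norm : simple_euclidean_jordan_algebra mul e ->
  exists2 k, 0 < k & forall p, primitive_idempotent mul e p -> B p p = k.
Proof.
move=> [_ e0 simple]; have [c [l [[c1 _ ce] _ _]]] := spectral_theorem e_idem e_idem.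
have c0 : (0 < size c)%N.
  by rewrite lt0n size_eq0; apply: contra e0 => /eqP c0; rewrite -ce c0 big_nil.
have pP := c1 0 c0; set p := c`_0 in pP *.
exists (B p p); first exact: primitive_B_gt0.
pose I y := forall q, primitive_idempotent mul e q -> B q q != B p p -> B y q = 0.
have I_ideal : jordan_ideal mul I.
  split=> [q _ _|a y z Iy Iz q qP qp|x y Iy q qP qp]; first exact: B0l.
    by rewrite BDl BZl Iy// Iz// mulr0 addr0.
  have [d [m [[d1 d0 _] _ yE]]] := spectral_theorem e_idem (jmul1l y).
  (* Let $d_i$ be a spectral idempotent of $y$. If it is orthogonal to $q$, then $d_iq=0$. Otherwise
     it has the norm of $q$, so membership in [I] may be tested on $d_i$ and its eigenvalue is 0. *)
  suff yq : y ** q = 0 by rewrite (jmulC x) Bassoc yq B0r.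
  rewrite big_mkord in yE; rewrite yE jmul_suml big1// => i _; rewrite jmulZl.
  have diP := d1 i (ltn_ord i); have := Iy _ diP.
  rewrite {1}yE B_suml (bigD1 i)//= big1 ?addr0 => [|j ji]; last first.
    by rewrite BZl -(primitive_idem diP) -Bassoc d0 ?B0l ?mulr0 1?eq_sym.
  have [diq|diq] := eqVneq (B d`_i q) 0; first by rewrite primitive_orth// scaler0.
  have [di|di] := eqVneq (B d`_i d`_i) (B p p).
    by case/negP: qp; rewrite -di (primitive_norm diP qP diq).
  move=> /(_ isT); rewrite BZl => /eqP; rewrite mulf_eq0.
  by rewrite (gt_eqF (primitive_B_gt0 diP)) orbF => /eqP ->; rewrite scale0r.
have Ip : I p.
  move=> q qP qp; apply: contraNeq qp => pq.
  by rewrite (primitive_norm pP qP).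
move=> q qP; apply/eqP; apply: contraT => qp.
case: (simple _ I_ideal) => E.
  have : I p by []. rewrite E /= => p0; have := primitive_B_gt0 pP.
  by rewrite p0 B0l ltxx.
have : I q by rewrite E.
by move=> /(_ q qP qp) => qq0; have := primitive_B_gt0 qP; rewrite qq0 ltxx.
Qed.

(* The normalization for which [B] is the trace form [ip mul e]. *)
Hypothesis HB1 : forall p, primitive_idempotent mul e p -> B p p = 1.

Lemma idem0 : idem 0. Proof. exact: jmul0l. Qed.

(** * Functional calculus in a frame *)

Section Frame.
Variables (u : V) (c : seq V).
Hypotheses (uu : idem u) (Fc : jordan_frame mul u c).

Lemma frame_primitive i : (i < size c)%N -> primitive_idempotent mul e c`_i.
Proof.
by move=> ic; apply: (primitive_lift uu); [exact: jmul1l | case: Fc => H _ _; exact: H].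
Qed.

Lemma frame_mul i j : (i < size c)%N -> (j < size c)%N -> c`_i ** c`_j = (i == j)%:R *: c`_i.
Proof.
case: Fc => _ c0 _ ic jc; have [<-|ij] := eqVneq i j.
  by rewrite scale1r (frame_idem Fc).
by rewrite c0// scale0r.
Qed.

Lemma frame_sum : \sum_(i < size c) c`_i = u.
Proof. by case: Fc => _ _ <-; rewrite (big_nth 0) big_mkord. Qed.

Lemma frame_osys : orth_system (fun i : 'I_(size c) => c`_i).
Proof.
by split=> [i|i j ij]; [exact: (frame_idem Fc) | case: Fc => _ c0 _; exact: c0].
Qed.

Definition fsum (a : nat -> R) := \sum_(i < size c) a i *: c`_i.

Lemma fsum_mul a b : fsum a ** fsum b = fsum (fun i => a i * b i).
Proof. exact: (osys_mul_sum frame_osys (fun i => a i) (fun i => b i)). Qed.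

Lemma fsum1 : fsum (fun=> 1) = u.
Proof. by rewrite -frame_sum; apply: eq_bigr => i _; rewrite scale1r. Qed.

Lemma fsumD a b : fsum a + fsum b = fsum (fun i => a i + b i).
Proof. by rewrite -big_split; apply: eq_bigr => i _; rewrite scalerDl. Qed.

Lemma fsumZ k a : k *: fsum a = fsum (fun i => k * a i).
Proof. by rewrite scaler_sumr; apply: eq_bigr => i _; rewrite scalerA. Qed.

Lemma eq_fsum a b : (forall i, (i < size c)%N -> a i = b i) -> fsum a = fsum b.
Proof. by move=> H; apply: eq_bigr => i _; rewrite H. Qed.

Lemma fsum_in a : u ** fsum a = fsum a.
Proof. by rewrite -{1}fsum1 fsum_mul; apply: eq_fsum => i _; rewrite mul1r. Qed.

Lemma fsum_eigen a i : (i < size c)%N -> fsum a ** c`_i = a i *: c`_i.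
Proof.
move=> ic; rewrite jmul_suml (bigD1 (Ordinal ic))//= big1 => [|j]; last rewrite -val_eqE /= => ji.
  by rewrite addr0 jmulZl frame_mul// eqxx scale1r.
by rewrite jmulZl frame_mul// (negbTE ji) scale0r scaler0.
Qed.

Lemma B_frame i : (i < size c)%N -> B c`_i c`_i = 1.
Proof. by move=> ic; apply/HB1/frame_primitive. Qed.

Lemma B_unit_frame i : (i < size c)%N -> B c`_i u = 1.
Proof.
move=> ic; rewrite -(B_frame ic) -{1}(frame_idem Fc ic) Bassoc.
by rewrite (jmulC c`_i) (frame_in Fc).
Qed.

Lemma B_fsum_unit a : B (fsum a) u = \sum_(i < size c) a i.
Proof. by rewrite B_suml; apply: eq_bigr => i _; rewrite BZl B_unit_frame// mulr1. Qed.

Lemma ext_frame_osys :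
  orth_system (fun i : 'I_(size c).+1 => (e - u :: c)`_i).
Proof.
apply: ext_orth_system => //; [exact: (frame_idem Fc) | by case: Fc | by case: Fc].
Qed.

Lemma ext_frame_sum1 : \sum_(i < (size c).+1) (e - u :: c)`_i = e.
Proof. by apply: ext_orth_system_sum1; case: Fc. Qed.

Lemma ext_fsum k a :
  \sum_(i < (size c).+1) (if val i is j.+1 then a j else k) *: (e - u :: c)`_i =
  k *: (e - u) + fsum a.
Proof. by rewrite big_ord_recl. Qed.

Lemma fsum_mul_ge a k v : u ** v = v -> (forall i, (i < size c)%N -> k <= a i) ->
  k * B v v <= B (fsum a ** v) v.
Proof.
move=> uv ak; have euv : (e - u) ** v = 0 by rewrite jmulDl jmulNl jmul1l uv subrr.
have -> : fsum a ** v = (k *: (e - u) + fsum a) ** v.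
  by rewrite jmulDl jmulZl euv scaler0 add0r.
rewrite -ext_fsum; apply: (mul_osys_ge ext_frame_osys ext_frame_sum1).
by case=> [[|i]] //= ic; exact: ak.
Qed.

(** $L(x)P(x^{-1})=L(x^{-1})$ on $V(u,1)$: on $V_{ij}$ both sides act as
    $\frac{a_i+a_j}{2a_ia_j}$. *)
Lemma fsum_inv_qrep (a : nat -> R) v : (forall i, (i < size c)%N -> a i != 0) ->
  fsum a ** P (fsum (fun i => (a i)^-1)) v = fsum (fun i => (a i)^-1) ** P u v.
Proof.
move=> a0; have od := ext_frame_osys.
have E b : fsum b = \sum_(i < (size c).+1) (if val i is j.+1 then b j else 0) *: (e - u :: c)`_i.
  by rewrite ext_fsum scale0r add0r.
rewrite -{1}fsum1 !E !(qrep_osys od) !jmul_sumr; apply: eq_bigr => i _.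
rewrite !jmul_sumr; apply: eq_bigr => j _; rewrite !jmulZr !(peirce_comp_mul od) !scalerA.
congr (_ *: _); case: i => [[|i]] /= ic; first by rewrite !mul0r.
case: j => [[|j]] /= jc; first by rewrite !mulr0 !mul0r.
by rewrite !mul1r; field; rewrite !a0.
Qed.

Lemma fsum_qrep_in a v : u ** P (fsum a) v = P (fsum a) v.
Proof.
have od := ext_frame_osys.
have E b : fsum b = \sum_(i < (size c).+1) (if val i is j.+1 then b j else 0) *: (e - u :: c)`_i.
  by rewrite ext_fsum scale0r add0r.
rewrite -{1}fsum1 !E !(qrep_osys od) !jmul_sumr; apply: eq_bigr => i _.
rewrite !jmul_sumr; apply: eq_bigr => j _; rewrite !jmulZr !(peirce_comp_mul od) !scalerA.
congr (_ *: _); case: i => [[|i]] /= ic; first by rewrite !mul0r.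
case: j => [[|j]] /= jc; first by rewrite !mulr0 !mul0r.
by field.
Qed.

Lemma fsum_comm a b v : fsum a ** (fsum b ** v) = fsum b ** (fsum a ** v).
Proof.
have E f g : fsum f ** (fsum g ** v) = _ :=
  osys_mul_mul (fun i : 'I_(size c) => c`_i) (fun i => f i) (fun i => g i) v.
rewrite !E exchange_big /=.
by apply: eq_bigr => i _; apply: eq_bigr => j _; rewrite mulrC (osys_comm frame_osys).
Qed.

Lemma jpow_fsum a n : jpow mul u (fsum a) n = fsum (fun i => a i ^+ n).
Proof.
elim: n => [|n IH] /=; first by rewrite -fsum1; apply: eq_fsum.
by rewrite IH fsum_mul; apply: eq_fsum => i _; rewrite exprS.
Qed.

Lemma jhorner_fsum p a : jhorner mul u p (fsum a) = fsum (fun i => p.[a i]).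
Proof.
rewrite /jhorner; under eq_bigr do rewrite jpow_fsum scaler_sumr.
rewrite exchange_big /=; apply: eq_bigr => i _.
rewrite horner_coef scaler_suml; apply: eq_bigr => j _.
by rewrite scalerA.
Qed.

(** The product $g=\prod_a(1-X/a)$ has $g(0)=1$, so $1-g=Xq$; at each $a$ in the list $g$ vanishes
    and $a\,q(a)=1$. *)
Lemma inverse_polynomial (l : seq R) : all (fun a => a != 0) l ->
  exists p : {poly R}, forall a, a \in l -> a * p.[a] = 1.
Proof.
move=> l0; pose g := \prod_(a <- l) (1 - a^-1 *: 'X) : {poly R}.
have g0 : root (1 - g) 0.
  rewrite rootE !hornerE horner_prod big1 ?subrr// => a _.
  by rewrite !hornerE ?mulr0 ?subr0 ?oppr0 ?addr0.
have [q gq] := factor_theorem _ _ g0; exists q => a al.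
have : (1 - g).[a] = 1.
  rewrite !hornerE horner_prod (big_rem a)//= !hornerE mulVf ?subrr ?mul0r ?subr0//.
  exact: (allP l0).
by rewrite gq !hornerE ?oppr0 ?subr0 ?addr0 mulrC.
Qed.

Lemma jinv_fsum (a : nat -> R) : (forall i, (i < size c)%N -> a i != 0) ->
  jinv mul u (fsum a) = fsum (fun i => (a i)^-1).
Proof.
move=> a0; apply: xget_unique => /=.
  split.
    by rewrite fsum_mul -fsum1; apply: eq_fsum => i ic; rewrite mulfV// a0.
  have l0 : all (fun a => a != 0) (mkseq a (size c)).
    rewrite /mkseq all_map; apply/allP => i; rewrite mem_iota add0n /=; exact: a0.
  have [p pP] := inverse_polynomial l0; exists p.
  rewrite jhorner_fsum; apply: eq_fsum => i ic; apply: (mulfI (a0 i ic)).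
  by rewrite mulfV ?a0// pP// /mkseq map_f// mem_iota.
(* A polynomial in $x$ is diagonal in the same frame, so the equation determines $y$ entry by
   entry. *)
move=> y [xy [p yp]]; rewrite yp jhorner_fsum in xy *.
apply: eq_fsum => i ic; apply: (mulfI (a0 i ic)); rewrite mulfV ?a0//.
move/(congr1 (fun z => B (z ** c`_i) u)): xy.
rewrite fsum_mul fsum_eigen// (frame_in Fc)// BZl B_unit_frame// mulr1.
exact.
Qed.

End Frame.

(** * Determinant, trace and inverse *)

(** For $u=e$ this is membership in the cone, by [symmetric_coneE]; for any idempotent $u$,
    [posin_fsum] translates it into positive eigenvalues. *)
Definition posin (u x : V) :=
  u ** x = x /\ forall v, u ** v = v -> v != 0 -> 0 < B (x ** v) v.

Lemma spectral_fsum u x c l : spectral_decomposition mul u x c l ->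
  x = fsum c (fun i => l`_i).
Proof. by case=> _ _; rewrite big_mkord. Qed.

Lemma spectral_fsumP u x : idem u -> u ** x = x ->
  exists c a, jordan_frame mul u c /\ x = fsum c a.
Proof.
move=> uu ux; have [c [l H]] := spectral_theorem uu ux.
by exists c, (fun i => l`_i); split; [case: H | exact: spectral_fsum H].
Qed.

Lemma positive_lower_bound (a : nat -> R) n : (forall i, (i < n)%N -> 0 < a i) ->
  exists2 k, 0 < k & forall i, (i < n)%N -> k <= a i.
Proof.
elim: n => [|n IH] a0; first by exists 1.
have [k k0 ka] := IH (fun i ni => a0 i (leqW ni)); have an := a0 n (ltnSn n).
exists (Num.min k (a n)); first by rewrite lt_min k0.
move=> i; rewrite ltnS leq_eqVlt => /orP[/eqP ->|/ka H].
  by rewrite ge_min lexx orbT.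
by rewrite ge_min H.
Qed.

Lemma posin_fsum u c a : idem u -> jordan_frame mul u c ->
  posin u (fsum c a) <-> forall i, (i < size c)%N -> 0 < a i.
Proof.
move=> uu Fc; split=> [[_ H] i ic|a0].
  have := H c`_i; rewrite (fsum_eigen Fc)// BZl (B_frame uu Fc)// mulr1; apply.
    exact: frame_in Fc _ ic.
  by have [_ _] := frame_primitive uu Fc ic.
split=> [|v uv v0]; first exact: (fsum_in Fc).
have [k k0 ak] := positive_lower_bound a0.
apply: lt_le_trans (fsum_mul_ge uu Fc uv ak).
by rewrite mulr_gt0// B_gt0.
Qed.

Lemma posinP u x : idem u -> posin u x -> exists c a,
  [/\ jordan_frame mul u c, x = fsum c a & forall i, (i < size c)%N -> 0 < a i].
Proof.
move=> uu px; have [c [a [Fc xE]]] := spectral_fsumP uu px.1.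
by exists c, a; split=> //; apply/(posin_fsum _ uu Fc); rewrite -xE.
Qed.

Lemma posin_ge u x : idem u -> posin u x ->
  exists2 k, 0 < k & forall v, u ** v = v -> k * B v v <= B (x ** v) v.
Proof.
move=> uu /(posinP uu)[c [a [Fc -> a0]]].
have [k k0 ak] := positive_lower_bound a0.
by exists k => // v uv; exact: fsum_mul_ge uv ak.
Qed.

(** Each element of a frame pairs to 1 with the unit, so all spectral decompositions of [x] give the
    same sum, and the trace chosen by [get] is linear. *)
Lemma jtr_unit x : jtr mul e x = B x e.
Proof.
apply: xget_unique => /= [|t [c [l [sc ->]]]].
  have [c [l sc]] := spectral_theorem e_idem (jmul1l x); exists c, l; split=> //.
  have [Fc lc _] := sc.
  by rewrite (spectral_fsum sc) (B_fsum_unit e_idem Fc) (big_nth 0) big_mkord lc.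
have [Fc lc _] := sc.
by rewrite (spectral_fsum sc) (B_fsum_unit e_idem Fc) (big_nth 0) big_mkord lc.
Qed.

Lemma ipE : ip mul e = B.
Proof. by apply/funext => x; apply/funext => y; rewrite /ip jtr_unit Bassoc jmul1r BC. Qed.

Lemma ln_le_sub1 (t : R) : 0 < t -> ln t <= t - 1.
Proof. by move=> t0; have := expR_ge1Dx (ln t); rewrite lnK//; lra. Qed.

Section LogDet.
Variables (u : V) (c d : seq V) (a b : nat -> R).
Hypotheses (uu : idem u) (Fc : jordan_frame mul u c) (Fd : jordan_frame mul u d).
Hypotheses (a0 : forall i, (i < size c)%N -> 0 < a i).
Hypotheses (b0 : forall i, (i < size d)%N -> 0 < b i).

(* The numbers [B c`_i d`_j] form a doubly stochastic matrix. *)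
Lemma logdet_fsum_le : \sum_(j < size d) ln (b j) - \sum_(i < size c) ln (a i) <=
  B (fsum c (fun i => (a i)^-1)) (fsum d b - fsum c a).
Proof.
pose w (i j : nat) := B c`_i d`_j.
have w0 i j : (i < size c)%N -> (j < size d)%N -> 0 <= w i j.
  move=> ic jd; apply: primitive_B_ge0.
    exact: (frame_primitive uu Fc).
  exact: (frame_primitive uu Fd).
have wl i : (i < size c)%N -> \sum_(j < size d) w i j = 1.
  by move=> ic; rewrite -B_sumr (frame_sum Fd) (B_unit_frame uu Fc).
have wr j : (j < size d)%N -> \sum_(i < size c) w i j = 1.
  by move=> ic; rewrite -B_suml (frame_sum Fc) BC (B_unit_frame uu Fd).
have -> : \sum_(j < size d) ln (b j) - \sum_(i < size c) ln (a i) =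
    \sum_(i < size c) \sum_(j < size d) w i j * (ln (b j) - ln (a i)).
  rewrite [RHS](_ : _ = \sum_(i < size c) \sum_(j < size d) w i j * ln (b j)
     - \sum_(i < size c) \sum_(j < size d) w i j * ln (a i)).
    congr (_ - _).
      rewrite exchange_big /=; apply: eq_bigr => j _.
      by rewrite -mulr_suml wr// mul1r.
    by apply: eq_bigr => i _; rewrite -mulr_suml wl// mul1r.
  rewrite -sumrB; apply: eq_bigr => i _; rewrite -sumrB; apply: eq_bigr => j _.
  by rewrite mulrBr.
have -> : B (fsum c (fun i => (a i)^-1)) (fsum d b - fsum c a) =
    \sum_(i < size c) \sum_(j < size d) w i j * (b j / a i - 1).
  rewrite BDr BNr [X in _ - X](_ : _ = \sum_(i < size c) \sum_(j < size d) w i j).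
    rewrite B_suml -sumrB; apply: eq_bigr => i _; rewrite B_sumr -sumrB.
    by apply: eq_bigr => j _; rewrite BZl BZr -/(w i j); field; rewrite gt_eqF ?a0.
  rewrite B_suml; apply: eq_bigr => i _; rewrite wl// BZl BC.
  rewrite -[X in B _ X](frame_idem Fc (ltn_ord i)) -Bassoc jmulC (fsum_eigen Fc)// BZl.
  rewrite (B_frame uu Fc)//.
  by rewrite mulr1 mulVf// gt_eqF ?a0.
apply: ler_sum => i _; apply: ler_sum => j _; apply: ler_wpM2l; first exact: w0.
by rewrite -ln_div ?posrE ?a0 ?b0// ln_le_sub1// divr_gt0 ?a0 ?b0.
Qed.

End LogDet.

Lemma ln_prod n (a : nat -> R) : (forall i, (i < n)%N -> 0 < a i) ->
  ln (\prod_(i < n) a i) = \sum_(i < n) ln (a i).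
Proof.
elim: n => [|n IH] a0; first by rewrite !big_ord0 ln1.
rewrite !big_ord_recr /= lnM ?posrE ?a0//; last first.
  by apply: prodr_gt0 => i _; rewrite a0// ltnW// ltnS.
by rewrite IH// => i ni; rewrite a0// ltnW.
Qed.

(** For two decompositions of one element, the log-determinant inequality has right-hand side 0 in
    both directions. The products agree without any matching of the eigenvalues. *)
Lemma jdet_fsum u c a : idem u -> jordan_frame mul u c ->
  (forall i, (i < size c)%N -> 0 < a i) ->
  jdet mul u (fsum c a) = \prod_(i < size c) a i.
Proof.
move=> uu Fc a0; apply: xget_unique => /=.
  exists c, (mkseq a (size c)); split; last by rewrite (big_nth 0) size_mkseq big_mkord; apply: eq_bigr => i _; rewrite nth_mkseq.
  split=> //; first by rewrite size_mkseq.
  by rewrite big_mkord; apply: eq_bigr => i _; rewrite nth_mkseq.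
move=> t [d [l [sd ->]]]; have [Fd ld _] := sd; have xE := spectral_fsum sd.
have l0 : forall i, (i < size d)%N -> 0 < l`_i.
  by apply/(posin_fsum (fun i => l`_i) uu Fd); rewrite -xE; apply/(posin_fsum _ uu Fc).
have P0 : 0 < \prod_(i < size c) a i by apply: prodr_gt0 => i _; exact: a0.
rewrite (big_nth 0) big_mkord ld.
have P1 : 0 < \prod_(i < size d) l`_i by apply: prodr_gt0 => i _; exact: l0.
apply: ln_inj => //; rewrite !ln_prod//.
have := logdet_fsum_le uu Fc Fd a0 l0; have := logdet_fsum_le uu Fd Fc l0 a0.
by rewrite -xE subrr !B0r; lra.
Qed.

Section Posin.
Variable u : V.
Hypothesis uu : idem u.

Lemma jdet_gt0 x : posin u x -> 0 < jdet mul u x.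
Proof.
by move=> /(posinP uu)[c [a [Fc -> a0]]]; rewrite jdet_fsum//; apply: prodr_gt0 => i _; exact: a0.
Qed.

Lemma logdet_le x y : posin u x -> posin u y ->
  ln (jdet mul u y) - ln (jdet mul u x) <= B (jinv mul u x) (y - x).
Proof.
move=> /(posinP uu)[c [a [Fc -> a0]]] /(posinP uu)[d [b [Fd -> b0]]].
rewrite !jdet_fsum// !ln_prod// (jinv_fsum uu Fc); last by move=> i /a0 /lt0r_neq0.
exact: (logdet_fsum_le uu Fc Fd).
Qed.

Lemma jinvP x : posin u x -> x ** jinv mul u x = u.
Proof.
move=> /(posinP uu)[c [a [Fc -> a0]]]; rewrite (jinv_fsum uu Fc); last first.
  by move=> i /a0 /lt0r_neq0.
rewrite (fsum_mul Fc) -[RHS](fsum1 Fc); apply: eq_fsum => i ic.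
by rewrite mulfV// lt0r_neq0// a0.
Qed.

Lemma jinv_posin x : posin u x -> posin u (jinv mul u x).
Proof.
move=> /(posinP uu)[c [a [Fc -> a0]]]; rewrite (jinv_fsum uu Fc); last first.
  by move=> i /a0 /lt0r_neq0.
by apply/(posin_fsum _ uu Fc) => i ic; rewrite invr_gt0 a0.
Qed.

Lemma posin_inj x v w : posin u x -> u ** v = v -> u ** w = w -> x ** v = x ** w -> v = w.
Proof.
move=> [_ px] uv uw xvw; apply/eqP; rewrite -subr_eq0; apply: contraT => vw.
have := px (v - w); rewrite !jmulE uv uw xvw subrr B0l ltxx.
by move=> /(_ erefl vw).
Qed.

(** Injectivity of $L(x)$ on $V(u,1)$ lets an inverse be verified by a single product; the Schur
    formulas below are checked this way. *)
Lemma jinv_unique x y : posin u x -> u ** y = y -> x ** y = u -> y = jinv mul u x.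
Proof.
move=> px uy xy; apply: (posin_inj px uy); first by case: (jinv_posin px).
by rewrite xy jinvP.
Qed.

Lemma jinvK x : posin u x -> jinv mul u (jinv mul u x) = x.
Proof.
move=> px; apply/esym/jinv_unique; [exact: jinv_posin | by case: px | ].
by rewrite jmulC jinvP.
Qed.

Lemma jinv_comm x v : posin u x ->
  x ** (jinv mul u x ** v) = jinv mul u x ** (x ** v).
Proof.
move=> /(posinP uu)[c [a [Fc -> a0]]]; rewrite (jinv_fsum uu Fc); last first.
  by move=> i /a0 /lt0r_neq0.
exact: (fsum_comm Fc).
Qed.

Lemma mul_qrep_jinv x v : posin u x ->
  x ** P (jinv mul u x) v = jinv mul u x ** P u v.
Proof.
move=> /(posinP uu)[c [a [Fc -> a0]]].
have a1 i : (i < size c)%N -> a i != 0 by move=> /a0 /lt0r_neq0.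
by rewrite (jinv_fsum uu Fc)// (fsum_inv_qrep uu Fc).
Qed.

Lemma qrep_in x v : u ** x = x -> u ** P x v = P x v.
Proof. by move=> /(spectral_fsumP uu)[c [a [Fc ->]]]; exact: fsum_qrep_in. Qed.

Lemma posin_qrep x : posin e x -> posin u (P u x).
Proof.
move=> [_ px]; split=> [|v uv v0]; first exact: qrep_idem.
have := px v (jmul1l v) v0; rewrite !(jmulC _ v) !Bassoc.
by rewrite qrep_sym qrep_idem1// peirce1_mul.
Qed.

Lemma orth_projE x : orth_proj mul e u x = P u x.
Proof.
rewrite /orth_proj ipE; apply: xget_unique => /=.
  split=> [|z uz]; first exact: qrep_idem.
  by rewrite BDl BNl qrep_sym qrep_idem1// subrr.
move=> y [uy H]; apply/eqP; rewrite -subr_eq0; apply/eqP/B_eq0.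
have uz : u ** (y - P u x) = y - P u x by rewrite jmulDr jmulNr uy qrep_idem.
have := H _ uz; rewrite -{1}[x](subrK (P u x)) => E.
have : B (x - P u x) (y - P u x) = 0.
  by rewrite BDl BNl qrep_sym (qrep_idem1 uu uz) subrr.
by move: E; rewrite !BlE; lra.
Qed.

End Posin.

Lemma half_part_sym p x y : B (half_part p x) y = B x (half_part p y).
Proof. by rewrite /half_part !BlE !BrE !Bassoc. Qed.

(** The squared norm of the $V_{1/2}(u)$ part of $v$ is $4(\langle uv,v\rangle-|uv|^2)$, hence
    $|uv|^2\le\langle uv,v\rangle$. *)
Lemma idem_mul_eq0 u v : idem u -> B (u ** v) v = 0 -> u ** v = 0.
Proof.
move=> uu H; have := half_part_half (half_partP v uu) => hh.
have := B_ge0 (half_part u v); rewrite -half_part_sym hh.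
rewrite /half_part BZl BDl BNl H Bassoc => h0; apply: B_eq0.
by have := B_ge0 (u ** v); lra.
Qed.

Lemma fsum_mul_ge0 u d a v : idem u -> jordan_frame mul u d ->
  (forall i, (i < size d)%N -> 0 <= a i) -> 0 <= B (fsum d a ** v) v.
Proof.
move=> uu Fd a0; have := ext_fsum u d 0 a; rewrite scale0r add0r => <-.
have := @mul_osys_ge _ _ (ext_frame_osys uu Fd) (ext_frame_sum1 Fd) _ 0 v.
by rewrite mul0r; apply; case=> [[|i]] //= ic; exact: a0.
Qed.

(** In contrast to [posin_ge], [v] ranges over all of [V], with $L(u)$ in place of the identity.
    [posin_lift] tests vectors outside $V(u,1)$. *)
Lemma posin_mul_ge u x : idem u -> posin u x ->
  exists2 k, 0 < k & forall v, k * B (u ** v) v <= B (x ** v) v.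
Proof.
move=> uu /(posinP uu)[c [a [Fc -> a0]]].
have [k k0 ak] := positive_lower_bound a0.
exists k => // v.
have : 0 <= B (fsum c (fun i => a i - k) ** v) v.
  by apply: (fsum_mul_ge0 _ uu Fc) => i ic; rewrite subr_ge0 ak.
have -> : fsum c (fun i => a i - k) = fsum c a - k *: u.
  by rewrite -{1}(fsum1 Fc) -scaleNr fsumZ fsumD; apply: eq_fsum => i _; rewrite mulr1.
by rewrite !jmulE !BlE; lra.
Qed.

(** * Schur complements *)

Section Schur.
Variables (u c : V).
Hypotheses (uu : idem u) (cP : primitive_idempotent mul e c) (uc : u ** c = 0).

Let cc : idem c := primitive_idem cP.

Lemma add_idem : idem (u + c).
Proof. by rewrite /idem !jmulE uu cc (jmulC c) uc addr0 add0r. Qed.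

Lemma add_in n : u ** n = n -> (u + c) ** n = n.
Proof. by move=> un; rewrite jmulDl un (jmulC c) (peirce10_mul uu un uc) addr0. Qed.

Lemma mul_c n : u ** n = n -> c ** n = 0.
Proof. by move=> un; rewrite jmulC (peirce10_mul uu un uc). Qed.

Lemma Bcc : B c c = 1.
Proof. exact: HB1. Qed.

Lemma mul_c_half z w : c ** z = 2^-1 *: z -> c ** w = 2^-1 *: w ->
  c ** (z ** w) = (B z w / 2) *: c.
Proof.
move=> cz cw; have H := peirce_half_mul cc cz cw.
have : P c (z ** w) = c ** (z ** w) by rewrite /qrep H cc; pair_with t; lra.
rewrite (qrep_primitive cP) Bcc divr1 => <-; congr (_ *: _).
by rewrite -Bassoc (jmulC z) cz BZl mulrC.
Qed.

(** For $z$ in $V_{1/2}(c)$, this is the $V_0(c)$ component of $z^2$: the subtracted term is the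
    component along $c$, and there is no $V_{1/2}(c)$ component by [peirce_half_mul]. *)
Definition sq0 (z : V) := z ** z - (B z z / 2) *: c.

Lemma sq0P z : c ** z = 2^-1 *: z -> c ** sq0 z = 0.
Proof. by move=> cz; rewrite /sq0 jmulDr jmulNr mul_c_half// jmulZr cc subrr. Qed.

Lemma sq0E z : z ** z = (B z z / 2) *: c + sq0 z.
Proof. by rewrite /sq0 addrC subrK. Qed.

Section Vector.
Variables (n z v : V) (xi eta : R) (Z : V).
Hypotheses (un : u ** n = n) (cz : c ** z = 2^-1 *: z) (uz : u ** z = 2^-1 *: z).
Hypotheses (vE : n ** z = v) (ZE : sq0 z = Z) (xiE : B z v / 2 = xi) (etaE : B z z / 2 = eta).

Let cn : c ** n = 0 := mul_c un.

Let cv : c ** v = 2^-1 *: v.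
Proof. by rewrite -vE (jmulC n) (peirce_half_zero cc). Qed.

Let cZ : c ** Z = 0. Proof. by rewrite -ZE sq0P. Qed.

Let zz : z ** z = eta *: c + Z. Proof. by rewrite -etaE -ZE sq0E. Qed.

Let czv : c ** (z ** v) = xi *: c. Proof. by rewrite -xiE mul_c_half. Qed.

Let zv : z ** v = xi *: c + 2^-1 *: (n ** Z).
Proof.
have := jordan4 z n c z; rewrite (jmulC z n) vE (jmulC n c) cn cz !jmulE zz !jmulE (jmulC n c) cn.
by rewrite (jmulC v z) czv => H; pair_with t; pair_eq H t; lra.
Qed.

(** In block matrices, $z$ has off-diagonal column $\zeta$, $Z=\zeta\zeta^T$, $v$ has column
    $n\zeta/2$ and $2\xi=\zeta^Tn\zeta$. The identity reads
    $\zeta\zeta^Tn\zeta=(\zeta^Tn\zeta)\zeta$. *)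
Lemma schur_sq0_mul : Z ** v = (xi / 2) *: z.
Proof.
have HA : z ** (n ** Z) = (eta / 2) *: v + Z ** v.
  have := jordanI z n; rewrite (jmulC z n) vE zz !jmulE cn !jmulE (jmulC Z n) cv => H.
  by pair_with t; pair_eq H t; lra.
have := jordan4 z z v c; rewrite zz !jmulE (jmulC v c) cv (jmulC z c) cz.
rewrite cc (jmulC v c) (jmulC Z c) cZ (jmulC v z) !(jmulC (z ** v) c) czv !jmulE cv.
rewrite (jmulC (z ** v) z) zv !jmulE HA (jmulC z c) cz => H.
by pair_with t; pair_eq H t; lra.
Qed.

(** The matrix with blocks $n$, $-n\zeta$, $k$ maps $(\zeta,1)$ to $(0,k-\zeta^Tn\zeta)$, and
    $\zeta^Tn\zeta=2\xi$. *)
Lemma schur_mul_lift k :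
  (n - 2 *: v + k *: c) ** (c + z + Z) = (k - 2 * xi) *: (c + 2^-1 *: z).
Proof.
rewrite !jmulE (jmulC n c) cn (jmulC v c) cv vE (jmulC v z) zv (jmulC v Z) schur_sq0_mul cc cz cZ.
by pair_with t; lra.
Qed.

Lemma inv_half_mul m : u ** m = m -> m ** n = u ->
  m ** (n ** z) = n ** (m ** z) -> m ** v = 4^-1 *: z.
Proof.
move=> um mn mnz; have cm := mul_c um.
have cmz : c ** (m ** z) = 2^-1 *: (m ** z).
  by rewrite (jmulC m) (peirce_half_zero cc).
have := jordan4 m n z c; rewrite mn (jmulC z m) vE.
rewrite (jmulC z c) cz (jmulC n c) cn (jmulC m c) cm uc.
rewrite (jmulC v c) cv (jmulC (m ** z) c) cmz !jmulE uz -mnz vE => H.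
by pair_with t; pair_eq H t; lra.
Qed.

Lemma schur_mul_inv m k : u ** m = m -> m ** n = u ->
  m ** (n ** z) = n ** (m ** z) -> (n - 2 *: v + k *: c) ** m = u - 2^-1 *: z.
Proof.
move=> um mn mnz; rewrite !jmulE (jmulC n) mn (jmulC v) inv_half_mul// (mul_c um).
by pair_with t; lra.
Qed.

End Vector.

(* In block-matrix terms, with [c] the last diagonal entry, this is the rank-one
   matrix $(\zeta, 1)^T(\zeta, 1)$. *)
Definition schur_lift (z : V) := c + z + sq0 z.

Section Lift.
Variable z : V.
Hypotheses (cz : c ** z = 2^-1 *: z) (uz : u ** z = 2^-1 *: z).

Lemma sq0_mul : sq0 z ** z = (B z z / 4) *: z.
Proof.
have := schur_sq0_mul uu cz uz erefl erefl erefl; rewrite jmulZr BrE => H.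
by pair_with t; pair_eq H t; lra.
Qed.

Lemma sq0_sq : sq0 z ** sq0 z = (B z z / 2) *: sq0 z.
Proof.
have cZ := sq0P cz; have Zz := sq0_mul; have zzE := sq0E z.
move: (sq0 z) => Z in cZ Zz zzE *.
have := jordanI z z; rewrite zzE !jmulE cz cc (jmulC Z c) cZ Zz !jmulE zzE => H.
by pair_with t; pair_eq H t; lra.
Qed.

(** A rank-one positive matrix is its trace times a projection; here the trace is $1+|\zeta|^2$ with
    $|\zeta|^2=\langle z,z\rangle/2$. *)
Lemma lift_sq : schur_lift z ** schur_lift z = (1 + B z z / 2) *: schur_lift z.
Proof.
have cZ := sq0P cz; have Zz := sq0_mul; have ZZ := sq0_sq; have zzE := sq0E z.
rewrite /schur_lift; move: (sq0 z) => Z in cZ Zz ZZ zzE *.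
rewrite !(jmulDl, jmulDr) cc (jmulC z c) cz (jmulC Z c) cZ ZZ (jmulC z Z) Zz zzE.
by pair_with t; lra.
Qed.

Lemma sq0_in : u ** sq0 z = sq0 z.
Proof.
have ucz : (u + c) ** z = z by rewrite jmulDl uz cz; pair_with t; lra.
have ucc : (u + c) ** c = c by rewrite jmulDl uc cc add0r.
have : (u + c) ** sq0 z = sq0 z.
  rewrite /sq0 jmulDr jmulNr jmulZr ucc; congr (_ - _).
  exact: (peirce1_mul add_idem).
by rewrite jmulDl (sq0P cz) addr0.
Qed.

Lemma lift_in : (u + c) ** schur_lift z = schur_lift z.
Proof.
have cZ := sq0P cz; have uZ := sq0_in; rewrite /schur_lift.
move: (sq0 z) => Z in cZ uZ *; rewrite !(jmulDl, jmulDr) uZ cZ uz cz uc cc.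
by pair_with t; lra.
Qed.

Lemma B_half_c : B z c = 0.
Proof. by have := Bassoc c z c; rewrite cz cc BZl; lra. Qed.

Lemma B_lift_c : B (schur_lift z) c = 1.
Proof.
have cZ := sq0P cz; rewrite /schur_lift; move: (sq0 z) => Z in cZ *.
rewrite !BDl Bcc B_half_c addr0.
by have := Bassoc c Z c; rewrite cc cZ B0l => <-; rewrite addr0.
Qed.

(** The lift is a positive multiple of an idempotent, so both summands give nonnegative forms. If
    that of $m$ vanishes at $v$, then $uv=0$ and $v$ is a multiple of $c$, where the lift is
    positive. *)
Lemma posin_lift m k : posin u m -> 0 < k -> posin (u + c) (m + k *: schur_lift z).
Proof.
move=> pm k0; split; first by rewrite jmulDr jmulZr lift_in add_in//; case: pm.
move=> v ucv v0; set g := schur_lift z; set eta := 1 + B z z / 2.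
have eta0 : 0 < eta by rewrite /eta; have := B_ge0 z; lra.
have [x gE xx] : exists2 x, g = eta *: x & idem x.
  exists (eta^-1 *: g); first by rewrite scalerA mulfV ?scale1r// gt_eqF.
  by rewrite /idem jmulZl jmulZr lift_sq !scalerA -/eta -mulrA mulVf ?mulr1// gt_eqF.
have [l l0 lP] := posin_mul_ge uu pm.
have Bx := idem_mul_ge0 v xx; have Bu := idem_mul_ge0 v uu.
rewrite gE jmulDl !jmulZl BDl !BZl; apply: lt_le_trans (lerD (lP v) (lexx _)).
have [Bu0|Bu0] := eqVneq (B (u ** v) v) 0; last first.
  have : 0 < l * B (u ** v) v by rewrite mulr_gt0// lt_def Bu0.
  have : 0 <= k * (eta * B (x ** v) v) by rewrite !mulr_ge0// ltW.
  lra.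
have uv := idem_mul_eq0 uu Bu0.
rewrite Bu0 mulr0 add0r !mulr_gt0// lt_def Bx andbT.
rewrite jmulDl uv add0r in ucv.
have [l' vE] := primitive_line e_idem cP ucv.
have l'0 : l' != 0 by apply: contra v0 => /eqP l'0; rewrite vE l'0 scale0r.
rewrite vE !(jmulZr, BZl, BZr) !mulf_eq0 (negbTE l'0) /=.
have -> : B (x ** c) c = eta^-1.
  have := B_lift_c; rewrite -/g gE BZl => E.
  by rewrite (jmulC x) Bassoc cc -[LHS](mulKf (lt0r_neq0 eta0)) E mulr1.
by rewrite invr_eq0 lt0r_neq0.
Qed.

Section Inverse.
Variable m : V.
Hypothesis pm : posin u m.
Let n := jinv mul u m.
Let xi := B z (n ** z) / 2.

Let um : u ** m = m. Proof. by case: pm. Qed.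
Let un : u ** n = n. Proof. by case: (jinv_posin uu pm). Qed.
Let mn : m ** n = u. Proof. exact: jinvP. Qed.

Lemma schur_mul k l : l * (k - 2 * xi) = 1 ->
  (n - 2 *: (n ** z) + k *: c) ** (m + l *: schur_lift z) = u + c.
Proof.
move=> lk; rewrite jmulDr jmulZr.
rewrite (schur_mul_inv un cz uz erefl)//; last exact: jinv_comm.
rewrite (schur_mul_lift un cz erefl erefl erefl erefl) -/xi scalerA lk.
by pair_with t; lra.
Qed.

(** The block inverse: $l^{-1}+2\xi$ is the corner entry $k$ whose Schur complement $k-2\xi$ equals
    $l^{-1}$. *)
Lemma jinv_lift l : 0 < l -> jinv mul (u + c) (m + l *: schur_lift z) =
  n - 2 *: (n ** z) + (l^-1 + 2 * xi) *: c.
Proof.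
move=> l0; apply/esym/(jinv_unique add_idem); first exact: posin_lift.
  rewrite jmulDr jmulDr jmulNr !jmulZr add_in//.
  rewrite [_ ** c]jmulDl uc cc add0r; congr (_ - _ *: _ + _).
  rewrite jmulDl (jmulC n) (peirce_half_zero cc cz (mul_c un)).
  by rewrite (jmulC z) (peirce_comm1 uu)// uz jmulZr; pair_with t; lra.
by rewrite jmulC schur_mul// addrK mulfV// gt_eqF.
Qed.

Lemma qrep_jinv_lift l : 0 < l ->
  P u (jinv mul (u + c) (m + l *: schur_lift z)) = n.
Proof.
move=> l0; rewrite jinv_lift// -scaleNr !qrepD !qrepZ (qrep_idem1 uu un).
rewrite (qrep_idem0 uu uc) (qrep_idem_half uu).
  by rewrite !scaler0 !addr0.
by rewrite (peirce_comm1 uu)// uz jmulZr.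
Qed.

End Inverse.
End Lift.

Lemma schur_decomposition a : posin (u + c) a -> exists z l,
  [/\ c ** z = 2^-1 *: z, u ** z = 2^-1 *: z, 0 < l &
      jinv mul (u + c) a = jinv mul u (P u a) + l *: schur_lift z].
Proof.
move=> pa; have uca := pa.1.
pose z0 := half_part c a; pose b := zero_part c a.
have cz0 : c ** z0 = 2^-1 *: z0 := half_partP a cc.
have cb : c ** b = 0 := zero_partP a cc.
have aE : a = B c a *: c + z0 + b.
  by rewrite {1}(peirce_decomp c a) (qrep_primitive cP) Bcc divr1.
have ucc : (u + c) ** c = c by rewrite jmulDl uc cc add0r.
have uca1 : (u + c) ** (c ** a) = c ** a by exact: (peirce1_mul add_idem).
have ucz0 : (u + c) ** z0 = z0.
  by rewrite /z0 /half_part jmulZr jmulDr jmulNr uca1 (peirce1_mul add_idem).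
have ucb : (u + c) ** b = b.
  rewrite /b /zero_part -/z0 (qrep_primitive cP) jmulDr jmulNr ucz0 jmulDr jmulNr uca.
  by rewrite jmulZr ucc.
have ub : u ** b = b by move: ucb; rewrite jmulDl cb addr0.
have uz0 : u ** z0 = 2^-1 *: z0.
  by move: ucz0; rewrite jmulDl cz0 => H; pair_with t; pair_eq H t; lra.
clearbody z0 b.
have Pa : P u a = b.
  rewrite aE !qrepD qrepZ (qrep_idem0 uu uc) (qrep_idem_half uu uz0) (qrep_idem1 uu ub).
  by rewrite scaler0 !add0r.
have pb : posin u b.
  split=> // v uv v0; have := pa.2 v (add_in uv) v0.
  rewrite !(jmulC _ v) !Bassoc -Pa qrep_sym qrep_idem1//.
  exact: peirce1_mul.
rewrite Pa; set m := jinv mul u b.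
have pm : posin u m := jinv_posin uu pb.
have mb : m ** b = u by rewrite jmulC jinvP.
have mK : jinv mul u m = b by rewrite jinvK.
(* The solution of $-2bz=z_0$, because $L(b)L(b^{-1})$ is 1/4 on $V_{1/2}(u)\cap V_{1/2}(c)$. *)
pose z := - 2 *: (m ** z0).
have cz : c ** z = 2^-1 *: z.
  rewrite /z jmulZr (jmulC m) (peirce_half_zero cc cz0) ?(mul_c pm.1)//.
  by rewrite !scalerA mulrC.
have uz : u ** z = 2^-1 *: z.
  by rewrite /z jmulZr (peirce_comm1 uu) ?pm.1// uz0 jmulZr !scalerA mulrC.
have bz : b ** z = - 2^-1 *: z0.
  rewrite /z jmulZr (inv_half_mul pm.1 cz0 uz0 erefl ub) ?(jmulC b m)//.
    by rewrite scalerA; congr (_ *: _); field.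
  by have := jinv_comm uu z0 pm; rewrite mK => ->.
have aE' : a = b - 2 *: (b ** z) + (B c a) *: c.
  by rewrite bz {1}aE; pair_with t; lra.
set xi := B z (b ** z) / 2; set k := B c a in aE' *.
(* Testing $L(a)$ on the lift $g$ isolates the Schur complement: $\langle
   ag,g\rangle=(k-2\xi)(1+\langle z,z\rangle/2)$. *)
have k0 : 0 < k - 2 * xi.
  have g0 : schur_lift z != 0.
    by apply/eqP => g0; have := B_lift_c cz; rewrite g0 B0l => /eqP; rewrite eq_sym oner_eq0.
  have := pa.2 _ (lift_in cz uz) g0.
  rewrite {1}aE' (schur_mul_lift ub cz erefl erefl erefl erefl) -/xi BZl pmulr_lgt0//.
  rewrite BDl BZl (BC c) B_lift_c//.
  have cZ := sq0P cz; rewrite /schur_lift; move: (sq0 z) => Z in cZ *.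
  rewrite !BDr B_half_c// add0r.
  have := Bassoc c z Z; rewrite cz cZ B0r BZl.
  by have := B_ge0 z; lra.
exists z, (k - 2 * xi)^-1; split=> //; first by rewrite invr_gt0.
apply/esym/(jinv_unique add_idem) => //.
  by rewrite jmulDr jmulZr lift_in// add_in// pm.1.
have := schur_mul cz uz pm; rewrite mK -/xi => H; rewrite {1}aE'; apply: H.
by rewrite mulVf// gt_eqF.
Qed.

End Schur.

(** * Chains of Schur complements along the frame *)

Section Chain.
Variable c : seq V.
Hypothesis Fc : jordan_frame mul e c.
Local Notation r := (size c).
Local Notation u := (frame_first c).

Lemma frame_first0 : u 0 = 0.
Proof. by rewrite /frame_first big_geq. Qed.

Lemma frame_firstS k : u k.+1 = u k + c`_k.
Proof. by rewrite /frame_first big_nat_recr. Qed.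

Lemma frame_first_size : u r = e.
Proof. by rewrite /frame_first big_mkord (frame_sum Fc). Qed.

Lemma frame_first_mul k j : (k <= r)%N -> (j < r)%N ->
  u k ** c`_j = (j < k)%N%:R *: c`_j.
Proof.
elim: k => [|k IH] kr jr; first by rewrite frame_first0 jmul0l scale0r.
rewrite frame_firstS jmulDl IH ?(ltnW kr)// (frame_mul Fc)//.
have -> : (j < k.+1)%N = (j == k) || (j < k)%N by rewrite ltnS leq_eqVlt.
have [->|kj] := eqVneq k j; first by rewrite ltnn scale0r add0r.
by rewrite /= scale0r addr0.
Qed.

Lemma frame_first_mul_le j k : (j <= k)%N -> (k <= r)%N -> u k ** u j = u j.
Proof.
move=> jk kr; rewrite {2 3}/frame_first jmul_sumr !big_mkord; apply: eq_bigr => i _.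
have ik : (i < k)%N := leq_trans (ltn_ord i) jk.
by rewrite frame_first_mul// ?ik ?scale1r// (leq_trans ik).
Qed.

Lemma frame_first_idem k : (k <= r)%N -> idem (u k).
Proof. by move=> kr; exact: frame_first_mul_le. Qed.

Lemma frame_first_orth k : (k < r)%N -> u k ** c`_k = 0.
Proof. by move=> kr; rewrite frame_first_mul ?ltnn ?scale0r// ltnW. Qed.

Lemma frame_elt_primitive k : (k < r)%N -> primitive_idempotent mul e c`_k.
Proof. exact: (frame_primitive e_idem Fc). Qed.

Lemma qrep_tower j k x : (j <= k)%N -> (k <= r)%N -> P (u j) (P (u k) x) = P (u j) x.
Proof.
move=> jk kr; have jr := leq_trans jk kr.
have ij := frame_first_idem jr; have ik := frame_first_idem kr.
apply: B_ext => w; rewrite !qrep_sym; congr (B x _).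
apply: (qrep_idem1 ik); apply: (peirce1_sub ik ij (frame_first_mul_le jk kr)).
exact: qrep_idem.
Qed.

Lemma posin0 : posin 0 0.
Proof. by split=> [|v]; rewrite jmul0l// => <-; rewrite eqxx. Qed.

(* $[(P_k x)^{-1}]_0$ *)
Definition pinverse k x := jinv mul (u k) (P (u k) x).

Lemma pinverse_posin k x : (k <= r)%N -> posin e x -> posin (u k) (pinverse k x).
Proof.
move=> kr px; have ik := frame_first_idem kr.
exact/(jinv_posin ik)/(posin_qrep ik).
Qed.

Lemma pinverse_in k x : (k <= r)%N -> posin e x -> u k ** pinverse k x = pinverse k x.
Proof. by move=> kr px; case: (pinverse_posin kr px). Qed.

Lemma pinverse0 x : posin e x -> pinverse 0 x = 0.
Proof.
by move=> px; have := pinverse_in (leq0n _) px; rewrite frame_first0 jmul0l => <-.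
Qed.

Lemma qrep_e x : P e x = x.
Proof. by rewrite /qrep !jmul1l; pair_with t; lra. Qed.

Lemma pinverse_size x : pinverse r x = jinv mul e x.
Proof. by rewrite /pinverse frame_first_size qrep_e. Qed.

Lemma pinverse_step k x : (k < r)%N -> posin e x -> exists z l,
  [/\ c`_k ** z = 2^-1 *: z, u k ** z = 2^-1 *: z, 0 < l &
      pinverse k.+1 x = pinverse k x + l *: schur_lift c`_k z].
Proof.
move=> kr px; have ik := frame_first_idem (ltnW kr).
have pa : posin (u k + c`_k) (P (u k.+1) x).
  by rewrite -frame_firstS; apply: (posin_qrep (frame_first_idem kr)).
have [z [l [cz uz l0 E]]] :=
  schur_decomposition ik (frame_elt_primitive kr) (frame_first_orth kr) pa.
exists z, l; split=> //; move: E.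
by rewrite -frame_firstS qrep_tower.
Qed.

(* Writing [pinverse i x] as $\sum_{j < i} q_j$, this is $\sum_{j < k} t_j q_j$. *)
Definition rescale (t : nat -> R) k x :=
  \sum_(i < k) t i *: (pinverse i.+1 x - pinverse i x).

Lemma rescaleS t k x :
  rescale t k.+1 x = rescale t k x + t k *: (pinverse k.+1 x - pinverse k x).
Proof. by rewrite /rescale big_ord_recr. Qed.

Section Rescale.
Variables (t : nat -> R) (x : V).
Hypotheses (t0 : forall i, (i < r)%N -> 0 < t i) (px : posin e x).

Lemma rescale_posin k : (k <= r)%N -> posin (u k) (rescale t k x).
Proof.
elim: k => [|k IH] kr; first by rewrite /rescale big_ord0 frame_first0; exact: posin0.
have [z [l [cz uz l0 E]]] := pinverse_step kr px.
rewrite rescaleS frame_firstS E [pinverse k x + _]addrC addrK scalerA.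
apply: posin_lift => //; first exact/frame_first_idem/ltnW.
- exact: frame_elt_primitive.
- exact: frame_first_orth.
- exact/IH/ltnW.
- by rewrite mulr_gt0// t0.
Qed.

Lemma qrep_jinv_rescaleS k : (k < r)%N ->
  P (u k) (jinv mul (u k.+1) (rescale t k.+1 x)) = jinv mul (u k) (rescale t k x).
Proof.
move=> kr; have [z [l [cz uz l0 E]]] := pinverse_step kr px.
rewrite rescaleS frame_firstS E [pinverse k x + _]addrC addrK scalerA.
apply: qrep_jinv_lift => //; first exact/frame_first_idem/ltnW.
- exact: frame_elt_primitive.
- exact: frame_first_orth.
- exact/rescale_posin/ltnW.
- by rewrite mulr_gt0// t0.
Qed.

Lemma qrep_jinv_rescale k m : (k <= m)%N -> (m <= r)%N ->
  P (u k) (jinv mul (u m) (rescale t m x)) = jinv mul (u k) (rescale t k x).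
Proof.
have refl j : (j <= r)%N -> P (u j) (jinv mul (u j) (rescale t j x)) = jinv mul (u j) (rescale t j x).
  move=> jr; apply: qrep_idem1; first exact: frame_first_idem.
  exact: (jinv_posin (frame_first_idem jr) (rescale_posin jr)).1.
elim: m => [|m IH]; rewrite leq_eqVlt => /orP[/eqP -> /refl//|//].
by rewrite ltnS => km mr; rewrite -(qrep_tower _ km (ltnW mr)) qrep_jinv_rescaleS// IH// ltnW.
Qed.

Lemma rescale_size_posin : posin e (rescale t r x).
Proof. by rewrite -frame_first_size; exact: rescale_posin. Qed.

Lemma pinverse_jinv_rescale k : (k <= r)%N ->
  pinverse k (jinv mul e (rescale t r x)) = rescale t k x.
Proof.
move=> kr; rewrite /pinverse -{1}frame_first_size qrep_jinv_rescale// jinvK//.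
  exact: frame_first_idem.
exact: rescale_posin.
Qed.

End Rescale.

Variable s : nat -> R.
Hypothesis s0 : forall i, (i < r)%N -> 0 < s i.

(** By [pinverse_jinv_rescale] the full sum determines all partial sums; the increments are then
    compared one at a time, dividing by [s]. *)
Lemma rescale_inj x y : posin e x -> posin e y ->
  rescale s r x = rescale s r y -> x = y.
Proof.
move=> px py E; suff W k : (k <= r)%N -> pinverse k x = pinverse k y.
  have := W r (leqnn r); rewrite !pinverse_size -{2}(jinvK e_idem px) => ->.
  by rewrite (jinvK e_idem).
have SE j : (j <= r)%N -> rescale s j x = rescale s j y.
  by move=> jr; rewrite -(pinverse_jinv_rescale s0 px jr) -(pinverse_jinv_rescale s0 py jr) E.
elim: k => [|k IH] kr; first by rewrite !pinverse0.
have := SE _ kr; rewrite !rescaleS SE ?(ltnW kr)// IH ?(ltnW kr)// => /addrI.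
by move=> /(scalerI (lt0r_neq0 (s0 kr)))/addIr.
Qed.

(** The increments attached to $m^{-1}$ sum to $m$. Dividing them by $s_i$ and inverting their sum
    gives a point whose own increments are the divided ones. *)
Lemma rescale_surj m : posin e m -> exists2 x, posin e x & rescale s r x = m.
Proof.
move=> pm; pose x0 := jinv mul e m; pose t i := (s i)^-1.
have t0 i : (i < r)%N -> 0 < t i by move=> ir; rewrite invr_gt0 s0.
have p0 : posin e x0 by exact: (jinv_posin e_idem).
exists (jinv mul e (rescale t r x0)).
  exact/(jinv_posin e_idem)/rescale_size_posin.
transitivity (\sum_(i < r) (pinverse i.+1 x0 - pinverse i x0)).
  apply: eq_bigr => i _; rewrite !pinverse_jinv_rescale//; last exact/ltnW.
  rewrite rescaleS [rescale t i x0 + _]addrC addrK scalerA mulfV ?scale1r//.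
  by rewrite gt_eqF ?s0.
transitivity (pinverse r x0 - pinverse 0 x0).
  elim: (r) => [|k IH]; first by rewrite big_ord0 subrr.
  by rewrite big_ord_recr /= IH addrC addrA subrK.
by rewrite pinverse0// subr0 pinverse_size (jinvK e_idem).
Qed.

End Chain.

(** * Summation by parts for quadratic maps *)

Section QuadraticRescale.
Variables (p : V -> V) (Q : V -> V -> V).
Hypotheses (Q0 : forall v, Q 0 v = 0) (QD : forall v x z, Q (x + z) v = Q x v + Q z v).
Hypothesis QZ : forall k x v, Q (k *: x) v = k *: Q x v.
Hypothesis PD : forall x z k, p (x + k *: z) = p x + (2 * k) *: Q x z + k ^+ 2 *: p z.
Hypothesis PZ : forall z k, p (k *: z) = k ^+ 2 *: p z.

(** Induction on [r]. With $a_k=s_k^{-1}-s_{k-1}^{-1}$, where $s_{-1}^{-1}$ is read as 0, the sums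
    $\sum_{i\le k}a_i$ are $s_k^{-1}$ and $\sum_{i<r}a_i(S_r-S_i)=W_r$. These account for the pure
    and the cross terms created by $q_r$. *)
Lemma quadratic_rescale (q : nat -> V) (s : nat -> R) r :
  (forall i, (i < r)%N -> s i != 0) ->
  let W k := \sum_(i < k) q i in let S k := \sum_(i < k) s i *: q i in
  \sum_(k < r) s k *: (p (W k.+1) - p (W k)) =
  \sum_(k < r) ((s k)^-1 - (if val k is j.+1 then (s j)^-1 else 0)) *: p (S r - S k).
Proof.
move=> + W S; pose a k := (s k)^-1 - (if k is j.+1 then (s j)^-1 else 0).
rewrite -[RHS]/(\sum_(k < r) a k *: p (S r - S k)).
have sum_a k : \sum_(i < k.+1) a i = (s k)^-1.
  elim: k => [|k IH]; first by rewrite big_ord1 /a subr0.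
  by rewrite big_ord_recr /= IH /a addrC subrK.
have SS k : S k.+1 = S k + s k *: q k by rewrite /S big_ord_recr.
have WS k : W k.+1 = W k + q k by rewrite /W big_ord_recr.
have SD k i : S k.+1 - S i = (S k - S i) + s k *: q k by rewrite SS addrAC.
elim: r => [|r IH] sr; first by rewrite !big_ord0.
have sr' i : (i < r)%N -> s i != 0 by move=> ir; rewrite sr// ltnW.
have sum_aS k : (forall i, (i < k)%N -> s i != 0) -> \sum_(i < k) a i *: (S k - S i) = W k.
  elim: k => [|k IHk] sk; first by rewrite big_ord0 /W big_ord0.
  under eq_bigr do rewrite SD scalerDr scalerA.
  rewrite big_split /= -scaler_suml big_ord_recr /= subrr scaler0 addr0.
  rewrite IHk => [|i ik]; last by rewrite sk// ltnW.
  by rewrite -mulr_suml sum_a mulVf ?scale1r ?sk// WS.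
have Qsum I (l : seq I) (F : I -> V) v :
    Q (\sum_(i <- l) F i) v = \sum_(i <- l) Q (F i) v.
  by apply: (big_morph (fun x => Q x v)); [exact: QD|exact: Q0].
have sr0 : s r != 0 by exact: sr.
have SSr : S r.+1 - S r = s r *: q r by rewrite SS addrAC subrr add0r.
rewrite big_ord_recr /= IH// [in RHS]big_ord_recr /= SSr PZ.
under [in RHS]eq_bigr do rewrite SD PD !scalerDr.
rewrite !big_split /= -!addrA; congr (_ + _).
have -> : \sum_(i < r) a i *: ((2 * s r) *: Q (S r - S i) (q r)) = (2 * s r) *: Q (W r) (q r).
  rewrite -sum_aS// Qsum scaler_sumr; apply: eq_bigr => i _.
  by rewrite QZ !scalerA mulrC.
have -> : \sum_(i < r) a i *: (s r ^+ 2 *: p (q r)) = ((\sum_(i < r) a i) * s r ^+ 2) *: p (q r).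
  by rewrite mulr_suml scaler_suml; apply: eq_bigr => i _; rewrite scalerA.
have := sum_a r; rewrite big_ord_recr /= => /(canRL (addrK _)) ->.
by rewrite WS -[q r in LHS]scale1r PD; pair_with t; field.
Qed.

End QuadraticRescale.

Lemma qrep_rescale (q : nat -> V) (s : nat -> R) r y :
  (forall i, (i < r)%N -> s i != 0) ->
  let W k := \sum_(i < k) q i in let S k := \sum_(i < k) s i *: q i in
  \sum_(k < r) s k *: (P (W k.+1) y - P (W k) y) =
  \sum_(k < r) ((s k)^-1 - (if val k is j.+1 then (s j)^-1 else 0)) *: P (S r - S k) y.
Proof.
pose Q x z := x ** (z ** y) + z ** (x ** y) - (x ** z) ** y.
apply: (@quadratic_rescale (fun x => P x y) Q).
- by move=> v; rewrite /Q !jmulE; pair_with t; lra.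
- by move=> v x z; rewrite /Q !jmulE; pair_with t; lra.
- by move=> k x v; rewrite /Q !jmulE; pair_with t; lra.
- by move=> x z k; rewrite /qrep /Q !jmulE (jmulC z x); pair_with t; lra.
- by move=> z k; rewrite /qrep !jmulE; pair_with t; lra.
Qed.

(** * Differential calculus on the cone *)

Lemma homogeneous_lower_bound n (phi : 'rV[R]_n -> R) : continuous phi ->
  (forall a, a != 0 -> 0 < phi a) -> (forall k a, phi (k *: a) = k ^+ 2 * phi a) ->
  exists2 k, 0 < k & forall a, k * `|a| ^+ 2 <= phi a.
Proof.
move=> phic phi0 phiZ; pose A := [set a : 'rV[R]_n | `|a| = 1].
have phi00 : phi 0 = 0 by rewrite -(scale0r 0) phiZ expr0n mul0r.
have normed a : a != 0 -> A (`|a|^-1 *: a).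
  move=> a0; rewrite /A /= normrZ normfV normr_id mulVf//.
  by rewrite normr_eq0.
have [A0|A0] := pselect (A !=set0); last first.
  (* For [n = 0] the unit sphere is empty and 0 is the only vector. *)
  exists 1 => // a; have [->|/normed H] := eqVneq a 0.
    by rewrite normr0 expr0n mulr0 phi00.
  by exfalso; apply: A0; exists (`|a|^-1 *: a).
have cA : compact A.
  apply: bounded_closed_compact.
    exists 1; split=> // M M1 a /= ->; exact: ltW.
  rewrite (_ : A = Num.norm @^-1` [set x | x = 1 :> R])//.
  by apply: closed_comp; [move=> a _; exact: norm_continuous | exact: closed_eq].
have [a aA amin] := EVT_min_rV A0 cA (continuous_subspaceT phic).
have a0 : a != 0.
  by move: aA; rewrite inE /A /= => a1; rewrite -normr_eq0 a1 oner_eq0.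
exists (phi a); first exact: phi0.
move=> b; have [->|b0] := eqVneq b 0; first by rewrite normr0 expr0n mulr0 phi00.
have := amin (`|b|^-1 *: b); rewrite inE phiZ => /(_ (normed b b0)).
by rewrite exprVn ler_pdivlMl ?exprn_gt0 ?normr_gt0// mulrC.
Qed.

(** * Comparison of norms and bounds for bilinear maps *)

Section Coordinates.
Variables (n : nat) (f : {linear 'rV[R]_n -> V}) (g : V -> 'rV[R]_n).
Hypotheses (fg : cancel f g) (gf : cancel g f).

Let b i := f (delta_mx 0 i).

Lemma coordinates_sum a : f a = \sum_i a 0 i *: b i.
Proof.
by rewrite {1}(row_sum_delta a) linear_sum; apply: eq_bigr => i _; rewrite linearZ.
Qed.

Lemma coordinate_le (a : 'rV[R]_n) i : `|a 0 i| <= `|a|.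
Proof.
rewrite [leRHS]/Num.Def.normr /= mx_normrE; apply/bigmax_geP; right => /=.
by exists (0, i).
Qed.

Lemma continuous_bigsum (T : topologicalType) I (l : seq I) (F : I -> T -> R) :
  (forall i, continuous (F i)) -> continuous (fun x => \sum_(i <- l) F i x).
Proof.
move=> Fc; elim: l => [|i l IH] x.
  by under eq_fun do rewrite big_nil; exact: cvg_cst.
by under eq_fun do rewrite big_cons; apply: cvgD; [exact: Fc | exact: IH].
Qed.

Lemma coordinates_continuous : continuous f.
Proof.
apply: bounded_linear_continuous; apply/linear_boundedP.
pose K := \sum_i `|b i|; near=> k => a.
have Kk : K <= k by near: k; apply: nbhs_pinfty_ge; rewrite num_real.
apply: le_trans (ler_wpM2r (normr_ge0 a) Kk); rewrite coordinates_sum /K mulr_suml.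
apply: le_trans (ler_norm_sum _ _ _) _; apply: ler_sum => i _.
by rewrite normrZ mulrC ler_wpM2l// coordinate_le.
Unshelve. all: by end_near. Qed.

Lemma coordinates_le : exists2 C, 0 < C & forall v, `|g v| <= C * `|v|.
Proof.
have [|a a0|k a|k k0 kP] := @homogeneous_lower_bound n (fun a => `|f a| ^+ 2).
- move=> a; apply: (@continuousM _ _ (fun a => `|f a|) (fun a => `|f a|));
  apply: (@continuous_comp _ _ _ f Num.norm); by [exact: coordinates_continuous|exact: norm_continuous].
- rewrite exprn_gt0// normr_gt0; apply: contra a0 => /eqP fa.
  by rewrite -(fg a) fa -(linear0 f) fg.
- by rewrite linearZ /= normrZ exprMn real_normK// num_real.
have sk : 0 < Num.sqrt k by rewrite sqrtr_gt0.
exists (Num.sqrt k)^-1; first by rewrite invr_gt0.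
move=> v; rewrite ler_pdivlMl// -(@ler_pXn2r _ 2)// ?nnegrE ?mulr_ge0 ?(ltW sk)//.
by rewrite exprMn sqr_sqrtr ?(ltW k0)//; have := kP (g v); rewrite gf.
Qed.

Lemma form_lower_bound : exists2 C, 0 < C & forall v, `|v| ^+ 2 <= C * B v v.
Proof.
have [|a a0|k a|k k0 kP] := @homogeneous_lower_bound n (fun a => B (f a) (f a)).
- have -> : (fun a => B (f a) (f a)) =
      (fun a : 'rV[R]_n => \sum_i \sum_j (a 0 i * a 0 j) * B (b i) (b j)).
    apply/funext => a; rewrite {1}coordinates_sum B_suml; apply: eq_bigr => i _.
    rewrite coordinates_sum BZl B_sumr mulr_sumr; apply: eq_bigr => j _.
    by rewrite BZr mulrA.
  apply: continuous_bigsum => i; apply: continuous_bigsum => j a.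
  have ci k : {for a, continuous (fun a : 'rV[R]_n => a 0 k)} by exact: coord_continuous.
  have cij : {for a, continuous (fun a : 'rV[R]_n => a 0 i * a 0 j)}.
    exact: (continuousM (ci i) (ci j)).
  exact: (continuousM cij (@cst_continuous _ _ (B (b i) (b j)) a)).
- apply: B_gt0; apply: contra a0 => /eqP fa.
  by rewrite -(fg a) fa -(linear0 f) fg.
- by rewrite linearZ /= BZl BZr mulrA.
pose K := \sum_i `|b i|; exists ((K + 1) ^+ 2 / k).
  by rewrite divr_gt0// exprn_gt0// ltr_wpDl// sumr_ge0.
move=> v; have K0 : 0 <= K by exact: sumr_ge0.
have vK : `|v| <= (K + 1) * `|g v|.
  rewrite -{1}(gf v) coordinates_sum; apply: (@le_trans _ _ (K * `|g v|)).
    rewrite /K mulr_suml; apply: le_trans (ler_norm_sum _ _ _) _; apply: ler_sum => i _.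
    by rewrite normrZ mulrC ler_wpM2l// coordinate_le.
  by rewrite ler_wpM2r// lerDl.
apply: (@le_trans _ _ (((K + 1) * `|g v|) ^+ 2)).
  by rewrite ler_pXn2r ?nnegrE ?mulr_ge0 ?addr_ge0.
rewrite exprMn -[leRHS]mulrA; apply: ler_wpM2l; first by rewrite exprn_ge0 ?addr_ge0.
rewrite ler_pdivlMl//.
by have := kP (g v); rewrite gf.
Qed.

Lemma bilinear_bound (W : normedModType R) (beta : V -> V -> W) :
  (forall x y z, beta (x + y) z = beta x z + beta y z) ->
  (forall x y z, beta z (x + y) = beta z x + beta z y) ->
  (forall k x z, beta (k *: x) z = k *: beta x z) ->
  (forall k x z, beta z (k *: x) = k *: beta z x) ->
  exists2 C, 0 < C & forall v w, `|beta v w| <= C * `|v| * `|w|.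
Proof.
move=> Dl Dr Zl Zr; have [C C0 gC] := coordinates_le.
have zl z : beta 0 z = 0 by rewrite -(scale0r 0) Zl scale0r.
have zr z : beta z 0 = 0 by rewrite -(scale0r 0) Zr scale0r.
pose K := \sum_i \sum_j `|beta (b i) (b j)|.
have K0 : 0 <= K by apply: sumr_ge0 => i _; exact: sumr_ge0.
exists ((K + 1) * C ^+ 2); first by rewrite mulr_gt0 ?exprn_gt0// ltr_wpDl.
move=> v w; apply: (@le_trans _ _ (K * ((C * `|v|) * (C * `|w|)))); last first.
  rewrite (_ : _ * _ * _ * _ = (K + 1) * ((C * `|v|) * (C * `|w|))); last by ring.
  by rewrite ler_wpM2r ?lerDl// !mulr_ge0// ltW.
have -> : beta v w = \sum_i \sum_j (g v 0 i * g w 0 j) *: beta (b i) (b j).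
  rewrite -{1}(gf v) coordinates_sum (big_morph (beta^~ w) (fun x y => Dl x y w) (zl w)).
  apply: eq_bigr => i _; rewrite -{1}(gf w) coordinates_sum Zl.
  rewrite (big_morph (beta (b i)) (fun x y => Dr x y (b i)) (zr (b i))) scaler_sumr.
  by apply: eq_bigr => j _; rewrite Zr scalerA.
apply: le_trans (ler_norm_sum _ _ _) _; rewrite mulr_suml; apply: ler_sum => i _.
apply: le_trans (ler_norm_sum _ _ _) _; rewrite mulr_suml; apply: ler_sum => j _.
rewrite normrZ normrM mulrC ler_wpM2l// ler_pM//.
  exact: le_trans (coordinate_le _ _) (gC v).
exact: le_trans (coordinate_le _ _) (gC w).
Qed.

End Coordinates.

Lemma jmul_bound : exists2 C, 0 < C & forall v w, `|v ** w| <= C * `|v| * `|w|.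
Proof.
have [_ [n [f [g fg gf]]] _] := HJ; apply: (bilinear_bound fg gf) => *.
- exact: jmulDl.
- exact: jmulDr.
- exact: jmulZl.
- exact: jmulZr.
Qed.

Lemma B_bound : exists2 C, 0 < C & forall v w, `|B v w| <= C * `|v| * `|w|.
Proof.
have [_ [n [f [g fg gf]]] _] := HJ; apply: (@bilinear_bound _ _ _ fg gf R^o B) => *.
- exact: BDl.
- exact: BDr.
- exact: BZl.
- exact: BZr.
Qed.

Lemma norm_bound : exists2 C, 0 < C & forall v, `|v| ^+ 2 <= C * B v v.
Proof.
by have [_ [n [f [g fg gf]]] _] := HJ; exact: (form_lower_bound fg gf).
Qed.

(** * Derivatives with quadratic remainder *)

Section QuadraticDifferential.
Variable W : normedModType R.

(** A remainder of order $|h|^2$ is what the two-sided estimates on the cone yield, and it adds up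
    with explicit constants. Linearity and continuity of [D] enter only in [quad_diffP]. *)
Definition quad_diff (f D : V -> W) (x : V) := exists C d, [/\ 0 <= C, 0 < d &
  forall h, `|h| < d -> `|f (x + h) - f x - D h| <= C * `|h| ^+ 2].

Lemma quad_diffP (f : V -> W) (D : {linear V -> W}) x : continuous D ->
  quad_diff f D x -> 'd f x = D :> (V -> W).
Proof.
move=> Dc [C [d [C0 d0 H]]]; apply: diff_unique => //.
apply/eqaddoP => _/posnumP[eps]; near=> h.
have hd : `|h| < d by near: h; apply: nbhs0_lt.
have hC : (C + 1) * `|h| <= eps%:num.
  rewrite -ler_pdivlMl ?ltr_wpDl// mulrC ltW//.
  by near: h; apply: nbhs0_lt; rewrite divr_gt0// ltr_wpDl.
have -> : (f \o shift x - (cst (f x) + D)) h = f (x + h) - f x - D h.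
  by rewrite /= !fctE /= [h + x]addrC opprD addrA.
apply: le_trans (H h hd) _; rewrite expr2 mulrA ler_wpM2r//.
by apply: le_trans hC; rewrite ler_wpM2r// lerDl.
Unshelve. all: by end_near. Qed.

Lemma quad_diff_cst (k : W) x : quad_diff (fun=> k) (fun=> 0) x.
Proof. by exists 0, 1; split=> // h _; rewrite subrr subr0 normr0 mul0r. Qed.

Lemma quad_diffD f g D E x : quad_diff f D x -> quad_diff g E x ->
  quad_diff (fun x => f x + g x) (fun h => D h + E h) x.
Proof.
move=> [C [d [C0 d0 H]]] [C' [d' [C0' d0' H']]].
exists (C + C'), (Num.min d d'); split; rewrite ?addr_ge0 ?lt_min ?d0//.
move=> h; rewrite lt_min => /andP[hd hd'].
rewrite (_ : _ - _ = (f (x + h) - f x - D h) + (g (x + h) - g x - E h)); last first.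
  by rewrite !opprD [X in X + _ = _]addrACA [LHS]addrACA.
by rewrite mulrDl; apply: le_trans (ler_normD _ _) (lerD (H _ hd) (H' _ hd')).
Qed.

Lemma quad_diffZ k f D x : quad_diff f D x ->
  quad_diff (fun x => k *: f x) (fun h => k *: D h) x.
Proof.
move=> [C [d [C0 d0 H]]]; exists (`|k| * C), d; split=> //; first by rewrite mulr_ge0.
by move=> h hd; rewrite -!scalerBr normrZ -mulrA ler_wpM2l// H.
Qed.

Lemma quad_diffB f g D E x : quad_diff f D x -> quad_diff g E x ->
  quad_diff (fun x => f x - g x) (fun h => D h - E h) x.
Proof.
move=> Hf /(quad_diffZ (-1)) Hg.
have -> : (fun x => f x - g x) = (fun x => f x + (-1) *: g x).
  by apply/funext => y; rewrite scaleN1r.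
have -> : (fun h => D h - E h) = (fun h => D h + (-1) *: E h).
  by apply/funext => y; rewrite scaleN1r.
exact: quad_diffD.
Qed.

Lemma quad_diff_sum n (f D : 'I_n -> V -> W) x : (forall i, quad_diff (f i) (D i) x) ->
  quad_diff (fun x => \sum_i f i x) (fun h => \sum_i D i h) x.
Proof.
elim: n f D => [|n IH] f D H.
  rewrite (_ : (fun x => \sum_i f i x) = fun=> 0); last by apply/funext => y; rewrite big_ord0.
  rewrite (_ : (fun h => \sum_i D i h) = fun=> 0); last by apply/funext => y; rewrite big_ord0.
  exact: quad_diff_cst.
rewrite (_ : (fun x => \sum_i f i x) = fun x => \sum_(i < n) f (widen_ord (leqnSn n) i) x + f ord_max x).
  rewrite (_ : (fun h => \sum_i D i h) = fun h => \sum_(i < n) D (widen_ord (leqnSn n) i) h + D ord_max h).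
    have HI := IH _ _ (fun i : 'I_n => H (widen_ord (leqnSn n) i)).
    exact: (quad_diffD HI (H ord_max)).
  by apply/funext => y; rewrite big_ord_recr.
by apply/funext => y; rewrite big_ord_recr.
Qed.

Lemma quad_diff_eq f g D x d : 0 < d -> (forall h, `|h| < d -> f (x + h) = g (x + h)) ->
  quad_diff f D x -> quad_diff g D x.
Proof.
move=> d0 fg [C [d' [C0 d0' H]]]; exists C, (Num.min d d'); split=> //.
  by rewrite lt_min d0.
move=> h; rewrite lt_min => /andP[hd hd']; rewrite -fg// -[x in g x]addr0 -fg ?normr0//.
by rewrite addr0 H.
Qed.

End QuadraticDifferential.

Lemma qrep_form u x v : idem u -> u ** v = v -> B (P u x ** v) v = B (x ** v) v.
Proof.
move=> uu uv; rewrite !(jmulC _ v) !Bassoc qrep_sym qrep_idem1//.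
exact: peirce1_mul.
Qed.

Lemma posin_open x : posin e x -> exists d k, [/\ 0 < d, 0 < k &
  forall h, `|h| < d -> forall v, k * `|v| ^+ 2 <= B ((x + h) ** v) v].
Proof.
move=> px; have [k k0 kP] := posin_ge e_idem px.
have [C C0 CP] := norm_bound; have [Cb Cb0 CbP] := B_bound.
have [Cm Cm0 CmP] := jmul_bound.
(* Within this radius $L(h)$ consumes at most half of the coercivity constant $k/C$ of $L(x)$. *)
exists (k / C / 2 / (Cb * Cm)), (k / C / 2).
split; rewrite ?divr_gt0 ?mulr_gt0//.
move=> h hd v; rewrite jmulDl BDl.
have H1 : k / C * `|v| ^+ 2 <= B (x ** v) v.
  apply: le_trans (kP v (jmul1l v)); rewrite -mulrA ler_wpM2l ?(ltW k0)//.
  by rewrite ler_pdivrMl.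
have H2 : `|B (h ** v) v| <= k / C / 2 * `|v| ^+ 2.
  apply: le_trans (CbP _ _) _; apply: (@le_trans _ _ (Cb * (Cm * `|h| * `|v|) * `|v|)).
    by rewrite ler_wpM2r// ler_wpM2l ?(ltW Cb0).
  rewrite (_ : _ * _ * _ = Cb * Cm * `|h| * `|v| ^+ 2); last by ring.
  rewrite ler_wpM2r ?exprn_ge0// mulrC -ler_pdivlMr ?mulr_gt0//.
  exact: ltW.
have := ler_norm (- B (h ** v) v); rewrite normrN; lra.
Qed.

Lemma posin_add x : posin e x -> exists2 d, 0 < d & forall h, `|h| < d -> posin e (x + h).
Proof.
move=> /posin_open[d [k [d0 k0 H]]]; exists d => // h hd; split=> [|v _ v0].
  exact: jmul1l.
by apply: lt_le_trans (H h hd v); rewrite mulr_gt0 ?exprn_gt0 ?normr_gt0.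
Qed.

(** An interior point remains a square after subtraction of a small multiple of $e$, and
    $L(y^2)\ge0$, so $L(x)$ is definite. Conversely, definiteness is an open condition and positive
    eigenvalues have square roots. *)
Lemma symmetric_coneE x : symmetric_cone mul x <-> posin e x.
Proof.
split=> [|px].
  rewrite /symmetric_cone /interior /= => /nbhs_ballP[d /= d0 H].
  have [eps eps0 [y xy]] : exists2 eps, 0 < eps & exists y, x - eps *: e = y ** y.
    exists (d / 2 / (`|e| + 1)); first by rewrite !divr_gt0// ltr_wpDl.
    apply: H; rewrite -ball_normE /= opprB addrC subrK normrZ.
    rewrite gtr0_norm ?divr_gt0 ?ltr_wpDl// mulrAC -mulrA.
    apply: (@le_lt_trans _ _ (d / 2)); last by lra.
    rewrite ler_piMr ?divr_ge0 ?ltW// ltr_pdivrMr ?ltr_wpDl// mul1r ltrDl//.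
  split=> [|v _ v0]; first exact: jmul1l.
  have -> : x = eps *: e + y ** y by rewrite -xy addrC subrK.
  rewrite !jmulE jmul1l BDl BZl ltr_wpDr ?mulr_gt0 ?B_gt0//.
  have [c [a [Fc ->]]] := spectral_fsumP e_idem (jmul1l y).
  by rewrite (fsum_mul Fc); apply: (fsum_mul_ge0 _ e_idem Fc) => i _; exact: sqr_ge0.
rewrite /symmetric_cone /interior /=; have [d d0 H] := posin_add px.
apply/nbhs_ballP; exists d => //= y; rewrite -ball_normE /= distrC => yd.
have := H _ yd; rewrite addrC subrK => /(posinP e_idem)[c [a [Fc -> a0]]].
exists (fsum c (fun i => Num.sqrt (a i))); rewrite (fsum_mul Fc).
by apply: eq_fsum => i ic; rewrite -expr2 sqr_sqrtr// ltW// a0.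
Qed.

Lemma qrep_bound x : exists2 C, 0 < C & forall v, `|P x v| <= C * `|v|.
Proof.
have [Cm Cm0 CmP] := jmul_bound; have Cm1 := ltW Cm0.
pose K1 := Cm * `|x| * (Cm * `|x|); pose K2 := Cm * `|x ** x|.
exists (2 * K1 + K2 + 1); first by rewrite ltr_wpDl// addr_ge0 ?mulr_ge0.
move=> v; rewrite /qrep; apply: le_trans (ler_normB _ _) _.
rewrite normrZ ger0_norm//.
have H1 : `|x ** (x ** v)| <= K1 * `|v|.
  apply: le_trans (CmP _ _) _.
  by have := ler_wpM2l (mulr_ge0 Cm1 (normr_ge0 x)) (CmP x v); rewrite /K1 !mulrA.
by have := CmP (x ** x) v; have := normr_ge0 v; rewrite -/K2; lra.
Qed.

(** * Derivatives of the inverse and of the log-determinant *)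

Section Derivatives.
Variable u : V.
Hypothesis uu : idem u.
Local Notation W x := (jinv mul u (P u x)).

(** The increment $v$ of the inverse solves $(P_u(x+h))v=-(P_uh)w$, and the coercivity of $L(x+h)$,
    uniform for small $h$, bounds it. *)
Lemma jinv_lipschitz x : posin e x -> exists C d, [/\ 0 <= C, 0 < d &
  forall h, `|h| < d -> posin e (x + h) /\ `|W (x + h) - W x| <= C * `|h|].
Proof.
move=> px; have [d1 d10 pxh] := posin_add px.
have [d2 [k [d20 k0 kP]]] := posin_open px.
have [Cb Cb0 CbP] := B_bound; have [Cm Cm0 CmP] := jmul_bound.
have [Cu Cu0 CuP] := qrep_bound u.
have Cb1 := ltW Cb0; have Cm1 := ltW Cm0; have Cu1 := ltW Cu0; have k1 := ltW k0.
pose w := W x; pose C := Cb * (Cm * Cu * `|w|) / k.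
exists C, (Num.min d1 d2); split.
- by rewrite /C !mulr_ge0 ?invr_ge0.
- by rewrite lt_min d10.
move=> h; rewrite lt_min => /andP[hd1 hd2]; have px' := pxh h hd1; split=> //.
have pu := posin_qrep uu px; have pu' := posin_qrep uu px'.
set v := _ - _.
have uv : u ** v = v.
  by rewrite /v jmulDr jmulNr (jinv_posin uu pu).1 (jinv_posin uu pu').1.
have E : P u (x + h) ** v = - (P u h ** w).
  rewrite /v jmulDr jmulNr jinvP// qrepD jmulDl jinvP// -/w.
  by rewrite opprD addrA subrr add0r.
have := kP h hd2 v; rewrite -(qrep_form _ uu uv) E BNl.
have [->|v0] := eqVneq v 0; first by rewrite normr0 mulr_ge0// /C !mulr_ge0 ?invr_ge0.
move=> H; rewrite /C mulrAC ler_pdivlMr// mulrC.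
rewrite -(@ler_pM2r _ `|v|) ?normr_gt0//.
apply: le_trans (_ : k * `|v| ^+ 2 <= _); first by rewrite expr2 mulrA.
apply: le_trans H _; apply: le_trans (ler_norm _) _; rewrite normrN.
apply: le_trans (CbP _ _) _; rewrite ler_wpM2r// -[leRHS]mulrA ler_wpM2l//.
apply: le_trans (CmP _ _) _.
rewrite (_ : Cm * Cu * `|w| * `|h| = Cm * (Cu * `|h|) * `|w|); last by ring.
by rewrite ler_wpM2r// ler_wpM2l.
Qed.

(** The remainder $y$ solves $(P_ux)y=-(P_uh)v$ with $v=O(|h|)$. The linear terms cancel by
    [mul_qrep_jinv]. *)
Lemma quad_diff_jinv x : posin e x -> quad_diff (fun y => W y) (fun h => - P (W x) h) x.
Proof.
move=> px; have [C [d1 [C0 d10 H1]]] := jinv_lipschitz px.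
have [d2 [k [d20 k0 kP]]] := posin_open px.
have [Cb Cb0 CbP] := B_bound; have [Cm Cm0 CmP] := jmul_bound.
have [Cu Cu0 CuP] := qrep_bound u.
have Cb1 := ltW Cb0; have Cm1 := ltW Cm0; have Cu1 := ltW Cu0; have k1 := ltW k0.
pose C' := Cb * (Cm * Cu * C) / k.
exists C', d1; split=> //; first by rewrite /C' !mulr_ge0 ?invr_ge0.
move=> h hd; have [px' vP] := H1 h hd.
have pu := posin_qrep uu px; have pu' := posin_qrep uu px'.
set w := W x; set v := W (x + h) - w in vP *; set y := v - - _.
have uw : u ** w = w := (jinv_posin uu pu).1.
have uv : u ** v = v by rewrite /v jmulDr jmulNr uw (jinv_posin uu pu').1.
have uy : u ** y = y by rewrite /y opprK jmulDr uv qrep_in.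
have E' : P u (x + h) ** v = - (P u h ** w).
  rewrite /v jmulDr jmulNr jinvP// qrepD jmulDl jinvP// -/w.
  by rewrite opprD addrA subrr add0r.
have E : P u x ** y = - (P u h ** v).
  rewrite /y opprK jmulDr (mul_qrep_jinv uu _ pu) -/w (jmulC w).
  move: E'; rewrite qrepD jmulDl => E'.
  by pair_with t; pair_eq E' t; lra.
have [->|y0] := eqVneq y 0; first by rewrite normr0 mulr_ge0 ?exprn_ge0// /C' !mulr_ge0 ?invr_ge0.
have := kP 0; rewrite normr0 addr0 => /(_ d20 y); rewrite -(qrep_form _ uu uy) E BNl.
move=> H; rewrite /C' mulrAC ler_pdivlMr// mulrC.
rewrite -(@ler_pM2r _ `|y|) ?normr_gt0//.
apply: le_trans (_ : k * `|y| ^+ 2 <= _); first by rewrite expr2 mulrA.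
apply: le_trans H _; apply: le_trans (ler_norm _) _; rewrite normrN.
apply: le_trans (CbP _ _) _; rewrite ler_wpM2r// -[leRHS]mulrA ler_wpM2l//.
apply: le_trans (CmP _ _) _.
rewrite (_ : Cm * Cu * C * `|h| ^+ 2 = Cm * (Cu * `|h|) * (C * `|h|)); last by ring.
by rewrite ler_pM ?mulr_ge0// ler_wpM2l.
Qed.

(** [logdet_le] from $x$ to $x+h$ and back traps the remainder between $\langle
    W(x+h)-W(x),h\rangle$ and 0. *)
Lemma quad_diff_logdet x : posin e x ->
  quad_diff (fun y => ln (jdet mul u (P u y)) : R^o) (B (W x)) x.
Proof.
move=> px; have [C [d1 [C0 d10 H1]]] := jinv_lipschitz px.
have [Cb Cb0 CbP] := B_bound.
exists (Cb * C), d1; split=> //; first by rewrite mulr_ge0 ?(ltW Cb0).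
move=> h hd; have [px' vP] := H1 h hd.
have pu := posin_qrep uu px; have pu' := posin_qrep uu px'.
have uw := (jinv_posin uu pu).1; have uw' := (jinv_posin uu pu').1.
have D1 := logdet_le uu pu pu'; have D2 := logdet_le uu pu' pu.
have BE y : u ** y = y -> B y (P u h) = B y h by move=> uy; rewrite -qrep_sym qrep_idem1.
have E : P u (x + h) - P u x = P u h by rewrite qrepD addrC addKr.
rewrite E BE// in D1; rewrite -[P u x - _]opprB E BNr BE// in D2.
have H3 : `|B (W (x + h) - W x) h| <= Cb * C * `|h| ^+ 2.
  apply: le_trans (CbP _ _) _; rewrite expr2 mulrA ler_wpM2r// -mulrA.
  by rewrite ler_wpM2l ?(ltW Cb0).
apply: le_trans H3; rewrite BDl BNl ler0_norm; last by lra.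
by have := ler_norm (- (B (W (x + h)) h - B (W x) h)); rewrite normrN; lra.
Qed.

End Derivatives.

Lemma frame_single c : primitive_idempotent mul e c -> jordan_frame mul c [:: c].
Proof.
move=> cP; have cc := primitive_idem cP; split; last by rewrite big_seq1.
  by case=> // _; exact: (primitive_lift e_idem).
by case=> [|i] [|j].
Qed.

(** The convention $\Delta_0=1$: the zero algebra has the empty frame. *)
Lemma jdet0 : jdet mul 0 0 = 1.
Proof.
have F0 : jordan_frame mul 0 [::] by split=> //; rewrite big_nil.
have := @jdet_fsum 0 [::] (fun=> 1) idem0 F0.
by rewrite /fsum !big_ord0; apply.
Qed.

(** Two steps of half the length cost $2C(d/2)^2$, so halving the interval replaces $C$ by $C/2$;
    iteration leaves no room for an increment. *)
Lemma quadratic_constant (f : R -> R) C : (forall x y, `|f x - f y| <= C * (x - y) ^+ 2) ->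
  forall x y, f x = f y.
Proof.
move=> H.
have {}H n x y : `|f x - f y| <= C / 2 ^+ n * (x - y) ^+ 2.
  elim: n x y => [|n IH] x y; first by rewrite expr0 divr1.
  pose z := (x + y) / 2; have H1 := IH x z; have H2 := IH z y.
  rewrite (_ : f x - f y = (f x - f z) + (f z - f y)); last by rewrite addrA subrK.
  apply: le_trans (ler_normD _ _) _; apply: le_trans (lerD H1 H2) _.
  by rewrite /z (exprS 2 n); rewrite le_eqVlt; apply/orP; left; apply/eqP; field; rewrite expf_neq0.
move=> x y; apply/eqP; rewrite -subr_eq0; apply: contraT => fxy.
pose K := C * (x - y) ^+ 2; pose d := `|f x - f y|; have d0 : 0 < d by rewrite normr_gt0.
have Kd : 0 <= K / d.
  apply: divr_ge0; last exact: ltW.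
  apply: le_trans (ltW d0) _; by have := H 0 x y; rewrite expr0 divr1.
have := archi_boundP Kd; set n := Num.bound _ => nP.
have := H n x y; rewrite mulrAC -/K -/d ler_pdivlMr ?exprn_gt0// => dn.
have : d * n%:R <= K.
  apply: le_trans dn; rewrite ler_wpM2l ?(ltW d0)// -natrX ler_nat.
  exact/ltnW/ltn_expl.
by rewrite leNgt -ltr_pdivrMl// mulrC nP.
Qed.

(** * Determinants of rank-one lifts *)

Section JdetAdd.
Variables u c m : V.
Hypotheses (uu : idem u) (cP : primitive_idempotent mul e c) (uc : u ** c = 0).
Hypothesis pm : posin u m.

Lemma jdet_add l : 0 < l -> jdet mul (u + c) (m + l *: c) = jdet mul u m * l.
Proof.
move=> l0; have cc := primitive_idem cP; have [d [a [Fd -> a0]]] := posinP uu pm.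
have Fdc := frame_cat uu cc uc Fd (frame_single cP).
pose a' i := if (i < size d)%N then a i else l.
have sz : size (d ++ [:: c]) = (size d).+1 by rewrite size_cat addn1.
have -> : fsum d a + l *: c = fsum (d ++ [:: c]) a'.
  rewrite /fsum sz big_ord_recr /= nth_cat ltnn subnn /= /a' ltnn; congr (_ + _).
  by apply: eq_bigr => i _; rewrite nth_cat ltn_ord.
rewrite (jdet_fsum uu Fd)// (jdet_fsum (add_idem uu cP uc) Fdc).
  rewrite sz big_ord_recr /= /a' ltnn; congr (_ * _).
  by apply: eq_bigr => i _; rewrite ltn_ord.
by move=> i _; rewrite /a'; case: ifP => // /a0.
Qed.

Lemma half0 (x : V) : x ** 0 = 2^-1 *: 0.
Proof. by rewrite jmul0r scaler0. Qed.

Lemma schur_lift0 : schur_lift c 0 = c.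
Proof. by rewrite /schur_lift /sq0 jmul0l B0r mul0r scale0r subr0 !addr0. Qed.

Lemma posin_add_scale l : 0 < l -> posin (u + c) (m + l *: c).
Proof. by move=> l0; have := posin_lift uu cP uc (half0 c) (half0 u) pm l0; rewrite schur_lift0. Qed.

Lemma jinv_add l : 0 < l ->
  jinv mul (u + c) (m + l *: c) = jinv mul u m + l^-1 *: c.
Proof.
move=> l0; have := jinv_lift uu cP uc (half0 c) (half0 u) pm l0.
by rewrite schur_lift0 jmul0r scaler0 subr0 B0l mul0r mulr0 addr0.
Qed.

(* Along [t |-> schur_lift c (t *: z)] the determinant is constant: the remainder
   of [logdet_le] is quadratic in the increment. *)
Lemma jdet_lift z l : c ** z = 2^-1 *: z -> u ** z = 2^-1 *: z -> 0 < l ->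
  jdet mul (u + c) (m + l *: schur_lift c z) = jdet mul u m * l.
Proof.
move=> cz uz l0; rewrite -jdet_add//; have uuc := add_idem uu cP uc.
pose M t := m + l *: schur_lift c (t *: z).
have tz x t : x ** z = 2^-1 *: z -> x ** (t *: z) = 2^-1 *: (t *: z).
  by move=> xz; rewrite jmulZr xz !scalerA mulrC.
have pM t : posin (u + c) (M t) by apply: posin_lift => //; exact: tz.
pose F t := ln (jdet mul (u + c) (M t)).
pose Z := sq0 c z; pose n := jinv mul u m; pose k := B n Z.
have sq0Z t : sq0 c (t *: z) = t ^+ 2 *: Z.
  by rewrite /Z /sq0 !jmulE BZl BZr; pair_with w; ring.
have ME t : M t = m + l *: (c + t *: z + t ^+ 2 *: Z) by rewrite /M /schur_lift sq0Z.
have un : u ** n = n := (jinv_posin uu pm).1.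
have cn : c ** n = 0 := mul_c uu uc un.
have cZ : c ** Z = 0 := sq0P cP cz.
have zzE : z ** z = (B z z / 2) *: c + Z by exact: sq0E.
clearbody Z.
have B0c v : c ** v = 0 -> B v c = 0.
  by move=> cv; rewrite -(primitive_idem cP) -Bassoc cv B0l.
have B_half v w : c ** v = 2^-1 *: v -> c ** w = 0 -> B v w = 0.
  by move=> cv cw; have := Bassoc c v w; rewrite cv cw BZl B0r; lra.
have cnz : c ** (n ** z) = 2^-1 *: (n ** z).
  by rewrite (jmulC n) (peirce_half_zero (primitive_idem cP)).
have nzz : B (n ** z) z = k.
  by rewrite (jmulC n) Bassoc zzE BDr BZr B0c// mulr0 add0r.
(* The pairings $\langle nz,z\rangle$ and $\langle n,Z\rangle$ both equal $k$ and the others vanish,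
   which leaves $(t'^2-t^2)-2t(t'-t)=(t'-t)^2$ times $lk$. *)
have step t t' : F t' - F t <= l * k * (t' - t) ^+ 2.
  apply: le_trans (logdet_le uuc (pM t) (pM t')) _.
  rewrite {1}/M jinv_lift//; try exact: tz.
  have -> : M t' - M t = l *: ((t' - t) *: z + (t' ^+ 2 - t ^+ 2) *: Z).
    by rewrite !ME; pair_with w; ring.
  rewrite -/n jmulZr !(BDl, BNl, BZl, BDr, BZr) nzz (BC n z) (B_half z n)//.
  rewrite (BC c z) (BC c Z) (B0c Z)// (B_half (n ** z) Z)// -/k.
  rewrite (B_half_c cP cz); rewrite le_eqVlt; apply/orP; left; apply/eqP; ring.
have F01 : F 1 = F 0.
  apply: (@quadratic_constant F (l * k)) => t t'; rewrite ler_norml step andbT.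
  by have := step t t'; rewrite -(opprB t) sqrrN; lra.
have := F01; rewrite /F /M scale1r scale0r schur_lift0 => /ln_inj; apply.
  by rewrite posrE jdet_gt0//; have := pM 1; rewrite /M scale1r.
by rewrite posrE jdet_gt0//; exact: posin_add_scale.
Qed.

End JdetAdd.

(** * Linear forms, gradients and Laplace transforms *)

Lemma B_linear x : exists2 f : {linear V -> R}, (f : V -> R) = B x & continuous f.
Proof.
have lin : linear (B x : V -> R) by move=> a y z; exact: BP.
pose f : {linear V -> R} := HB.pack (B x) (GRing.isLinear.Build _ _ _ _ _ lin).
exists f => //; apply: bounded_linear_continuous; apply/linear_boundedP.
have [C C0 CP] := B_bound; near=> k => y.
have Ck : C * `|x| <= k by near: k; apply: nbhs_pinfty_ge; rewrite num_real.
by apply: le_trans (CP x y) _; rewrite ler_wpM2r.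
Unshelve. all: by end_near. Qed.

Lemma linear_continuous_of_bound (D : V -> V) C : linear D -> (forall v, `|D v| <= C * `|v|) ->
  exists2 f : {linear V -> V}, (f : V -> V) = D & continuous f.
Proof.
move=> lin DC; pose f : {linear V -> V} := HB.pack D (GRing.isLinear.Build _ _ _ _ _ lin).
exists f => //; apply: bounded_linear_continuous; apply/linear_boundedP.
near=> k => y.
have Ck : C <= k by near: k; apply: nbhs_pinfty_ge; rewrite num_real.
by apply: le_trans (DC y) _; rewrite ler_wpM2r.
Unshelve. all: by end_near. Qed.

Lemma gradient_quad_diff (f : V -> R) x g : quad_diff (f : V -> R^o) (B g) x ->
  gradient B f x = g.
Proof.
move=> H; have [D DE Dc] := B_linear g; rewrite -DE in H.
have dE := quad_diffP Dc H; apply: xget_unique => /= [h|g' g'P].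
  by rewrite dE DE.
by apply: B_ext => w; rewrite -g'P dE DE.
Qed.

Section Laplace.
Variable mu : {measure set (borelType V) -> \bar R}.

Lemma laplace_integrand_measurable x :
  measurable_fun [set: borelType V] (fun y : borelType V => (expR (- B x y))%:E : \bar R).
Proof.
apply/measurable_EFinP; apply: measurableT_comp; first exact: measurable_expR.
have [f fE fc] := B_linear (- x).
rewrite (_ : (fun y => - B x y) = f); last by apply/funext => y; rewrite fE BNl.
apply: (measurability _ (RGenOpens.measurableE R)).
move=> _ [_ [a [b ->] <-]]; rewrite setTI; apply: sub_sigma_algebra.
by move/continuousP: fc; apply; exact: interval_open.
Qed.

(** The exponent at an intermediate point is at most the larger end exponent, and the larger
    exponential is at most the sum. *)
Lemma laplace_segment (x y : V) (t : R) : 0 <= t <= 1 ->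
  (laplace_transform B mu ((1 - t) *: x + t *: y)%R <=
   laplace_transform B mu x + laplace_transform B mu y)%E.
Proof.
move=> /andP[t0 t1]; rewrite /laplace_transform.
have mx := laplace_integrand_measurable.
have ge0 v : forall z, [set: borelType V] z -> (0 <= (expR (- B v z))%:E)%E.
  by move=> z _; rewrite lee_fin expR_ge0.
rewrite -(ge0_integralD mu measurableT (ge0 x) (mx x) (ge0 y) (mx y)).
apply: ge0_le_integral => //.
- by apply: emeasurable_funD; exact: mx.
move=> z _; rewrite -EFinD lee_fin BDl !BZl opprD.
have [xy|/ltW yx] := leP (B x z) (B y z).
  apply: (@le_trans _ _ (expR (- B x z))); last by rewrite lerDl expR_ge0.
  by rewrite ler_expR; nra.
apply: (@le_trans _ _ (expR (- B y z))); last by rewrite lerDr expR_ge0.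
by rewrite ler_expR; nra.
Qed.

End Laplace.

(** * The exponential family of a power function *)

Section Family.
Variable c : seq V.
Hypothesis Fc : jordan_frame mul e c.
Local Notation r := (size c).
Local Notation u := (frame_first c).

Definition minor k x := jdet mul (u k) (P (u k) x).

Lemma minor_gt0 k x : (k <= r)%N -> posin e x -> 0 < minor k x.
Proof.
move=> kr px; have ik := frame_first_idem Fc kr.
exact/(jdet_gt0 ik)/(posin_qrep ik).
Qed.

Lemma minor0 x : minor 0 x = 1.
Proof.
by rewrite /minor frame_first0 /qrep !jmul0l scaler0 subr0 jdet0.
Qed.

Lemma minor_size x : minor r x = jdet mul e x.
Proof. by rewrite /minor (frame_first_size Fc) qrep_e. Qed.

Lemma B_frame_gt0 k x : (k < r)%N -> posin e x -> 0 < B c`_k x.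
Proof.
move=> kr [_ px]; have cP := frame_elt_primitive Fc kr.
have [_ _ c0 _] := cP; have := px _ (jmul1l _) c0.
by rewrite (jmulC x) Bassoc (primitive_idem cP) BC.
Qed.

(* The Hadamard--Fischer inequality. *)
Lemma ln_minor_le k x : (k < r)%N -> posin e x ->
  ln (minor k.+1 x) - ln (minor k x) <= ln (B c`_k x).
Proof.
move=> kr px; have ik := frame_first_idem Fc (ltnW kr).
have cP := frame_elt_primitive Fc kr; have uc := frame_first_orth Fc kr.
have iS := frame_first_idem Fc kr.
have t0 := B_frame_gt0 kr px; set t := B c`_k x in t0 *.
have pk := posin_qrep ik px; have pS := posin_qrep iS px.
have uS := frame_firstS c k.
have p1 : posin (u k.+1) (P (u k) x + t *: c`_k) by rewrite uS; exact: posin_add_scale.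
have := logdet_le iS p1 pS; rewrite -/(minor k.+1 x) uS jdet_add// jinv_add//.
rewrite lnM ?posrE ?(jdet_gt0 ik)// -/(minor k x) -uS; set w := jinv _ _ _.
have uw : u k ** w = w := (jinv_posin ik pk).1.
have cw : c`_k ** w = 0 := mul_c ik uc uw.
have wc : B w c`_k = 0 by rewrite -(primitive_idem cP) -Bassoc cw B0l.
have uSw : u k.+1 ** w = w by rewrite uS; exact: add_in.
have uSc : u k.+1 ** c`_k = c`_k by rewrite uS jmulDl uc (primitive_idem cP) add0r.
have E1 : B w (P (u k.+1) x) = B w x by rewrite -qrep_sym (qrep_idem1 iS).
have E2 : B w (P (u k) x) = B w x by rewrite -qrep_sym (qrep_idem1 ik).
have E3 : B c`_k (P (u k.+1) x) = t by rewrite -qrep_sym (qrep_idem1 iS).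
have E4 : B c`_k (P (u k) x) = 0 by rewrite -qrep_sym (qrep_idem0 ik)// B0l.
move: (P (u k.+1) x) (P (u k) x) E1 E2 E3 E4 => y1 y2 E1 E2 E3 E4.
rewrite !(BDl, BZl, BDr, BNr, BZr) E1 E2 E3 E4 wc (Bcc cP).
by have := mulVf (lt0r_neq0 t0); lra.
Qed.

Variable s : nat -> R.
Hypothesis s0 : forall i, (i < r)%N -> 0 < s i.

(** This is $\ln\Delta_{-\underline s}$ after summation by parts: each weight multiplies the
    logarithm of one pivot $\Delta_{k+1}/\Delta_k$, with $\Delta_0=1$. *)
Definition log_power x := - \sum_(k < r) s k * (ln (minor k.+1 x) - ln (minor k x)).

Lemma sum_ln_minor x : \sum_(k < r) (ln (minor k.+1 x) - ln (minor k x)) = ln (jdet mul e x).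
Proof.
rewrite -minor_size; elim: (r) => [|k IH]; first by rewrite big_ord0 minor0 ln1.
by rewrite big_ord_recr /= IH addrC subrK.
Qed.

(** Bounded diagonal entries keep every log-pivot $D_k$ below some $L$. As $s_k\ge a>0$,
    $a\sum_k(L-D_k)\le\sum_k s_k(L-D_k)$, so an upper bound for $-\sum_k s_kD_k$ bounds $\sum_k
    D_k=\ln\det$ from below. *)
Lemma logdet_lower_bound M C : exists K, forall x, posin e x ->
  (forall k, (k < r)%N -> B c`_k x <= M) -> log_power x <= C -> K <= ln (jdet mul e x).
Proof.
have [a a0 aP] := positive_lower_bound s0.
pose L := ln (Num.max M 1).
exists (r%:R * L - (C + (\sum_(k < r) s k) * L) / a) => x px xM xC.
have d k : (k < r)%N -> ln (minor k.+1 x) - ln (minor k x) <= L.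
  move=> kr; apply: le_trans (ln_minor_le kr px) _.
  have H : B c`_k x <= Num.max M 1 by rewrite le_max xM.
  rewrite ler_ln ?posrE//; first exact: B_frame_gt0.
  by apply: lt_le_trans H; exact: B_frame_gt0.
rewrite -sum_ln_minor.
pose D k := ln (minor k.+1 x) - ln (minor k x); rewrite -[leRHS]/(\sum_(k < r) D k).
have H : a * \sum_(k < r) (L - D k) <= \sum_(k < r) s k * (L - D k).
  rewrite mulr_sumr; apply: ler_sum => k _.
  by rewrite ler_wpM2r ?subr_ge0 ?aP// d.
have H1 : \sum_(k < r) (L - D k) = r%:R * L - \sum_(k < r) D k.
  by rewrite sumrB sumr_const card_ord mulr_natl.
have H2 : \sum_(k < r) s k * (L - D k) = (\sum_(k < r) s k) * L - \sum_(k < r) s k * D k.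
  by rewrite mulr_suml -sumrB; apply: eq_bigr => k _; rewrite mulrBr.
have E : - \sum_(i < r) s i * D i <= C by exact: xC.
rewrite H1 H2 in H; rewrite lerBlDr -lerBlDl ler_pdivlMr// mulrC.
by apply: le_trans H _; lra.
Qed.

Lemma posin_e : posin e e.
Proof. by split=> [|v _ v0]; rewrite jmul1l// B_gt0. Qed.

(* On the segment from [e] to [x], the determinant tends to [0] at the exit point. *)
Lemma log_power_escape x : ~ posin e x -> forall C, exists t, [/\ 0 <= t <= 1,
  posin e ((1 - t) *: e + t *: x) & C < log_power ((1 - t) *: e + t *: x)].
Proof.
move=> npx C; have [d [l [Fd xE]]] := spectral_fsumP e_idem (jmul1l x).
have [i0 li0] : exists i : 'I_(size d), l i <= 0.
  apply: contrapT => H; apply: npx; rewrite xE; apply/(posin_fsum _ e_idem Fd) => i id.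
  by rewrite ltNge; apply/negP => li; apply: H; exists (Ordinal id).
(* The smallest eigenvalue of [x], the first to reach 0 along the segment. *)
have [j lj lmin] : exists2 j : 'I_(size d), l j <= 0 & forall i : 'I_(size d), l j <= l i.
  exists [arg min_(i < i0) l i]%O; case: arg_minP => // j _ H; last by move=> i; exact: H.
  by apply: le_trans li0; exact: H.
pose M := 1 + \sum_(k < r) `|B c`_k x|.
have [K KP] := logdet_lower_bound M C.
pose A := \sum_(i < size d) `|l i|.
(* The value that the smallest eigenvalue is made to take at the parameter [t] below. The other
   eigenvalues add at most [A] to the log-determinant, so $\ln\delta\le K-A-1$ pushes it below [K];
   the entry $-1$ keeps $\delta<1$. *)
pose del := expR (Num.min (-1) (K - A - 1)).
have del0 : 0 < del := expR_gt0 _.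
have del1 : del < 1.
  by rewrite -expR0 ltr_expR gt_min ltrN10.
pose t := (1 - del) / (1 - l j).
have lj1 : 0 < 1 - l j by lra.
have t0 : 0 <= t by apply: divr_ge0; lra.
have t1 : t <= 1 by rewrite ler_pdivrMr//; lra.
have tj : 1 - t + t * l j = del.
  by rewrite /t; field; exact: lt0r_neq0.
pose a i := 1 - t + t * l i.
have a0 (i : 'I_(size d)) : del <= a i.
  by rewrite -tj lerD2l ler_wpM2l.
pose xt := (1 - t) *: e + t *: x.
have xtE : xt = fsum d a.
  rewrite /xt xE -[in LHS](fsum1 Fd) !fsumZ fsumD.
  by apply: eq_fsum => i _; rewrite mulr1.
have a00 i : (i < size d)%N -> 0 < a i.
  by move=> id; apply: lt_le_trans del0 (a0 (Ordinal id)).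
have pxt : posin e xt by rewrite xtE; apply/(posin_fsum _ e_idem Fd).
have Ble k : (k < r)%N -> B c`_k xt <= M.
  move=> kr; rewrite BDr !BZr (B_unit_frame e_idem Fc)// mulr1.
  have H1 : `|B c`_k x| <= \sum_(k < r) `|B c`_k x|.
    rewrite (bigD1 (Ordinal kr))//= lerDl; exact: sumr_ge0.
  have H2 := ler_norm (B c`_k x); have H3 := normr_ge0 (B c`_k x).
  rewrite /M; nra.
exists t; split; [by rewrite t0 | exact: pxt | rewrite ltNge; apply/negP => /(KP _ pxt Ble)].
rewrite xtE (jdet_fsum e_idem Fd)// (ln_prod a00) (bigD1 j)//= {1}/a tj /del expRK.
have : \sum_(i < size d | i != j) ln (a i) <= A.
  apply: (@le_trans _ _ (\sum_(i < size d | i != j) `|l i|)).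
    apply: ler_sum => i _; apply: le_trans (ln_le_sub1 (a00 _ (ltn_ord i))) _.
    by have := ler_norm (l i); have := normr_ge0 (l i); rewrite /a; nra.
  by rewrite /A [leRHS](bigD1 j)//= lerDr.
have : Num.min (-1) (K - A - 1) <= K - A - 1 by rewrite ge_min lexx orbT.
lra.
Qed.

Variable mu : {measure set (borelType V) -> \bar R}.
Variable G : V -> R.
Hypothesis G0 : forall x, posin e x -> 0 < G x.
Hypothesis GE : forall x, posin e x -> ln (G x) = log_power x.
Hypothesis LE : forall x, posin e x -> laplace_transform B mu x = (G x)%:E.

Lemma laplace_finite_posin x : (laplace_transform B mu x < +oo)%E -> posin e x.
Proof.
move=> Lx; apply: contrapT => npx.
have L0 : (0 <= laplace_transform B mu x)%E.
  by apply: integral_ge0 => y _; rewrite lee_fin expR_ge0.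
have Lfin : laplace_transform B mu x \is a fin_num by rewrite ge0_fin_numE.
pose C := G e + fine (laplace_transform B mu x).
have [t [t01 pxt]] := log_power_escape npx (ln C).
have Gxt : G ((1 - t) *: e + t *: x) <= C.
  have := @laplace_segment mu e x t t01.
  by rewrite (LE pxt) (LE posin_e) -[X in (_ + X)%E](fineK Lfin) -EFinD lee_fin.
rewrite -GE// ltNge ler_ln ?posrE ?G0// ?Gxt//.
exact: lt_le_trans (G0 pxt) Gxt.
Qed.

Lemma canonical_domainE x : canonical_domain B mu x <-> posin e x.
Proof.
split=> [|px].
  by move=> /(@interior_subset V) /=; exact: laplace_finite_posin.
have [d d0 H] := posin_add px.
apply/nbhs_ballP; exists d => //= y; rewrite -ball_normE /= distrC => yd.
by have := H _ yd; rewrite addrC subrK => py; rewrite LE// ltry.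
Qed.

Lemma cumulantE x : posin e x -> cumulant B mu x = log_power x.
Proof. by move=> px; rewrite /cumulant LE//= GE. Qed.

Lemma gradient_cumulant x : posin e x -> gradient B (cumulant B mu) x = - rescale c s r x.
Proof.
move=> px; have [d d0 H] := posin_add px; apply: gradient_quad_diff.
apply: (@quad_diff_eq _ log_power _ _ _ d d0) => [h hd|]; first by rewrite (cumulantE (H h hd)).
pose D (k : 'I_r) h : R^o := s k *: (B (pinverse c k.+1 x) h - B (pinverse c k x) h : R^o).
have -> : B (- rescale c s r x) = (fun h => 0 - \sum_k D k h).
  apply/funext => h; rewrite sub0r BNl B_suml; congr (- _); apply: eq_bigr => k _.
  by rewrite BZl BDl BNl.
have -> : log_power = fun x => 0 - \sum_(k < r) (s k *: (ln (minor k.+1 x) - ln (minor k x) : R^o)) : R^o.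
  by apply/funext => y; rewrite sub0r.
apply: quad_diffB; first exact: (quad_diff_cst (0 : R^o)).
apply: quad_diff_sum => k; apply: quad_diffZ; apply: quad_diffB.
  exact/quad_diff_logdet/px/(frame_first_idem Fc (ltn_ord k)).
exact/quad_diff_logdet/px/(frame_first_idem Fc (ltnW (ltn_ord k))).
Qed.

Lemma mean_mapE x : posin e x -> mean_map B mu x = rescale c s r x.
Proof. by move=> px; rewrite /mean_map gradient_cumulant// opprK. Qed.

Lemma inverse_mean_mapE x : posin e x -> inverse_mean_map B mu (rescale c s r x) = x.
Proof.
move=> px; rewrite -mean_mapE// /inverse_mean_map pinvKV//.
  move=> y z; rewrite !inE !canonical_domainE => py pz.
  by rewrite !mean_mapE//; exact: rescale_inj.
by rewrite inE; apply/canonical_domainE.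
Qed.

Lemma diff_gradient_cumulant x y : posin e x ->
  'd (gradient B (cumulant B mu)) x y =
  \sum_(k < r) s k *: (P (pinverse c k.+1 x) y - P (pinverse c k x) y).
Proof.
move=> px; have [d d0 H] := posin_add px.
pose D h := \sum_(k < r) s k *: (P (pinverse c k.+1 x) h - P (pinverse c k x) h).
have HD : quad_diff (gradient B (cumulant B mu)) D x.
  apply: (@quad_diff_eq _ (fun y => - rescale c s r y) _ _ _ d d0) => [h hd|].
    by rewrite (gradient_cumulant (H h hd)).
  have -> : D = (fun h => 0 - \sum_(k < r) s k *:
      (- P (pinverse c k.+1 x) h - - P (pinverse c k x) h)).
    apply/funext => h; rewrite sub0r -sumrN; apply: eq_bigr => k _.
    rewrite -scalerN; move: (P (pinverse c k.+1 x) h) (P (pinverse c k x) h) => a b.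
    by rewrite opprB opprK addrC.
  have -> : (fun y => - rescale c s r y) = (fun y => 0 - rescale c s r y).
    by apply/funext => z; rewrite sub0r.
  apply: quad_diffB; first exact: quad_diff_cst.
  apply: quad_diff_sum => k; apply: quad_diffZ; apply: quad_diffB.
    exact/quad_diff_jinv/px/(frame_first_idem Fc (ltn_ord k)).
  exact/quad_diff_jinv/px/(frame_first_idem Fc (ltnW (ltn_ord k))).
have Dlin : linear D.
  move=> a v w; rewrite /D scaler_sumr -big_split; apply: eq_bigr => k _ /=.
  rewrite !qrepD !qrepZ; move: (P (pinverse c k.+1 x) v) (P (pinverse c k x) v)
    (P (pinverse c k.+1 x) w) (P (pinverse c k x) w) => p1 p2 p3 p4.
  by pair_with z; ring.
have [C DC] : exists C, forall v, `|D v| <= C * `|v|.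
  have b k : exists C, 0 < C /\ forall v, `|P (pinverse c k x) v| <= C * `|v|.
    by have [C C0 CP] := qrep_bound (pinverse c k x); exists C.
  have [f fP] := choice b.
  exists (\sum_(k < r) s k * (f k.+1 + f k)) => v.
  apply: le_trans (ler_norm_sum _ _ _) _; rewrite mulr_suml; apply: ler_sum => k _.
  rewrite normrZ gtr0_norm ?s0// -mulrA ler_wpM2l ?(ltW (s0 _))//.
  by apply: le_trans (ler_normB _ _) _; rewrite mulrDl lerD ?(fP _).2.
have [f fE fc] := linear_continuous_of_bound Dlin DC.
by rewrite -[RHS]/(D y) -fE; rewrite -fE in HD; rewrite (quad_diffP fc HD).
Qed.

Lemma variance_functionE m y : (0 < r)%N -> posin e m ->
  variance_function B mu m y = (s 0)^-1 *: P m y +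
    \sum_(1 <= k < r) ((s k)^-1 - (s k.-1)^-1) *: P (m - pinverse c k (jinv mul e m)) y.
Proof.
move=> r0 pm; have [x px xm] := rescale_surj Fc s0 pm.
have psi : inverse_mean_map B mu m = x by rewrite -xm inverse_mean_mapE.
rewrite /variance_function psi diff_gradient_cumulant//.
pose q k := pinverse c k.+1 x - pinverse c k x.
have WE k : pinverse c k x = \sum_(i < k) q i.
  elim: k => [|k IH]; first by rewrite big_ord0 (pinverse0 Fc).
  by rewrite big_ord_recr /= -IH addrC subrK.
transitivity (\sum_(k < r) s k *: (P (\sum_(i < k.+1) q i) y - P (\sum_(i < k) q i) y)).
  by apply: eq_bigr => k _; rewrite -!WE.
rewrite (@qrep_rescale q s r y) => [|i ir]; last by rewrite lt0r_neq0// s0.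
have SE k : (k <= r)%N -> \sum_(i < k) s i *: q i = pinverse c k (jinv mul e m).
  by move=> kr; rewrite -{1}xm pinverse_jinv_rescale.
(* In the term [k = 0] the default coefficient and [pinverse0] leave $s_0^{-1}P(m)$, the leading
   term of the formula. *)
transitivity (\sum_(0 <= k < r) ((s k)^-1 - (if k is j.+1 then (s j)^-1 else 0)) *:
   P (m - pinverse c k (jinv mul e m)) y).
  rewrite big_mkord; apply: eq_bigr => k _; rewrite !SE ?(ltnW (ltn_ord k))//.
  by rewrite (pinverse_size Fc) (jinvK e_idem).
rewrite big_ltn//= (pinverse0 Fc) ?subr0; last exact: (jinv_posin e_idem).
by congr (_ + _); apply: eq_big_nat => -[|k] // /andP[].
Qed.

End Family.

(** * Reversal of the frame *)

Lemma jdet_jinv u x : idem u -> posin u x -> jdet mul u (jinv mul u x) = (jdet mul u x)^-1.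
Proof.
move=> uu /(posinP uu)[c [a [Fc -> a0]]].
have a1 i : (i < size c)%N -> a i != 0 by move=> /a0 /lt0r_neq0.
rewrite (jinv_fsum uu Fc)// !(jdet_fsum uu Fc)//; first by rewrite prodfV.
by move=> i /a0; rewrite invr_gt0.
Qed.

Lemma orth_system3 a v c : idem a -> idem v -> idem c -> a ** v = 0 -> a ** c = 0 -> v ** c = 0 ->
  orth_system (fun i : 'I_3 => [:: a; v; c]`_i).
Proof.
move=> aa vv cc av ac vc; split; first by case=> [[|[|[|]]]].
case=> [[|[|[|i]]] //= ?] [[|[|[|j]]] //= ?] _ //.
- by rewrite jmulC.
- by rewrite jmulC.
- by rewrite jmulC.
Qed.

(** On $V_{1/2}(c)$, the operator $2L(v)$ is the projection onto the Peirce space of the pair [v],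
    [c]. *)
Lemma half_component a v c z : idem a -> idem v -> idem c ->
  a ** v = 0 -> a ** c = 0 -> v ** c = 0 -> c ** z = 2^-1 *: z ->
  [/\ c ** (2 *: (v ** z)) = 2^-1 *: (2 *: (v ** z)),
      v ** (2 *: (v ** z)) = 2^-1 *: (2 *: (v ** z)) & a ** (2 *: (v ** z)) = 0].
Proof.
move=> aa vv cc av ac vc cz; have od := orth_system3 aa vv cc av ac vc.
have H1 := @osys_pair _ _ od (@Ordinal 3 1 isT) (@Ordinal 3 2 isT) z isT.
have H2 := @osys_triple _ _ od (@Ordinal 3 0 isT) (@Ordinal 3 1 isT) (@Ordinal 3 2 isT) z isT isT isT.
have H3 := @osys_comm _ _ od (@Ordinal 3 1 isT) (@Ordinal 3 2 isT) z.
rewrite /= cz !jmulZr in H1 H2 H3; rewrite !jmulZr -H3; split.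
- by rewrite !scalerA mulrC.
- by pair_with t; pair_eq H1 t; lra.
by move: H2 => /eqP; rewrite scaler_eq0 invr_eq0 pnatr_eq0 /= => /eqP ->; rewrite scaler0.
Qed.

(** Compressing the rank-one matrix of $(\zeta,1)$ to the block of $v+c$ deletes the entries of
    $\zeta$ that belong to $a$. The cross term $z_1z_2$ is killed, and $z_2^2$ leaves only a
    multiple of $c$, which the correction in [sq0] cancels. *)
Lemma qrep_schur_lift a v c z : idem a -> idem v -> primitive_idempotent mul e c ->
  a ** v = 0 -> a ** c = 0 -> v ** c = 0 ->
  c ** z = 2^-1 *: z -> (a + v) ** z = 2^-1 *: z ->
  P (v + c) (schur_lift c z) = schur_lift c (2 *: (v ** z)).
Proof.
move=> aa vv cP av ac vc cz avz; have cc := primitive_idem cP.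
have va : v ** a = 0 by rewrite jmulC.
have [c1 v1 a1] := half_component aa vv cc av ac vc cz.
have [c2 a2 v2] := half_component vv aa cc va vc ac cz.
have zE : z = 2 *: (v ** z) + 2 *: (a ** z).
  by move: avz; rewrite jmulDl => H; pair_with t; pair_eq H t; lra.
move: (2 *: (v ** z)) (2 *: (a ** z)) zE c1 v1 a1 c2 a2 v2 => z1 z2 zE c1 v1 a1 c2 a2 v2.
have bb : idem (v + c) := add_idem vv cP vc.
have bc : (v + c) ** c = c by rewrite jmulDl vc cc add0r.
have b1 : (v + c) ** z1 = z1 by rewrite jmulDl c1 v1; pair_with t; lra.
have b2 : (v + c) ** z2 = 2^-1 *: z2 by rewrite jmulDl c2 v2 add0r.
have b12 : P (v + c) (z1 ** z2) = 0.
  by apply: qrep_idem_half => //; rewrite (peirce_comm1 bb)// b2 jmulZr.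
have b11 : P (v + c) (z1 ** z1) = z1 ** z1.
  by apply: qrep_idem1 => //; exact: peirce1_mul.
have b22 : P (v + c) (z2 ** z2) = (B z2 z2 / 2) *: c.
  have aZ := sq0_in aa cP ac c2 a2; have cZ := sq0P cP c2.
  rewrite (sq0E c z2) qrepD qrepZ (qrep_idem1 bb bc).
  rewrite (_ : P (v + c) (sq0 c z2) = 0) ?addr0//; apply: qrep_idem0 => //.
  rewrite jmulDl cZ addr0 jmulC; exact: (peirce10_mul aa aZ av).
have B12 : B z1 z2 = 0.
  by have := Bassoc v z1 z2; rewrite v1 v2 B0r BZl; lra.
rewrite /schur_lift /sq0 -scaleNr !qrepD !qrepZ zE !(jmulDl, jmulDr) !qrepD.
rewrite (jmulC z2 z1) b12 b11 b22 (qrep_idem1 bb bc) (qrep_idem1 bb b1) (qrep_idem_half bb b2).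
rewrite !(BDl, BDr) (BC z2 z1) B12.
by pair_with t; ring.
Qed.

Section Reversal.
Variable c : seq V.
Hypothesis Fc : jordan_frame mul e c.
Local Notation r := (size c).
Local Notation u := (frame_first c).

Let v k m := u m - u k.

Let vS k m : v k m.+1 = v k m + c`_m.
Proof. by rewrite /v frame_firstS addrAC. Qed.

Let v_idem k m : (k <= m)%N -> (m <= r)%N -> idem (v k m).
Proof.
move=> km mr; apply: idem_sub.
- exact: (frame_first_idem Fc).
- exact/(frame_first_idem Fc)/(leq_trans km).
- exact: (frame_first_mul_le Fc).
Qed.

Let uv k m : (k <= m)%N -> (m <= r)%N -> u k ** v k m = 0.
Proof.
move=> km mr; apply: idem_subM; first exact/(frame_first_idem Fc)/(leq_trans km).
exact: (frame_first_mul_le Fc).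
Qed.

(** Passing from $m$ to $m+1$ adds to $W_m$ and to its compression a rank-one lift with the same
    factor $l$, and [jdet_lift] multiplies both determinants by $l$. *)
Lemma complement_chain k m x : (k <= m)%N -> (m <= r)%N -> posin e x ->
  posin (v k m) (P (v k m) (pinverse c m x)) /\
  jdet mul (v k m) (P (v k m) (pinverse c m x)) * jdet mul (u k) (pinverse c k x) =
  jdet mul (u m) (pinverse c m x).
Proof.
move=> + + px; elim: m => [|m IH].
  rewrite leqn0 => /eqP -> _; rewrite /v subrr /qrep !jmul0l scaler0 subr0 jdet0 mul1r.
  by split=> //; exact: posin0.
rewrite leq_eqVlt => /orP[/eqP -> mr|].
  rewrite /v subrr /qrep !jmul0l scaler0 subr0 jdet0 mul1r.
  by split=> //; exact: posin0.
rewrite ltnS => km mr; have [pv dv] := IH km (ltnW mr).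
have [z [l [cz uz l0 WE]]] := pinverse_step Fc mr px.
have cP := frame_elt_primitive Fc mr.
have im := frame_first_idem Fc (ltnW mr); have ik := frame_first_idem Fc (leq_trans km (ltnW mr)).
have vv := v_idem km (ltnW mr).
have uc : u k ** c`_m = 0 by rewrite (frame_first_mul Fc (leq_trans km (ltnW mr)) mr) ltnNge km scale0r.
have vc : v k m ** c`_m = 0 by rewrite /v jmulDl jmulNl uc (frame_first_orth Fc mr) subr0.
have um : u k + v k m = u m by rewrite /v addrC subrK.
have Wm := pinverse_in Fc (ltnW mr) px.
have PW : P (v k m.+1) (pinverse c m x) = P (v k m) (pinverse c m x).
  have uvm : u m ** v k m = v k m.
    by rewrite /v jmulDr jmulNr im (frame_first_mul_le Fc km (ltnW mr)).
  have cW w : u m ** w = w -> c`_m ** w = 0.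
    by move=> uw; exact: (mul_c im (frame_first_orth Fc mr) uw).
  have uvW : u m ** (v k m ** pinverse c m x) = v k m ** pinverse c m x by exact: peirce1_mul.
  have vcc : idem (v k m + c`_m) := add_idem vv cP vc.
  have qrep_add w y : idem w -> idem (w + c`_m) -> c`_m ** y = 0 -> c`_m ** (w ** y) = 0 ->
      P (w + c`_m) y = P w y.
    by move=> ww wc cy cwy; rewrite /qrep wc ww !(jmulDl, jmulDr) cy !jmul0r cwy !addr0.
  by rewrite vS qrep_add// cW.
have PE : P (v k m.+1) (pinverse c m.+1 x) =
    P (v k m) (pinverse c m x) + l *: schur_lift c`_m (2 *: (v k m ** z)).
  rewrite WE qrepD qrepZ PW vS (qrep_schur_lift ik vv cP (uv km (ltnW mr)) uc vc cz)//.
  by rewrite um.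
have [c1 v1 _] := half_component ik vv (primitive_idem cP) (uv km (ltnW mr)) uc vc cz.
rewrite PE vS; split; first exact: (posin_lift vv cP vc c1 v1 pv l0).
rewrite (jdet_lift vv cP vc pv c1 v1 l0) mulrAC dv frame_firstS WE.
by rewrite (jdet_lift im cP (frame_first_orth Fc mr) (pinverse_posin Fc (ltnW mr) px) cz uz l0).
Qed.

Lemma frame_last_complement k : (k <= r)%N -> frame_last c (r - k) = v k r.
Proof.
move=> kr; rewrite /frame_last /v /frame_first subKn// (big_cat_nat (leq0n k) kr) /=.
by rewrite addrC addrK.
Qed.

(** Jacobi's identity for complementary minors: [complement_chain] is applied to $x^{-1}$, whose
    full chain ends in $x$. *)
Lemma minor_jinv k x : (k <= r)%N -> posin e x ->
  jdet mul (frame_last c (r - k)) (P (frame_last c (r - k)) x) =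
  jdet mul e x * minor c k (jinv mul e x).
Proof.
move=> kr px; have py := jinv_posin e_idem px.
have [_] := complement_chain kr (leqnn r) py.
rewrite -frame_last_complement// (pinverse_size Fc) (jinvK e_idem)// (frame_first_size Fc).
rewrite /pinverse jdet_jinv; last 2 first.
- exact: frame_first_idem.
- exact/posin_qrep/py/frame_first_idem.
rewrite -/(minor c k _) => <-; rewrite divfK// lt0r_neq0//.
exact: minor_gt0.
Qed.

End Reversal.

(** * Logarithm of the power function *)

Section PowerFunction.
Variables (r : nat) (c : r.-tuple V) (s : r.-tuple R).
Hypotheses (Fc : jordan_frame mul e c) (r0 : (0 < r)%N).

Let sz : size c = r := size_tuple c.

Lemma principal_minorE k x : (k <= r)%N -> principal_minor mul e c k x = minor c k x.
Proof. by move=> kr; rewrite /principal_minor orth_projE//; apply: frame_first_idem => //; rewrite sz. Qed.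

Lemma abel_sum (a D : nat -> R) n : D 0 = 0 -> (0 < n)%N ->
  \sum_(1 <= k < n) (a k.-1 - a k) * D k + a n.-1 * D n =
  \sum_(k < n) a k * (D k.+1 - D k).
Proof.
move=> D0; case: n => // n _; elim: n => [|n IH].
  by rewrite big_geq// add0r big_ord1 D0 subr0.
by rewrite big_ord_recr /= -IH big_nat_recr //=; ring.
Qed.

Lemma ln_prod_nat (F : nat -> R) m n : (forall k, (m <= k < n)%N -> 0 < F k) ->
  0 < \prod_(m <= k < n) F k /\ ln (\prod_(m <= k < n) F k) = \sum_(m <= k < n) ln (F k).
Proof.
elim: n => [|n IH] F0; first by rewrite !big_geq// ln1.
have [mn|nm] := leqP m n; last by rewrite !big_geq// ln1.
have [|p0 E] := IH; first by move=> k /andP[mk kn]; rewrite F0// mk ltnW.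
have Fn : 0 < F n by rewrite F0// mn /=.
by rewrite !big_nat_recr//= lnM ?posrE// E; split=> //; exact: mulr_gt0.
Qed.

Lemma gpower_ln x : posin e x -> 0 < gpower mul e c s x /\
  ln (gpower mul e c s x) = \sum_(k < r) s`_k * (ln (minor c k.+1 x) - ln (minor c k x)).
Proof.
move=> px.
have m0 k : (k <= r)%N -> 0 < minor c k x by rewrite -{1}sz => kr; exact: minor_gt0.
have pE k : (k <= r)%N -> principal_minor mul e c k x = minor c k x.
  exact: principal_minorE.
rewrite -(@abel_sum (nth 0 s) (fun k => ln (minor c k x)))//; last by rewrite minor0 ln1.
have -> : gpower mul e c s x =
    (\prod_(1 <= k < r) minor c k x `^ (s`_k.-1 - s`_k)) * minor c r x `^ s`_r.-1.
  rewrite /gpower pE//; congr (_ * _); apply: eq_big_nat => k /andP[_ kr].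
  by rewrite pE// ltnW.
have [|p0 E] := @ln_prod_nat (fun k => minor c k x `^ (s`_k.-1 - s`_k)) 1 r.
  by move=> k /andP[_ kr]; apply: powR_gt0; apply: m0; exact: ltnW.
have q0 : 0 < minor c r x `^ s`_r.-1 by apply: powR_gt0; exact: m0.
split; first exact: mulr_gt0.
rewrite lnM ?posrE// E ln_powR; congr (_ + _); apply: eq_bigr => k _.
by rewrite ln_powR.
Qed.

End PowerFunction.

(** * The two variance formulas *)

Section Variance.
Variables (r : nat) (c : r.-tuple V) (s : r.-tuple R).
Hypotheses (Fc : jordan_frame mul e c) (r0 : (0 < r)%N).
Hypothesis s0 : forall k, (k < r)%N -> 0 < s`_k.
Variable mu : {measure set (borelType V) -> \bar R}.

Let sz : size c = r := size_tuple c.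

Lemma variance_gpower :
  (forall x, symmetric_cone mul x ->
     laplace_transform B mu x = (gpower mul e c (map_tuple -%R s) x)%:E) ->
  forall m, symmetric_cone mul m -> forall y,
    variance_function B mu m y = (s`_0)^-1 *: P m y +
      \sum_(2 <= i < r.+1) ((s`_i.-1)^-1 - (s`_i.-2)^-1) *:
        P (m - jinv mul (frame_first c i.-1)
                 (orth_proj mul e (frame_first c i.-1) (jinv mul e m))) y.
Proof.
move=> L m /symmetric_coneE pm y.
have G x : posin e x -> 0 < gpower mul e c (map_tuple -%R s) x /\
    ln (gpower mul e c (map_tuple -%R s) x) = log_power c (nth 0 s) x.
  move=> px; have [p0 E] := gpower_ln (map_tuple -%R s) Fc r0 px; split=> //.
  rewrite E /log_power sz -sumrN; apply: eq_bigr => k _.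
  by rewrite (nth_map 0) ?size_tuple// mulNr.
rewrite (@variance_functionE c Fc (nth 0 s) _ mu (gpower mul e c (map_tuple -%R s)))//.
- rewrite sz [in RHS]big_add1 /=; congr (_ + _); apply: eq_big_nat => k /andP[_ kr].
  by rewrite orth_projE//; apply: frame_first_idem => //; rewrite sz ltnW.
- by move=> k; rewrite sz; exact: s0.
- by move=> x /G[].
- by move=> x /G[].
- by move=> x px; apply: L; apply/symmetric_coneE.
- by rewrite sz.
Qed.

Lemma frame_rev : jordan_frame mul e (rev c).
Proof.
case: Fc => c1 c0 cs; split; last by rewrite (perm_big c) // perm_rev.
- move=> i; rewrite size_rev => ic; rewrite nth_rev//; apply: c1.
  by rewrite ltn_subrL /= (leq_ltn_trans _ ic).
- move=> i j; rewrite size_rev => ic jc ij; rewrite !nth_rev//; apply: c0.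
  + by rewrite ltn_subrL /= (leq_ltn_trans _ ic).
  + by rewrite ltn_subrL /= (leq_ltn_trans _ jc).
  + apply: contra ij => /eqP /(congr1 (fun k => size c - k.+1)%N).
    by rewrite !subnSK// !subKn 1?ltnW// => ->.
Qed.

Lemma frame_first_rev k : (k <= r)%N -> frame_first (rev c) k = frame_last c k.
Proof.
move=> kr; rewrite /frame_first /frame_last sz big_nat_rev add0n.
rewrite -[X in _ = \sum_(X <= _ < _) _](add0n (r - k)%N) big_addn subKn//.
apply: eq_big_nat => i /andP[_ ik]; rewrite nth_rev ?sz; last first.
  by rewrite (leq_trans _ kr)// ltn_subrL (leq_ltn_trans _ ik).
by congr (_`__); lia.
Qed.

Lemma minor_rev k x : (k <= r)%N -> posin e x ->
  minor (rev c) (r - k) x = jdet mul e x * minor c k (jinv mul e x).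
Proof.
move=> kr px; have := @minor_jinv c Fc k x; rewrite sz => H.
by rewrite /minor frame_first_rev ?leq_subr//; exact: H.
Qed.

Let s' k := s`_(r.-1 - k).

(** The factor $\det x$ in [minor_rev] cancels in consecutive differences, and the reversed order of
    the minors absorbs the sign. *)
Lemma log_power_rev x : posin e x -> log_power (rev c) s' x =
  \sum_(k < r) s`_k * (ln (minor c k.+1 (jinv mul e x)) - ln (minor c k (jinv mul e x))).
Proof.
move=> px; have py := jinv_posin e_idem px.
rewrite /log_power size_rev sz -sumrN (reindex_inj rev_ord_inj) /=; apply: eq_bigr => k _.
have kr := ltn_ord k.
have -> : s' (r - k.+1) = s`_k by rewrite /s'; congr (_`__); lia.
have -> : (r - k.+1).+1 = (r - k)%N by lia.
have d0 := jdet_gt0 e_idem px.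
have m0 j : (j <= r)%N -> 0 < minor c j (jinv mul e x).
  by move=> jr; apply: minor_gt0 => //; rewrite sz.
rewrite !minor_rev ?(ltnW kr)// !lnM ?posrE ?m0 ?(ltnW kr)//.
by ring.
Qed.

Lemma variance_gpower_jinv :
  (forall x, symmetric_cone mul x ->
     laplace_transform B mu x = (gpower mul e c s (jinv mul e x))%:E) ->
  forall m, symmetric_cone mul m -> forall y,
    variance_function B mu m y = (s`_r.-1)^-1 *: P m y +
      \sum_(1 <= k < r) ((s`_k.-1)^-1 - (s`_k)^-1) *:
        P (m - jinv mul (frame_last c (r - k))
                 (orth_proj mul e (frame_last c (r - k)) (jinv mul e m))) y.
Proof.
move=> L m /symmetric_coneE pm y.
have G x : posin e x -> 0 < gpower mul e c s (jinv mul e x) /\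
    ln (gpower mul e c s (jinv mul e x)) = log_power (rev c) s' x.
  move=> px; rewrite log_power_rev//; apply: gpower_ln => //.
  exact: (jinv_posin e_idem).
rewrite (@variance_functionE _ frame_rev s' _ mu (fun x => gpower mul e c s (jinv mul e x))).
- rewrite size_rev sz {1}/s' subn0; congr (_ + _).
  rewrite big_nat_rev add1n; apply: eq_big_nat => k /andP[k1 kr]; rewrite subSS.
  have -> : s' (r - k) = s`_k.-1 by rewrite /s'; congr (_`__); lia.
  have -> : s' (r - k).-1 = s`_k by rewrite /s'; congr (_`__); lia.
  rewrite -frame_first_rev ?leq_subr// orth_projE//.
  by apply: (frame_first_idem frame_rev); rewrite size_rev sz leq_subr.
- by move=> k; rewrite size_rev sz => kr; apply: s0; lia.
- by move=> x /G[].
- by move=> x /G[].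
- by move=> x px; apply: L; apply/symmetric_coneE.
- by rewrite size_rev sz.
- exact: pm.
Qed.

End Variance.

End EuclideanJordan.

Theorem proposition8p1 (R : realType) (V : normedModType R)
    (mul : V -> V -> V) (e : V) (r : nat) (c : r.-tuple V) (s : r.-tuple R) :
  simple_euclidean_jordan_algebra mul e ->
  jordan_frame mul e c ->
  (forall k, (k < r)%N -> 0 < s`_k) ->
  (forall mu : {measure set (borelType V) -> \bar R},
     (forall theta, symmetric_cone mul theta ->
        laplace_transform (ip mul e) mu theta =
          (gpower mul e c (map_tuple -%R s) theta)%:E) ->
     forall m, symmetric_cone mul m -> forall y,
       variance_function (ip mul e) mu m y =
         (s`_0)^-1 *: qrep mul m y +
         \sum_(2 <= i < r.+1) ((s`_i.-1)^-1 - (s`_i.-2)^-1) *: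
           qrep mul
             (m - jinv mul (frame_first c i.-1)
                    (orth_proj mul e (frame_first c i.-1) (jinv mul e m)))
             y)
  /\
  (forall mu : {measure set (borelType V) -> \bar R},
     (forall theta, symmetric_cone mul theta ->
        laplace_transform (ip mul e) mu theta =
          (gpower mul e c s (jinv mul e theta))%:E) ->
     forall m, symmetric_cone mul m -> forall y,
       variance_function (ip mul e) mu m y =
         (s`_r.-1)^-1 *: qrep mul m y +
         \sum_(1 <= k < r) ((s`_k.-1)^-1 - (s`_k)^-1) *:
           qrep mul
             (m - jinv mul (frame_last c (r - k))
                    (orth_proj mul e (frame_last c (r - k)) (jinv mul e m)))
             y).
Proof.
move=> simple Fc s0; have [HJ e0 _] := simple; have [B0 HB0] := euclidean_form HJ.
have [k k0 kP] := simple_norm HJ HB0 simple; have [B0C B0P B0pos B0A] := HB0.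
(* All primitive idempotents have the same squared norm [k]; dividing by it gives them norm 1, and
   [ipE] then identifies the form with the trace form. *)
pose B x y := k^-1 * B0 x y.
have HB : associative_inner_product mul B.
  split=> [x y|x a y z|x x0|x y z]; rewrite /B.
  - by rewrite B0C.
  - by have := B0P x a y z; rewrite /= => ->; rewrite mulrDr /= mulrCA.
  - by rewrite mulr_gt0 ?invr_gt0// B0pos.
  - by rewrite B0A.
have HB1 p : primitive_idempotent mul e p -> B p p = 1.
  by move=> /kP E; rewrite /B E mulVf// gt_eqF.
have r0 : (0 < r)%N.
  rewrite lt0n; apply: contra e0 => /eqP r0; have [_ _ <-] := Fc.
  by rewrite (size0nil (etrans (size_tuple c) r0)) big_nil.
rewrite (ipE HJ HB HB1); split=> mu L m pm y.
- exact: (variance_gpower HJ HB HB1 Fc r0 s0 L pm).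
- exact: (variance_gpower_jinv HJ HB HB1 Fc r0 s0 L pm).
Qed.
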